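(* Let $d\ge 2$, let $\Omega\subset\mathbb{R}^d$ be a bounded smooth domain, and let $\gamma>1$. Let $\mu(\rho)=a\rho^{\alpha}$ and $\lambda(\rho)=b\rho^{\beta}$ with $a>0$, $2a+db\ge 0$, satisfy $\mu(\rho)\ge 0$ and $2\mu(\rho)+d\lambda(\rho)\ge 0$ for all $\rho\ge 0$. Let $(\rho(x,t),\mathbf{u}(x,t))$ be a classical solution on $\Omega\times[0,T)$, where $T\in(0,\infty]$ is its maximal time of existence, of the compressible Navier-Stokes system $$\rho_t+\operatorname{div}(\rho\mathbf{u})=0,\qquad (\rho\mathbf{u})_t+\operatorname{div}(\rho\mathbf{u}\otimes\mathbf{u})-\operatorname{div}(2\mu(\rho)D(\mathbf{u}))-\nabla(\lambda(\rho)\operatorname{div}\mathbf{u})+\nabla P=0,\qquad P=\rho^{\gamma},$$ with initial data $\rho(x,0)=\rho_0(x)$, $\mathbf{u}(x,0)=\mathbf{u}_0(x)$, supplied with a suitable boundary condition on $\partial\Omega$. Suppose that $\rho_0$ admits an isolated mass group $(U,V)$ in $\Omega$, and that one of the following holds: (1) $\alpha=\beta\in(0,+\infty)$, $2a+db=0$, and $M_0$ is finite; (2) $\alpha,\beta\in(0,\gamma]$, and $M_0,E_0$ are finite; (3) $\alpha=\beta\in(\gamma,\kappa\gamma]$, $2a(\alpha-1)=b$, where $\kappa$ is any number in $[1,2)$ when $d=2$ and $\kappa=\frac{d+2}{d}$ when $d\ge 3$, and $M_0,E_0,E_1$ are finite. Then the classical solution $(\rho,\mathbf{u})$ blows up in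 finite time, i.e. its maximal time of existence satisfies $T<\infty$.
   Context: Notation: $D(\mathbf{u})=\frac12(\nabla\mathbf{u}+\nabla\mathbf{u}^\top)$. Classical solution: a pair $(\rho,\mathbf{u})$ is a classical solution on $\Omega\times[0,T)$ (to the initial boundary value problem with a given boundary condition on $\partial\Omega$) if the nonnegative function $\rho\in C^1(\Omega\times[0,T))$ and the vector field $\mathbf{u}\in C^1([0,T);C^2(\Omega))$ satisfy the system pointwise on $\Omega\times[0,T)$, take on the initial condition continuously, and satisfy the boundary condition continuously. Boundary condition: ''suitable'' means any physical boundary condition (for example the Dirichlet or Navier conditions on the velocity) for which particle paths, i.e. solutions $X(a,t)$ of $\frac{d}{dt}X(a,t)=\mathbf{u}(X(a,t),t)$, $X(a,0)=a$, starting from $a\in\overline{U}$ are defined for all $t\in[0,T)$ and stay in $\Omega$. Isolated mass group: let $V\subset U$ be two bounded open subsets of $\Omega$. The pair $(U,V)$ is an isolated mass group of the initial density $\rho_0$ if $V\subset\overline{V}\subset U\subset\overline{U}\subset\Omega$, $U$ is connected, $\rho_0(x)=0$ for $x\in U\setminus V$, and $\int_V\rho_0(x)\,dx>0$. Constants: $$M_0=\int_V\rho_0\,dx,\quad E_0=\int_V\Big(\tfrac12\rho_0|\mathbf{u}_0|^2+\tfrac{1}{\gamma-1}\rho_0^{\gamma}\Big)dx,\quad E_1=\int_V\Big(\tfrac12\rho_0\big|\mathbf{u}_0+2\mu'(\rho_0)\nabla\log\rho_0\big|^2+\tfrac{1}{\gamma-1}\rho_0^{\gamma}\Big)dx,$$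 where the integrand of $E_1$ is taken to be zero where $\rho_0=0$. The general pressure law is $P=A\rho^\gamma$ with $A>0$ constant, and $A$ is set to $1$. *)

(* Defs.v *)
From HB Require Import structures.
From mathcomp Require Import all_boot all_order all_algebra.
From mathcomp Require Import all_classical all_reals all_analysis.

Set Implicit Arguments.
Unset Strict Implicit.
Unset Printing Implicit Defensive.
Import Order.TTheory GRing.Theory Num.Theory.
Import numFieldNormedType.Exports.
Local Open Scope classical_set_scope.
Local Open Scope ring_scope.

(* It is built on [n.-tuple R], the library's measurable type for R^n, as the
   n-fold product of the Lebesgue measure of R:  lambda^0 is the Dirac mass at
   the empty tuple, and lambda^(n+1) is the image of lambda \x lambda^n under
   (x, t) |-> x :: t. *)
Section lebesgue_tuple.
Context {R : realType}.
Local Notation mR := (measurableTypeR R).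

Definition tcons n (p : mR * n.-tuple mR) : n.+1.-tuple mR :=
  [tuple of p.1 :: p.2].

Lemma measurable_tcons n : measurable_fun [set: mR * n.-tuple mR] (@tcons n).
Proof. exact: measurable_cons. Qed.

Section step.
Variables (n : nat) (m : {sigma_finite_measure set (n.-tuple mR) -> \bar R}).

Definition tuple_step : set (n.+1.-tuple mR) -> \bar R :=
  pushforward (lebesgue_measure \x m)%E (@tcons n).

Let tuple_step0 : tuple_step set0 = 0%E.
Proof. by rewrite /tuple_step /pushforward preimage_set0 measure0. Qed.

Let tuple_step_ge0 A : (0 <= tuple_step A)%E.
Proof. by rewrite /tuple_step /pushforward; exact: measure_ge0. Qed.

Let tuple_step_sigma_additive : semi_sigma_additive tuple_step.
Proof.
move=> F mF tF mUF; rewrite /tuple_step /pushforward preimage_bigcup.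
have mcons k : measurable (@tcons n @^-1` F k).
  by rewrite -[X in measurable X]setTI; exact: measurable_tcons.
apply: measure_semi_sigma_additive => //.
- apply/trivIsetP => /= i j _ _ ij; rewrite -preimage_setI.
  by move/trivIsetP : tF => /(_ _ _ _ _ ij) ->//; rewrite preimage_set0.
- rewrite -preimage_bigcup -[X in measurable X]setTI.
  exact: measurable_tcons.
Qed.

HB.instance Definition _ := isMeasure.Build _ _ _
  tuple_step tuple_step0 tuple_step_ge0 tuple_step_sigma_additive.

Let tuple_step_sigma_finite : sigma_finite setT tuple_step.
Proof.
have /sigma_finiteP[F [TF ndF Foo]] := sigma_finiteT (@lebesgue_measure R).
have /sigma_finiteP[G [TG ndG Goo]] := sigma_finiteT m.
pose uncons (t : n.+1.-tuple mR) : mR * n.-tuple mR :=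
  (tnth t ord0, [tuple of behead t]).
have unconsK t : uncons (tcons t) = t.
  by case: t => x t; congr pair; apply/val_inj.
have muncons : measurable_fun setT uncons.
  apply/measurable_fun_pairP; split; first exact: measurable_tnth.
  exact: measurable_behead.
exists (fun k => uncons @^-1` (F k `*` G k)).
  rewrite -preimage_bigcup (_ : \bigcup_k _ = setT)// predeqE => -[x y].
  split=> // _; have [i _ Fx] : (\bigcup_i F i) x by rewrite -TF.
  have [j _ Gy] : (\bigcup_j G j) y by rewrite -TG.
  exists (maxn i j) => //; split => /=.
    by move: x Fx; exact/subsetPset/ndF/leq_maxl.
  by move: y Gy; exact/subsetPset/ndG/leq_maxr.
move=> k; have [mF Fkoo] := Foo k; have [mG Gkoo] := Goo k; split.
  by rewrite -[X in measurable X]setTI; apply: muncons => //; exact: measurableX.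
rewrite /tuple_step /pushforward -comp_preimage.
rewrite (_ : uncons \o _ = id); last by apply/funext => t /=; rewrite unconsK.
by rewrite preimage_id product_measure1E// lte_mul_pinfty// ge0_fin_numE.
Qed.

HB.instance Definition _ := Measure_isSigmaFinite.Build _ _ _
  tuple_step tuple_step_sigma_finite.

End step.

Fixpoint lebesgue_tuple (n : nat) :
    {sigma_finite_measure set (n.-tuple mR) -> \bar R} :=
  if n is k.+1 then tuple_step (lebesgue_tuple k) else \d_([tuple] : 0.-tuple mR).

End lebesgue_tuple.

Definition integral_rV (R : realType) (d : nat) (A : set 'rV[R]_d)
    (f : 'rV[R]_d -> R) : \bar R :=
  let row_of (t : d.-tuple (measurableTypeR R)) : 'rV[R]_d :=
    \row_i tnth t i in
  (\int[lebesgue_tuple d]_(t in row_of @^-1` A) (f (row_of t))%:E)%E.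

Section calculus.
Context {R : realType} {d : nat}.
Local Notation E := 'rV[R]_d.

(* Squared Euclidean norm; the library's norm on 'rV is the sup norm. *)
Definition sqnorm (v : E) : R := \sum_i v 0 i ^+ 2.

Definition basis (i : 'I_d) : E := delta_mx 0 i.

Definition grad (f : E -> R) (x : E) : E := \row_i 'D_(basis i) f x.

Definition divergence (v : E -> E) (x : E) : R :=
  \sum_i 'D_(basis i) (fun y => v y 0 i) x.

Definition tensor_divergence (S : E -> 'M[R]_d) (x : E) : E :=
  \row_i \sum_j 'D_(basis j) (fun y => S y i j) x.

Definition velocity_grad (v : E -> E) (x : E) : 'M[R]_d :=
  \matrix_(i, j) 'D_(basis j) (fun y => v y 0 i) x.

Definition sym_grad (v : E -> E) (x : E) : 'M[R]_d :=
  2^-1 *: (velocity_grad v x + (velocity_grad v x)^T).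

Fixpoint Ck {V : normedModType R} (k : nat) (W : set E) (f : E -> V) : Prop :=
  {within W, continuous f} /\
  (if k is k'.+1 then forall i,
     (forall x, W x -> derivable f x (basis i)) /\ Ck k' W ('D_(basis i) f)
   else True).

Definition smooth_on (W : set E) (f : E -> R) : Prop := forall k, Ck k W f.

(* Convergence in the Frechet space C^k(W): locally uniform convergence of all
   the partial derivatives of order at most k. *)
Fixpoint Ck_cvg {V : normedModType R} {I : Type} (k : nat) (W : set E)
    (F : set_system I) (f : I -> E -> V) (g : E -> V) : Prop :=
  (forall K, compact K -> K `<=` W -> {uniform K, f @ F --> g}) /\
  (if k is k'.+1 then forall i,
     Ck_cvg k' W F (fun s => 'D_(basis i) (f s)) ('D_(basis i) g)
   else True).

Definition boundary (W : set E) : set E := closure W `\` W°.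

Definition bounded_smooth_domain (Omega : set E) : Prop :=
  [/\ open Omega, connected Omega, bounded_set Omega &
      forall x, boundary Omega x -> exists (W : set E) (phi : E -> R),
        [/\ open W, W x, smooth_on W phi,
            (forall y, W y -> grad phi y != 0) &
            Omega `&` W = [set y | W y /\ phi y < 0]]].

End calculus.

Section evolution.
Context {R : realType}.

(* Derivative at t of a function of time defined for t >= 0 only: it is the
   right derivative at t = 0 and the two-sided one at t > 0. *)
Definition tdiff_filter (t : R) : set_system R :=
  within [set h | 0 <= t + h] 0^'.

Definition tderivable {V : normedModType R} (f : R -> V) (t : R) : Prop :=
  cvg (h^-1 *: (f (t + h) - f t) @[h --> tdiff_filter t]).

Definition tderive {V : normedModType R} (f : R -> V) (t : R) : V :=
  lim (h^-1 *: (f (t + h) - f t) @[h --> tdiff_filter t]).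

Definition lifespan (T : \bar R) : set R := [set t | 0 <= t /\ (t%:E < T)%E].

Context {d : nat}.
Local Notation E := 'rV[R]_d.

Definition C1_spacetime (Omega : set E) (T : \bar R) (rho : R -> E -> R) :=
  let Q := lifespan T `*` Omega in
  [/\ {within Q, continuous (fun p : R * E => rho p.1 p.2)},
      (forall t x, Q (t, x) -> tderivable (rho ^~ x) t),
      (forall t x i, Q (t, x) -> derivable (rho t) x (basis i)),
      {within Q, continuous (fun p : R * E => tderive (rho ^~ p.2) p.1)} &
      forall i, {within Q, continuous
        (fun p : R * E => 'D_(basis i) (rho p.1) p.2)}].

(* u \in C^1([0, T[ ; C^2(Omega)) for the Frechet topology of C^2(Omega): the
   difference quotients converge to ut in C^2(Omega), and ut is continuous. *)
Definition C1_time_C2 (Omega : set E) (T : \bar R) (u : R -> E -> E) :=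
  exists ut : R -> E -> E, forall t, lifespan T t ->
    [/\ Ck 2 Omega (u t), Ck 2 Omega (ut t),
        Ck_cvg 2 Omega (tdiff_filter t)
          (fun h x => h^-1 *: (u (t + h) x - u t x)) (ut t) &
        Ck_cvg 2 Omega (within (lifespan T) (nbhs t)) ut (ut t)].

(* A classical C^1 density may vanish, and then mu(rho) and lambda(rho) need
   not be differentiable; that the viscous fluxes are differentiable in space
   is part of the system being satisfied pointwise. *)
Definition navier_stokes (mu lambda : R -> R) (gamma : R)
    (rho : R -> E -> R) (u : R -> E -> E) (t : R) (x : E) : Prop :=
  let viscous y := (2 * mu (rho t y)) *: sym_grad (u t) y in
  let bulk y := lambda (rho t y) * divergence (u t) y in
  [/\ tderive (rho ^~ x) t + divergence (fun y => rho t y *: u t y) x = 0,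
      differentiable viscous x, differentiable bulk x &
      tderive (fun s => rho s x *: u s x) t
      + tensor_divergence (fun y => rho t y *: ((u t y)^T *m u t y)) x
      - tensor_divergence viscous x - grad bulk x
      + grad (fun y => rho t y `^ gamma) x = 0].

(* A boundary condition is a family of constraints on (rho, u), one for each
   boundary point x and each time t, about the behaviour of (rho, u) near
   (t, x).  For instance the Dirichlet condition is
     fun x t rho u => u p.1 p.2 @[p --> within ([set s | 0 <= s] `*` Omega)
                                          (nbhs (t, x))] --> 0.  *)
Definition boundary_condition :=
  E -> R -> (R -> E -> R) -> (R -> E -> E) -> Prop.

(* C1_spacetime and C1_time_C2 include continuity at t = 0, so the initial
   data are attained continuously. *)
Record classical_solution (Omega : set E) (mu lambda : R -> R) (gamma : R)
    (bc : boundary_condition) (rho0 : E -> R) (u0 : E -> E) (T : \bar R)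
    (rho : R -> E -> R) (u : R -> E -> E) : Prop := ClassicalSolution {
  density_ge0 : forall t x, lifespan T t -> Omega x -> 0 <= rho t x ;
  density_C1 : C1_spacetime Omega T rho ;
  velocity_C1C2 : C1_time_C2 Omega T u ;
  pointwise_system : forall t x, lifespan T t -> Omega x ->
    navier_stokes mu lambda gamma rho u t x ;
  initial_condition : forall x, Omega x -> rho 0 x = rho0 x /\ u 0 x = u0 x ;
  boundary_values : forall t x, lifespan T t -> boundary Omega x ->
    bc x t rho u }.

Definition maximal_classical_solution (Omega : set E) (mu lambda : R -> R)
    (gamma : R) (bc : boundary_condition) (rho0 : E -> R) (u0 : E -> E)
    (T : \bar R) (rho : R -> E -> R) (u : R -> E -> E) : Prop :=
  [/\ (0 < T)%E,
      classical_solution Omega mu lambda gamma bc rho0 u0 T rho u &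
      forall T' rho' u',
        classical_solution Omega mu lambda gamma bc rho0 u0 T' rho' u' ->
        (forall t x, lifespan T t -> lifespan T' t -> Omega x ->
          rho' t x = rho t x /\ u' t x = u t x) ->
        (T' <= T)%E].

Definition particle_paths_stay (Omega U : set E) (T : \bar R)
    (u : R -> E -> E) : Prop :=
  forall a, closure U a -> exists X : R -> E, X 0 = a /\
    forall t, lifespan T t ->
      [/\ Omega (X t), tderivable X t & tderive X t = u t (X t)].

Definition isolated_mass_group (Omega : set E) (rho0 : E -> R) (U V : set E) :=
  [/\ [/\ open U, open V, bounded_set U & bounded_set V],
      [/\ closure V `<=` U, closure U `<=` Omega & connected U],
      (forall x, (U `\` V) x -> rho0 x = 0) &
      (0 < integral_rV V rho0)%E].

Definition mass (V : set E) (rho0 : E -> R) : \bar R := integral_rV V rho0.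

Definition energy (gamma : R) (V : set E) (rho0 : E -> R) (u0 : E -> E) :
    \bar R :=
  integral_rV V (fun x => 2^-1 * rho0 x * sqnorm (u0 x)
                          + (gamma - 1)^-1 * rho0 x `^ gamma).

Definition bd_energy (mu : R -> R) (gamma : R) (V : set E)
    (rho0 : E -> R) (u0 : E -> E) : \bar R :=
  integral_rV V (fun x => if rho0 x == 0 then 0 else
    2^-1 * rho0 x * sqnorm (u0 x + (2 * derive1 mu (rho0 x)) *:
                                     grad (fun y => ln (rho0 y)) x)
    + (gamma - 1)^-1 * rho0 x `^ gamma).

End evolution.

(* Main.v *)
Require Import Defs.
From HB Require Import structures.
From mathcomp Require Import all_boot all_order all_algebra.
From mathcomp Require Import all_classical all_reals all_analysis.
From mathcomp Require Import ring lra.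

(** The solution is assumed to exist for all times, and the mass that starts in
    [V] is followed.  Let [chi] be a cutoff that equals 1 on this mass and 0 on
    the rest of the fluid.  The second moment [F = \int chi rho |x|^2] is at most
    a constant times the mass [M], as [Omega] is bounded.  By the continuity
    equation [F' = 2 G] with [G = \int chi rho u . x], and testing the momentum
    equation against [chi x] gives the virial identity ([virial])
      [G' = \int chi (rho |u|^2 + d rho ^ gamma - p(rho) div u)],
    where [p = 2 mu + d lambda].  By convexity the pressure term is bounded below
    by a positive constant that depends on [M] only ([powR_tangent]).  The viscous
    term has no sign, but it is an exact time derivative: if [s h'(s) - h(s) = p(s)],
    then the continuity equation gives
      [(\int chi h(rho))' = - \int chi p(rho) div u]     ([transport]).
    For a sum of powers with [p >= 0], such an [h] is bounded below by an affine
    function ([entropic_powR], [viscosity_entropic]), so [\int chi h(rho)] is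
    bounded below in terms of [M].  Hence [G - \int chi h(rho)] grows at least
    linearly ([momentum_growth]), so does [G], and [F] grows quadratically, which
    is absurd ([no_global_flow]).

    Three points need care.

    Entropy at vacuum.  For small exponents [h] is not differentiable at 0.  The
    notion [entropic] replaces it by regularizations that produce [p] up to an
    error [delta] on bounded densities, with bounds that do not depend on
    [delta].  This is enough, because on a given time interval the density and
    [div u] are bounded on the support of [chi], and the error is absorbed by the
    pressure.

    Cutoff.  Only individual particle paths are given.  Around finitely many
    of them, bumps on tubes of exponentially varying radius yield a function
    [eta] that decreases along the flow and lives initially in the vacuum around
    [V], so that [eta rho] remains zero; and [chi] is locally constant where
    [eta] vanishes ([cutoff_pair_exists], [eta_rho_eq0]).  Thus the derivatives
    of [chi] never meet any mass.

    Integration.  The viscous fluxes are differentiable but their derivatives are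
    not assumed continuous one by one; only the total divergence is, through the
    momentum equation.  The divergence theorem is therefore proved by Goursat's
    bisection argument ([discrete_divergence_defect], [mean_divergence]).  The
    integral in it is a limit of averages over dyadic grids along an ultrafilter
    ([mean]), for which that argument is exact at each mesh. *)

Set Implicit Arguments.
Unset Strict Implicit.
Unset Printing Implicit Defensive.
Import Order.TTheory GRing.Theory Num.Theory.
Import numFieldNormedType.Exports.
Local Open Scope classical_set_scope.
Local Open Scope ring_scope.
Local Notation basis := Defs.basis.

(** * Dyadic averages and telescoping *)

Section dyadic_average.
Context {R : realType} {d : nat}.
Local Notation E := 'rV[R]_d.
Implicit Types (f g : E -> R) (c x y v : E) (s : R) (n : nat).

Definition corner (e : {ffun 'I_d -> bool}) : E := \row_i (e i)%:R.

Definition corner_mean (F : {ffun 'I_d -> bool} -> R) : R :=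
  (#|{: {ffun 'I_d -> bool}}|%:R)^-1 * \sum_e F e.

Fixpoint dyadic_avg n c s f : R :=
  if n is n'.+1
  then corner_mean (fun e => dyadic_avg n' (c + (s / 2) *: corner e) (s / 2) f)
  else f c.

Definition cube c s : set E := [set x | forall i, c 0 i <= x 0 i <= c 0 i + s].

Let cornersN0 : (#|{: {ffun 'I_d -> bool}}|%:R : R) != 0.
Proof. by rewrite pnatr_eq0 card_ffun card_bool expn_eq0. Qed.

Lemma corner_mean_cst k : corner_mean (fun=> k) = k.
Proof.
rewrite /corner_mean sumr_const -[k *+ _]mulr_natl.
by rewrite mulrA mulVf ?mul1r.
Qed.

Lemma corner_meanD F G :
  corner_mean (fun e => F e + G e) = corner_mean F + corner_mean G.
Proof. by rewrite /corner_mean big_split mulrDr. Qed.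

Lemma corner_meanZ k F : corner_mean (fun e => k * F e) = k * corner_mean F.
Proof. by rewrite /corner_mean -mulr_sumr mulrCA. Qed.

Lemma corner_meanB F G :
  corner_mean (fun e => F e - G e) = corner_mean F - corner_mean G.
Proof. by rewrite /corner_mean sumrB mulrBr. Qed.

Lemma ler_corner_mean F G :
  (forall e, F e <= G e) -> corner_mean F <= corner_mean G.
Proof.
move=> FG; rewrite /corner_mean ler_wpM2l ?invr_ge0 ?ler0n//.
exact: ler_sum.
Qed.

Lemma eq_corner_mean F G : F =1 G -> corner_mean F = corner_mean G.
Proof. by move=> FG; rewrite /corner_mean (eq_bigr G). Qed.

Lemma ler_norm_corner_mean F k :
  (forall e, `|F e| <= k) -> `|corner_mean F| <= k.
Proof.
move=> Fk; rewrite ler_norml; apply/andP; split.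
  rewrite -[leLHS]corner_mean_cst; apply: ler_corner_mean => e.
  by have := Fk e; rewrite ler_norml => /andP[].
rewrite -[leRHS]corner_mean_cst; apply: ler_corner_mean => e.
by have := Fk e; rewrite ler_norml => /andP[].
Qed.

Lemma cube_child c s e x : 0 <= s ->
  cube (c + (s / 2) *: corner e) (s / 2) x -> cube c s x.
Proof.
move=> s0 ex i; have := ex i; rewrite !mxE.
by case: (e i) => /= /andP[h1 h2]; apply/andP; split; lra.
Qed.

Lemma dyadic_avgD n c s f g :
  dyadic_avg n c s (fun x => f x + g x) = dyadic_avg n c s f + dyadic_avg n c s g.
Proof.
elim: n c s => //= n IH c s; rewrite -corner_meanD.
by apply: eq_corner_mean => e; rewrite IH.
Qed.

Lemma dyadic_avgZ n c s k f :
  dyadic_avg n c s (fun x => k * f x) = k * dyadic_avg n c s f.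
Proof.
elim: n c s => //= n IH c s; rewrite -corner_meanZ.
by apply: eq_corner_mean => e; rewrite IH.
Qed.

Lemma dyadic_avg_cst n c s k : dyadic_avg n c s (fun=> k) = k.
Proof.
elim: n c s => //= n IH c s; rewrite -[RHS]corner_mean_cst.
by apply: eq_corner_mean => e; rewrite IH.
Qed.

Lemma ler_dyadic_avg n c s f g : 0 <= s ->
  (forall x, cube c s x -> f x <= g x) -> dyadic_avg n c s f <= dyadic_avg n c s g.
Proof.
elim: n c s => /= [c s s0 fg|n IH c s s0 fg].
  by apply: fg => i; rewrite lexx lerDl.
apply: ler_corner_mean => e; apply: IH; first by rewrite divr_ge0.
by move=> x /(cube_child s0); exact: fg.
Qed.

Lemma ler_norm_dyadic_avg n c s f k : 0 <= s ->
  (forall x, cube c s x -> `|f x| <= k) -> `|dyadic_avg n c s f| <= k.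
Proof.
move=> s0 fk; rewrite ler_norml; apply/andP; split.
  rewrite -[leLHS](dyadic_avg_cst n c s); apply: ler_dyadic_avg => // x /fk.
  by rewrite ler_norml => /andP[].
rewrite -[leRHS](dyadic_avg_cst n c s); apply: ler_dyadic_avg => // x /fk.
by rewrite ler_norml => /andP[].
Qed.

Lemma dyadic_avg_sum n c s (I : finType) (F : I -> E -> R) :
  dyadic_avg n c s (fun x => \sum_i F i x) = \sum_i dyadic_avg n c s (F i).
Proof.
elim: n c s => //= n IH c s.
rewrite (eq_corner_mean (G := fun e => \sum_i
  dyadic_avg n (c + (s / 2) *: corner e) (s / 2) (F i))); last by move=> e; rewrite IH.
by rewrite /corner_mean exchange_big mulr_sumr.
Qed.

Lemma dyadic_avg_shift n c s v f :
  dyadic_avg n c s (fun x => f (x + v)) = dyadic_avg n (c + v) s f.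
Proof.
elim: n c s => //= n IH c s; apply: eq_corner_mean => e.
by rewrite IH addrAC.
Qed.

(** The average over the face of the cube that contains [c] and is orthogonal
    to the [j]-th axis.  Every point of that face is counted twice at each
    bisection, which is harmless for a mean and keeps the same set of corners
    as [dyadic_avg]. *)
Fixpoint face_avg (j : 'I_d) n c s f : R :=
  if n is n'.+1
  then corner_mean (fun e =>
    face_avg j n' (c + (s / 2) *: corner [ffun i => (i != j) && e i]) (s / 2) f)
  else f c.

Lemma ler_norm_face_avg j n c s f k : 0 <= s ->
  (forall x, cube c s x -> x 0 j = c 0 j -> `|f x| <= k) ->
  `|face_avg j n c s f| <= k.
Proof.
elim: n c s => /= [c s s0 fk|n IH c s s0 fk].
  by apply: fk => // i; rewrite lexx lerDl.
apply: ler_norm_corner_mean => e; apply: IH; first by rewrite divr_ge0.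
move=> x /(cube_child s0) cx xj; apply: fk => //.
by rewrite xj !mxE ffunE eqxx mulr0 addr0.
Qed.

(** Summing the increments [f (x + h e_j) - f x] over the grid of mesh
    [h = s / 2 ^ n] telescopes along the [j]-th axis. *)
Lemma dyadic_avg_telescope j n c s f :
  dyadic_avg n (c + (s / 2 ^+ n) *: basis j) s f - dyadic_avg n c s f =
  (2 ^+ n)^-1 * (face_avg j n (c + s *: basis j) s f - face_avg j n c s f).
Proof.
elim: n c s => /= [c s|n IH c s]; first by rewrite expr0 invr1 mulr1 mul1r.
pose flip (e : {ffun 'I_d -> bool}) := [ffun i => (i == j) (+) e i].
have flipK : involutive flip.
  by move=> e; apply/ffunP => i; rewrite !ffunE addbA addbb.
pose psi (e : {ffun 'I_d -> bool}) (k : R) := face_avg j n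
  (c + (s / 2) *: corner [ffun i => (i != j) && e i] + (k * s) *: basis j) (s / 2) f.
have psi_flip e : psi (flip e) = psi e.
  apply/funext => k; rewrite /psi; congr (face_avg _ _ (_ + _ *: corner _ + _) _ _).
  by apply/ffunP => i; rewrite !ffunE; case: (i == j).
have cornerE e : corner e = corner [ffun i => (i != j) && e i] + (e j)%:R *: basis j.
  apply/rowP => i; rewrite !mxE ffunE eqxx andTb.
  by have [->|_] /= := eqVneq i j; rewrite ?add0r ?mulr1// mulr0 addr0.
rewrite -!corner_meanB -corner_meanZ.
(* the increment over a child cube goes from its [j]-lower to its [j]-upper face *)
have step e : dyadic_avg n (c + (s / 2 ^+ n.+1) *: basis j + (s / 2) *: corner e) (s / 2) f
   - dyadic_avg n (c + (s / 2) *: corner e) (s / 2) f =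
   (2 ^+ n)^-1 * (psi e (2^-1 + 2^-1 * (e j)%:R) - psi e (2^-1 * (e j)%:R)).
  rewrite addrAC.
  rewrite (_ : s / 2 ^+ n.+1 = s / 2 / 2 ^+ n); last first.
  by rewrite exprS invfM mulrA.
  have e0 : c + (s / 2) *: corner e =
      c + (s / 2) *: corner [ffun i => (i != j) && e i] + (s / 2 * (e j)%:R) *: basis j.
  by rewrite [in LHS]cornerE scalerDr scalerA addrA.
  rewrite IH /psi e0 -addrA -scalerDl.
  by congr (_ * (face_avg _ _ (_ + _ *: _) _ _ - face_avg _ _ (_ + _ *: _) _ _)); ring.
rewrite (eq_corner_mean step).
have psi0 (e : {ffun 'I_d -> bool}) : face_avg j n (c + (s / 2) *: corner [ffun i => (i != j) && e i]) (s / 2) f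
    = psi e 0 by rewrite /psi mul0r scale0r addr0.
have psi1 (e : {ffun 'I_d -> bool}) : face_avg j n (c + s *: basis j
      + (s / 2) *: corner [ffun i => (i != j) && e i]) (s / 2) f = psi e 1.
  by rewrite /psi mul1r addrAC.
rewrite [RHS](eq_corner_mean (G := fun e => (2 ^+ n.+1)^-1 * (psi e 1 - psi e 0))); last first.
  by move=> e; rewrite psi0 psi1.
rewrite !corner_meanZ.
rewrite exprSr invfM -mulrA; congr (_ * _).
rewrite -corner_meanZ /corner_mean; congr (_ * _).
rewrite -mulr_sumr [X in _ = _ * X](_ : _ = 2 * \sum_(e : {ffun 'I_d -> bool})
  (psi e (2^-1 + 2^-1 * (e j)%:R) - psi e (2^-1 * (e j)%:R))); last first.
  rewrite mulr2n mulrDl mul1r [in X in _ = _ + X](reindex_inj (inv_inj flipK)).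
  rewrite -big_split.
  apply: eq_bigr => e _ /=; rewrite psi_flip !ffunE eqxx.
  have h : 2^-1 + 2^-1 = 1 :> R by field.
  by case: (e j); rewrite /= ?mulr0 ?mulr1 ?addr0 ?h; ring.
by rewrite mulrA mulVf ?mul1r// pnatr_eq0.
Qed.
End dyadic_average.

(** * Goursat's divergence theorem, discrete part *)

Section row_norm.
Context {R : realType} {d : nat}.
Local Notation E := 'rV[R]_d.

Lemma row_norm_leP (x : E) (k : R) : 0 <= k ->
  (forall i, `|x 0 i| <= k) <-> `|x| <= k.
Proof.
move=> k0; rewrite [`|x|]/Num.Def.normr/= mx_normrE; split=> [xk|].
  by apply/bigmax_leP; split => // -[i j] _ /=; rewrite ord1.
by move/bigmax_leP => [_ xk] i; exact: (xk (0, i)).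
Qed.

Lemma coord_le_norm (x : E) i : `|x 0 i| <= `|x|.
Proof. by move: i; apply/row_norm_leP. Qed.

Lemma cube_dist (c x y : E) (s : R) : 0 <= s ->
  cube c s x -> cube c s y -> `|y - x| <= s.
Proof.
move=> s0 cx cy; apply/row_norm_leP => // i; rewrite !mxE ler_norml.
have /andP[? ?] := cx i; have /andP[? ?] := cy i.
by apply/andP; split; lra.
Qed.

End row_norm.

Section goursat.
Context {R : realType} {d : nat}.
Local Notation E := 'rV[R]_d.
Implicit Types (c x : E) (s : R).

Definition discrete_divergence (h : R) (W : 'I_d -> E -> R) x : R :=
  \sum_j h^-1 * (W j (x + h *: basis j) - W j x).

Lemma dyadic_avg_divergence n c s (W : 'I_d -> E -> R) : s != 0 ->
  dyadic_avg n c s (discrete_divergence (s / 2 ^+ n) W) =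
  \sum_j s^-1 * (face_avg j n (c + s *: basis j) s (W j) - face_avg j n c s (W j)).
Proof.
move=> s0; rewrite dyadic_avg_sum; apply: eq_bigr => j _.
rewrite dyadic_avgZ.
have -> : dyadic_avg n c s (fun x => W j (x + (s / 2 ^+ n) *: basis j) - W j x)
  = dyadic_avg n (c + (s / 2 ^+ n) *: basis j) s (W j) - dyadic_avg n c s (W j).
  rewrite -dyadic_avg_shift -[X in _ = _ + X]mulN1r -dyadic_avgZ -dyadic_avgD.
  by congr dyadic_avg; apply/funext => x; rewrite mulN1r.
rewrite dyadic_avg_telescope mulrA invf_div; congr (_ * _).
by rewrite mulrAC mulfV ?mul1r// expf_neq0.
Qed.

Lemma ler_dyadic_avg_divergence n c s (W : 'I_d -> E -> R) k : 0 < s ->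
  (forall j x, cube c s x -> `|W j x| <= k) ->
  `|dyadic_avg n c s (discrete_divergence (s / 2 ^+ n) W)| <= d%:R * (2 * k / s).
Proof.
move=> s0 Wk; rewrite dyadic_avg_divergence ?gt_eqF//.
apply: le_trans (ler_norm_sum _ _ _) _.
rewrite -[X in X%:R * _](card_ord d) mulr_natl -sumr_const.
apply: ler_sum => j _; rewrite normrM gtr0_norm ?invr_gt0// mulrC.
apply: ler_wpM2r; first by rewrite invr_ge0 ltW.
have -> : 2 * k = k + k by ring.
apply: le_trans (ler_normB _ _) _.
apply: lerD; (apply: ler_norm_face_avg => [|x cx xj]; first exact: ltW).
  apply: Wk => i; have := cx i; rewrite !mxE.
  case: (eqVneq i j) => [->|ij] /=; last by rewrite mulr0 addr0.
  by rewrite xj !mxE !eqxx mulr1 => _; rewrite lexx lerDl ltW.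
exact: Wk.
Qed.

(** On a cube where [W] is affine up to [eps] times the side, the discrete
    divergence has the right mean up to [O(eps)], whatever the mesh: the affine
    part is exact, and the remainder only counts through the faces. *)
Lemma dyadic_avg_affine_defect n c s (W : 'I_d -> E -> R) (D : 'I_d -> E -> R)
    (g : E -> R) x0 (eps : R) : 0 < s ->
  (forall j, linear_for *%R (D j)) ->
  (forall j x, cube c s x -> `|W j x - W j x0 - D j (x - x0)| <= eps * s) ->
  (forall x, cube c s x -> `|g x - \sum_j D j (basis j)| <= eps) ->
  `|dyadic_avg n c s (fun x => g x - discrete_divergence (s / 2 ^+ n) W x)|
    <= (d%:R * 2 + 1) * eps.
Proof.
move=> s0 linD WD gD; set h := s / 2 ^+ n.
have h0 : h != 0 by rewrite gt_eqF// divr_gt0// exprn_gt0.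
pose Q j x := W j x - W j x0 - D j (x - x0).
have WQ x : g x - discrete_divergence h W x =
    (g x - \sum_j D j (basis j)) + -1 * discrete_divergence h Q x.
  rewrite mulN1r -addrA; congr (_ + _); rewrite -opprD; congr (- _).
  rewrite -big_split; apply: eq_bigr => j _ /=; rewrite /Q.
  by rewrite (_ : x + h *: basis j - x0 = h *: basis j + (x - x0)) ?linD; [field|rewrite addrAC addrC].
rewrite (_ : (fun x => _) = (fun x => (g x - \sum_j D j (basis j))
   + -1 * discrete_divergence h Q x)); last exact/funext.
rewrite dyadic_avgD dyadic_avgZ mulN1r.
apply: le_trans (ler_normB _ _) _; rewrite mulrDl mul1r addrC lerD//; last first.
  by apply: ler_norm_dyadic_avg; rewrite ?ltW.
apply: le_trans (ler_dyadic_avg_divergence n s0 WD) _.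
by rewrite le_eqVlt; apply/orP; left; apply/eqP; field; rewrite gt_eqF.
Qed.

Lemma exists_half_pow s (r : R) : 0 < s -> 0 < r -> exists n, s / 2 ^+ n < r.
Proof.
move=> s0 r0.
have : geometric s (2^-1) @ \oo --> (0 : R).
  by apply: cvg_geometric; rewrite ger0_norm ?invf_lt1 ?ltr1n.
move/cvgrPdist_lt => /(_ r r0) [n _ /(_ n (leqnn n))] /=.
rewrite sub0r normrN ger0_norm; last by rewrite mulr_ge0 ?exprn_ge0 ?invr_ge0 ?ltW.
by rewrite exprVn => ?; exists n.
Qed.
End goursat.

(** Only the values of [f] are compared, so no candidate derivative has to be
    exhibited: the zero map is the differential. *)
Lemma differentiable_flat {R : realType} {V W : normedModType R} (f : V -> W) x :
  (forall eps, 0 < eps -> \forall y \near x, `|f y - f x| <= eps * `|y - x|) ->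
  differentiable f x.
Proof.
move=> fx; have fo : f \o shift x = cst (f x) + (\0 : {linear V -> W}) +o_0 id.
  apply/eqaddoP => eps /fx; rewrite (near_shift 0) subr0.
  by apply: filterS => h /=; rewrite addrK /GRing.add_fun/= addr0.
have c0 : continuous (\0 : {linear V -> W}) by exact: cst_continuous.
by apply/diff_locallyP; rewrite (diff_unique c0 fo).
Qed.

Lemma differentiable_bigsum {R : realType} {V : normedModType R} n
    (f : 'I_n -> V -> R) x :
  (forall i, differentiable (f i) x) -> differentiable (fun y => \sum_i f i y) x.
Proof.
move=> df; rewrite (_ : (fun y => _) = \sum_i f i); first exact: differentiable_sum.
by apply/funext => y; rewrite fct_sumE.
Qed.

Section goursat_theorem.
Context {R : realType} {d : nat}.
Local Notation E := 'rV[R]_d.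
Implicit Types (c x : E) (s : R).

Lemma differentiable_near (f : E -> R) x (eps : R) :
  differentiable f x -> 0 < eps ->
  \forall y \near x, `|f y - f x - 'd f x (y - x)| <= eps * `|y - x|.
Proof.
move=> /diff_locallyP[_ /eqaddoP dfx] /dfx near0.
rewrite (near_shift 0) subr0; apply: filterS near0 => h /=.
by rewrite opprD addrA addrK.
Qed.

(** Subtracting the affine part reduces to a flat remainder. *)
Lemma differentiable_affine_approx (f : E -> R) x (p : 'I_d -> R) :
  (forall eps, 0 < eps -> \forall y \near x,
     `|f y - f x - \sum_j p j * (y - x) 0 j| <= eps * `|y - x|) ->
  differentiable f x.
Proof.
move=> fx; pose L (y : E) := \sum_j p j * (y - x) 0 j.
have Lx : L x = 0.
  by rewrite /L; apply: big1 => j _; rewrite subrr mxE mulr0.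
have dL : differentiable L x.
  apply: differentiable_bigsum => j.
  apply: differentiableM => //; apply: (@differentiable_comp _ _ _ _ (fun y => y - x) (fun v : E => v 0 j)).
    by [].
  exact: differentiable_coord.
rewrite (_ : f = (fun y => f y - L y) \+ L); last first.
  by apply/funext => y /=; rewrite subrK.
apply: differentiableD dL; apply: differentiable_flat => eps /fx.
by apply: filterS => y; rewrite Lx subr0 addrAC.
Qed.

(** Nested bisection: a property of a cube inherited by one of its dyadic
    children holds on arbitrarily small cubes around a common point. *)
Lemma mean_defect_localize c0 s0 (P : E -> R -> Prop) :
  0 < s0 -> P c0 s0 ->
  (forall c s, P c s -> exists e, P (c + (s / 2) *: corner e) (s / 2)) ->
  exists x, cube c0 s0 x /\
    forall r, 0 < r -> exists c s, [/\ 0 < s < r, cube c s x,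
      (forall y, cube c s y -> cube c0 s0 y) & P c s].
Proof.
move=> s0_gt0 P0 Pstep.
pose next c s := if pselect (exists e, P (c + (s / 2) *: corner e) (s / 2))
  is left ex then c + (s / 2) *: corner (projT1 (cid ex)) else c.
pose cs := fix cs m := if m is m'.+1 then next (cs m') (s0 / 2 ^+ m') else c0.
have sS m : s0 / 2 ^+ m.+1 = s0 / 2 ^+ m / 2 by rewrite exprSr invfM mulrA.
have s_gt0 m : 0 < s0 / 2 ^+ m by rewrite divr_gt0// exprn_gt0.
have Pcs m : P (cs m) (s0 / 2 ^+ m).
  elim: m => [|m IH] /=; first by rewrite expr0 divr1.
  rewrite sS /next; case: pselect => [ex|nex]; last by exfalso; apply/nex/Pstep.
  exact: (projT2 (cid ex)).
have csS m i : cs m 0 i <= cs m.+1 0 i /\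
    cs m.+1 0 i + s0 / 2 ^+ m.+1 <= cs m 0 i + s0 / 2 ^+ m.
  rewrite sS /= /next; have := s_gt0 m.
  by case: pselect => [ex|nex]; rewrite ?mxE; [case: (projT1 (cid ex) i) => /=|]; lra.
have csD m k i : cs m 0 i <= cs (m + k)%N 0 i /\
    cs (m + k)%N 0 i + s0 / 2 ^+ (m + k) <= cs m 0 i + s0 / 2 ^+ m.
  elim: k => [|k [IH1 IH2]]; first by rewrite addn0.
  have [h1 h2] := csS (m + k)%N i.
  by rewrite addnS; split; [exact: le_trans IH1 h1|exact: le_trans h2 IH2].
have cs_ub k m i : cs m 0 i <= cs k 0 i + s0 / 2 ^+ k.
  have [mk|km] := leqP m k.
    have [h _] := csD m (k - m)%N i; rewrite subnKC// in h.
    by apply: le_trans h _; rewrite lerDl ltW.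
  have [_ h] := csD k (m - k)%N i; rewrite subnKC// 1?ltnW// in h.
  by apply: le_trans h; rewrite lerDl ltW.
(* the lower corners increase, each coordinate staying below every upper one *)
pose x : E := \row_i sup (range (fun m => cs m 0 i)).
have cx m : cube (cs m) (s0 / 2 ^+ m) x.
  move=> i; rewrite mxE; apply/andP; split.
    apply: ub_le_sup; last by exists m.
    by exists (cs 0%N 0 i + s0 / 2 ^+ 0) => _ [k _ <-].
  apply: ge_sup; first by exists (cs 0%N 0 i), 0%N.
  by move=> _ [k _ <-].
have csub m y : cube (cs m) (s0 / 2 ^+ m) y -> cube c0 s0 y.
  move=> cy i; have /andP[h1 h2] := cy i.
  have [/= h3 h4] := csD 0%N m i; rewrite add0n expr0 divr1 in h3 h4.
  by apply/andP; split; [exact: le_trans h3 h1|exact: le_trans h2 h4].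
exists x; split; first exact: csub (cx 0%N).
move=> r r0; have [m hm] := exists_half_pow s0_gt0 r0.
by exists (cs m), (s0 / 2 ^+ m); split => //; rewrite ?s_gt0//; exact: csub.
Qed.
End goursat_theorem.

(** * The mean over a cube and its divergence theorem *)

Section divergence_theorem.
Context {R : realType} {d : nat}.
Local Notation E := 'rV[R]_d.
Implicit Types (c x : E) (s : R).

Lemma near_inftyS (P : nat -> Prop) :
  (\forall n \near \oo, P n.+1) -> \forall n \near \oo, P n.
Proof. by move=> [N _ NP]; exists N.+1 => // -[//|n] /= Nn; exact: NP. Qed.

(** Goursat's bisection argument: were the defect between the mean of [g] and
    the discrete fluxes of size [delta] on the cube, it would be of size
    [delta] on arbitrarily small cubes around some point, where
    differentiability of [W] makes it small. *)
Lemma discrete_divergence_defect c s (W : 'I_d -> E -> R) (g : E -> R) delta :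
  0 < s ->
  (forall j x, cube c s x -> differentiable (W j) x) ->
  (forall x, cube c s x -> g x = \sum_j 'D_(basis j) (W j) x) ->
  (forall x, cube c s x -> {for x, continuous g}) ->
  0 < delta ->
  \forall n \near \oo,
    `|dyadic_avg n c s (fun x => g x - discrete_divergence (s / 2 ^+ n) W x)| <= delta.
Proof.
move=> s0 dW gW gc delta0; apply: contrapT => nP.
pose P c s := ~ \forall n \near \oo,
  `|dyadic_avg n c s (fun x => g x - discrete_divergence (s / 2 ^+ n) W x)| <= delta.
have Pstep c' s' : P c' s' -> exists e, P (c' + (s' / 2) *: corner e) (s' / 2).
  move=> Pc; apply: contrapT => /forallNP nPe; apply: Pc; apply: near_inftyS.
  have : \forall n \near \oo, forall e : {ffun 'I_d -> bool},
      `|dyadic_avg n (c' + (s' / 2) *: corner e) (s' / 2)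
        (fun x => g x - discrete_divergence (s' / 2 / 2 ^+ n) W x)| <= delta.
    by apply: filter_forall => e; exact: contrapT (nPe e).
  apply: filterS => n Hn /=; apply: ler_norm_corner_mean => e.
  by rewrite exprS invfM mulrA; exact: Hn.
have [x [cx small]] := mean_defect_localize s0 nP Pstep.
pose eps := delta / (d%:R * 2 + 1).
have d21 : 0 < d%:R * 2 + 1 :> R by rewrite ltr_wpDl// mulr_ge0// ler0n.
have eps0 : 0 < eps by rewrite divr_gt0.
have [r r0 near_x] : exists2 r, 0 < r & forall y, `|y - x| < r ->
    (forall j, `|W j y - W j x - 'd (W j) x (y - x)| <= eps * `|y - x|) /\
    `|g y - g x| <= eps.
  have : \forall y \near x, (forall j,
      `|W j y - W j x - 'd (W j) x (y - x)| <= eps * `|y - x|) /\ `|g y - g x| <= eps.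
    near=> y; split.
      near: y; apply: filter_forall => j; apply: differentiable_near => //.
      exact: dW.
    rewrite distrC; near: y; have := gc _ cx => /cvgrPdist_le; exact.
  move=> /nbhs_ballP[r /= r0 xr]; exists r => // y yr; apply: xr.
  by rewrite -ball_normE /= distrC.
have [c' [s' [/andP[s'0 s'r] cx' cc' Pc']]] := small _ r0.
apply: Pc'; apply: nearW => n.
have -> : delta = (d%:R * 2 + 1) * eps by rewrite /eps mulrC divfK// gt_eqF.
apply: (dyadic_avg_affine_defect n (x0 := x) (D := fun j => 'd (W j) x)) => //.
- by move=> j a u v; rewrite linearP.
- move=> j y cy; have yx : `|y - x| <= s' by apply: cube_dist cy => //; exact: ltW.
  have [+ _] := near_x y (le_lt_trans yx s'r) => /(_ j) /le_trans; apply.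
  by rewrite ler_wpM2l// ltW.
- move=> y cy; have yx : `|y - x| <= s' by apply: cube_dist cy => //; exact: ltW.
  rewrite (_ : \sum_j _ = g x); first by have [] := near_x y (le_lt_trans yx s'r).
  by rewrite gW//; apply: eq_bigr => j _; rewrite deriveE//; exact: dW.
Unshelve. all: by end_near. Qed.

End divergence_theorem.

Section mean.
Context {R : realType} {d : nat}.
Local Notation E := 'rV[R]_d.

Definition nat_ultrafilter : set_system nat :=
  projT1 (cid (ultraFilterLemma eventually_filter)).

Lemma nat_ultrafilter_ultra : UltraFilter nat_ultrafilter.
Proof. by rewrite /nat_ultrafilter; case: cid => F []. Qed.

Lemma nat_ultrafilter_oo : \oo `<=` nat_ultrafilter.
Proof. by rewrite /nat_ultrafilter; case: cid => F []. Qed.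

#[local] Instance nat_ultrafilter_proper : ProperFilter nat_ultrafilter.
Proof. by have [] := nat_ultrafilter_ultra. Qed.

Lemma bounded_ultra_cvg (a : nat -> R) k : (forall n, `|a n| <= k) ->
  cvg (a n @[n --> nat_ultrafilter]).
Proof.
move=> ak; have UF : UltraFilter (a @ nat_ultrafilter).
  have pF : ProperFilter (a @ nat_ultrafilter) by exact: fmap_proper_filter.
  split=> // G pG FG; apply/seteqP; split=> // A GA.
  have [//|nA] := in_ultra_setVsetC (a @^-1` A) nat_ultrafilter_ultra.
  have /filter_ex[x []//] : G (A `&` ~` A) by apply: filterI => //; exact: FG.
have := @segment_compact R (- k) k; rewrite compact_ultra => /(_ _ UF)[].
  by apply: nearW => n; rewrite /= in_itv /= -ler_norml.
by move=> l [_ al]; apply/cvg_ex; exists l.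
Qed.

Variables (c : E) (s : R).
Hypothesis s0 : 0 < s.

(** The mean value over the cube, as a limit of averages over dyadic grids.
    The limit is taken along an ultrafilter, so that it exists for every
    bounded function and is linear without any measurability. *)
Definition mean (f : E -> R) : R :=
  lim (dyadic_avg n c s f @[n --> nat_ultrafilter]).

Definition bounded_on_cube (f : E -> R) :=
  exists k, forall x, cube c s x -> `|f x| <= k.

Lemma mean_cvg f : bounded_on_cube f ->
  dyadic_avg n c s f @[n --> nat_ultrafilter] --> mean f.
Proof.
move=> [k fk]; apply: (@bounded_ultra_cvg _ k) => n.
by apply: ler_norm_dyadic_avg => //; exact: ltW.
Qed.

Lemma meanD f g : bounded_on_cube f -> bounded_on_cube g ->
  mean (fun x => f x + g x) = mean f + mean g.
Proof.
move=> bf bg; apply: cvg_lim => //.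
rewrite [X in X @ _](_ : _ = (fun n => dyadic_avg n c s f + dyadic_avg n c s g)).
  by apply: cvgD; exact: mean_cvg.
by apply/funext => n; rewrite dyadic_avgD.
Qed.

Lemma meanZ k f : bounded_on_cube f -> mean (fun x => k * f x) = k * mean f.
Proof.
move=> bf; apply: cvg_lim => //.
rewrite [X in X @ _](_ : _ = (fun n => k * dyadic_avg n c s f)).
  by apply: cvgM; [exact: cvg_cst|exact: mean_cvg].
by apply/funext => n; rewrite dyadic_avgZ.
Qed.

Lemma mean_cst k : mean (fun=> k) = k.
Proof.
apply: cvg_lim => //; rewrite [X in X @ _](_ : _ = fun=> k); first exact: cvg_cst.
by apply/funext => n; rewrite dyadic_avg_cst.
Qed.

Lemma ler_mean f g : bounded_on_cube f -> bounded_on_cube g ->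
  (forall x, cube c s x -> f x <= g x) -> mean f <= mean g.
Proof.
move=> bf bg fg; apply: (ler_cvg_to (mean_cvg bf) (mean_cvg bg)).
by apply: nearW => n; apply: ler_dyadic_avg => //; exact: ltW.
Qed.

Lemma eq_mean f g : (forall x, cube c s x -> f x = g x) -> mean f = mean g.
Proof.
move=> fg; rewrite /mean (_ : (fun n => dyadic_avg n c s f) = (fun n => dyadic_avg n c s g))//.
apply/funext => n.
by apply/eqP; rewrite eq_le !ler_dyadic_avg ?ltW// => x cx; rewrite fg.
Qed.

(** The divergence theorem for a field that vanishes on the faces and is merely
    differentiable: the discrete divergence averages to boundary terms, which
    are zero, and its defect from [g] is as small as wanted. *)
Lemma mean_divergence (W : 'I_d -> E -> R) g :
  (forall j x, cube c s x -> differentiable (W j) x) ->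
  (forall x, cube c s x -> g x = \sum_j 'D_(basis j) (W j) x) ->
  (forall x, cube c s x -> {for x, continuous g}) ->
  (forall j (x : E), x 0 j = c 0 j \/ x 0 j = c 0 j + s -> W j x = 0) ->
  bounded_on_cube g -> mean g = 0.
Proof.
move=> dW gW gc W0 bg.
have avg_dd n : dyadic_avg n c s (discrete_divergence (s / 2 ^+ n) W) = 0.
  rewrite dyadic_avg_divergence ?gt_eqF//; apply: big1 => j _.
  have face0 (c' : E) : c' 0 j = c 0 j \/ c' 0 j = c 0 j + s -> face_avg j n c' s (W j) = 0.
    move=> cj; apply/eqP; rewrite -normr_le0; apply: ler_norm_face_avg.
      exact: ltW.
    by move=> x _ xj; rewrite W0 ?normr0// xj.
  rewrite !face0 ?subrr ?mulr0//; first by left.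
  by right; rewrite !mxE !eqxx mulr1.
apply/eqP/negPn/negP; rewrite -normr_gt0 => g0.
have /(discrete_divergence_defect s0 dW gW gc) defect : 0 < `|mean g| / 2 by rewrite divr_gt0.
have : `|mean g| <= `|mean g| / 2.
  apply: (ler_cvg_to (cvg_norm (mean_cvg bg)) (cvg_cst _)).
  apply: nat_ultrafilter_oo; apply: filterS defect => n.
  rewrite (_ : (fun x => _) = (fun x => g x + -1 * discrete_divergence (s / 2 ^+ n) W x)).
    by rewrite dyadic_avgD dyadic_avgZ avg_dd mulr0 addr0.
  by apply/funext => x; rewrite mulN1r.
by lra.
Qed.

Lemma dyadic_avg_child_le n c' s' e (f : E -> R) : 0 <= s' ->
  (forall x, cube c' s' x -> 0 <= f x) ->
  (#|{: {ffun 'I_d -> bool}}|%:R)^-1 *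
    dyadic_avg n (c' + (s' / 2) *: corner e) (s' / 2) f <= dyadic_avg n.+1 c' s' f.
Proof.
move=> s'0 f0; rewrite /= /corner_mean ler_wpM2l ?invr_ge0 ?ler0n//.
rewrite (bigD1 e) //= lerDl; apply: sumr_ge0 => e' _.
rewrite -(dyadic_avg_cst n (c' + (s' / 2) *: corner e') (s' / 2) 0).
apply: ler_dyadic_avg; first by rewrite divr_ge0.
by move=> x /(cube_child s'0); exact: f0.
Qed.

Lemma cube_child_ex c' s' (x : E) :
  cube c' s' x -> exists e, cube (c' + (s' / 2) *: corner e) (s' / 2) x.
Proof.
move=> cx; exists [ffun i => c' 0 i + s' / 2 <= x 0 i] => i.
rewrite !mxE ffunE; have /andP[h1 h2] := cx i.
by case: (leP (c' 0 i + s' / 2) (x 0 i)) => /= h; apply/andP; split; lra.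
Qed.

(** Descending into the child cubes that contain [x], each step loses the fixed
    factor [2 ^ d]; hence a nonnegative function that is positive near a point
    has a positive mean. *)
Lemma dyadic_avg_descend j c' s' x (f : E -> R) : 0 < s' -> cube c' s' x ->
  (forall y, cube c' s' y -> 0 <= f y) ->
  exists c1 k, [/\ cube c1 (s' / 2 ^+ j) x, cube c1 (s' / 2 ^+ j) `<=` cube c' s',
    0 < k & forall n, k * dyadic_avg n c1 (s' / 2 ^+ j) f <= dyadic_avg (n + j) c' s' f].
Proof.
elim: j c' s' => [|j IH] c' s' s'0 cx f0.
  exists c', 1; rewrite expr0 divr1; split=> // n.
  by rewrite addn0 mul1r.
have [e ex] := cube_child_ex cx.
have [||c1 [k [c1x c1c k0 kavg]]] := IH _ _ _ ex.
- by rewrite divr_gt0.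
- by move=> y /(cube_child (ltW s'0)); exact: f0.
have card0 : 0 < (#|{: {ffun 'I_d -> bool}}|%:R)^-1 :> R.
  by rewrite invr_gt0 ltr0n card_ffun card_bool expn_gt0.
exists c1, ((#|{: {ffun 'I_d -> bool}}|%:R)^-1 * k).
rewrite exprS invfM mulrA; split=> //.
- by move=> y /c1c /(cube_child (ltW s'0)).
- exact: mulr_gt0.
move=> n; rewrite addnS -(mulrA _ k).
apply: le_trans _ (dyadic_avg_child_le (n + j) e (ltW s'0) f0).
by rewrite ler_wpM2l// ltW.
Qed.

Lemma mean_gt0 f x r m : bounded_on_cube f -> cube c s x ->
  (forall y, cube c s y -> 0 <= f y) -> 0 < r -> 0 < m ->
  (forall y, `|y - x| < r -> m <= f y) -> 0 < mean f.
Proof.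
move=> bf cx f0 r0 m0 fm; have [j sj] := exists_half_pow s0 r0.
have [c1 [k [c1x c1c k0 kavg]]] := dyadic_avg_descend j s0 cx f0.
apply: lt_le_trans (mulr_gt0 k0 m0) _.
apply: (ler_cvg_to (cvg_cst _) (mean_cvg bf)).
apply: nat_ultrafilter_oo; exists j => // n /= jn.
rewrite -(subnK jn); apply: le_trans _ (kavg _); rewrite ler_wpM2l ?(ltW k0)//.
have s1 : 0 <= s / 2 ^+ j by rewrite ltW// divr_gt0// exprn_gt0.
rewrite -(dyadic_avg_cst (n - j) c1 (s / 2 ^+ j) m); apply: ler_dyadic_avg => // y cy.
by apply: fm; apply: le_lt_trans sj; exact: cube_dist cy.
Qed.

End mean.

(** * Differentiating a mean with respect to time *)

Lemma MVT_unordered {R : realType} (f df : R -> R) (a b : R) :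
  (forall x : R, x \in `[Num.min a b, Num.max a b] -> is_derive x 1 f (df x)) ->
  exists2 c : R, c \in `[Num.min a b, Num.max a b] & f b - f a = df c * (b - a).
Proof.
move=> dF.
have mvt u v : u <= v -> (forall x : R, x \in `[u, v] -> is_derive x 1 f (df x)) ->
    exists2 c : R, c \in `[u, v] & f v - f u = df c * (v - u).
  move=> uv dFuv; have dFoo (x : R) : x \in `]u, v[ -> is_derive x 1 f (df x).
    move=> xuv; apply: dFuv; move: xuv; rewrite !in_itv /=.
    by move=> /andP[h1 h2]; rewrite (ltW h1) (ltW h2).
  have fc : {within `[u, v], continuous f}.
    apply: derivable_within_continuous => x xuv.
    by have := dFuv x xuv; case.
  by apply: MVT_segment.
have [ab|ba] := leP a b.
  by rewrite (min_idPl ab) (max_idPr ab) in dF *; exact: mvt.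
have {}ba := ltW ba; rewrite (min_idPr ba) (max_idPl ba) in dF *.
have [c cin Ec] := mvt b a ba dF.
by exists c => //; rewrite -[LHS]opprB Ec -mulrN opprB.
Qed.

(** Differentiability read off the increments, without dividing by them. *)
Lemma is_derive_affine_approx {R : realType} (F : R -> R) t L :
  (forall eps, 0 < eps ->
     \forall s \near t, `|F s - F t - L * (s - t)| <= eps * `|s - t|) ->
  is_derive t 1 F L.
Proof.
move=> Ft.
have FL : h^-1 *: (F (h *: (1 : R) + t) - F t) @[h --> 0^'] --> L.
  apply/cvgrPdist_le => eps /Ft; rewrite (near_shift 0) subr0 => Ft'.
  near=> h; have h0 : h != 0 by near: h; exact: nbhs_dnbhs_neq.
  have : `|F (h + t) - F t - L * (h + t - t)| <= eps * `|h + t - t|.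
    by near: h; exact: (nbhs_dnbhs Ft').
  rewrite addrK -[h *: 1]/(h * 1) mulr1 => Fh.
  rewrite -(ler_pM2r (_ : 0 < `|h|)) ?normr_gt0// -normrM.
  rewrite (_ : _ * h = - (F (h + t) - F t - L * h)) ?normrN//.
  by rewrite mulrBl -[_ *: _]/(_ * _) mulrAC mulVf// mul1r !opprB.
by apply: DeriveDef; [apply/cvg_ex; exists L|exact: cvg_lim].
Unshelve. all: by end_near. Qed.

Section time_derivative.
Context {R : realType} {d : nat}.
Local Notation E := 'rV[R]_d.
Implicit Types f ft : R -> E -> R.

(** Time runs over the half-line: at [t = 0] only the future is seen. *)
Definition time_nbhs (t : R) : set_system R := within [set s | 0 <= s] (nbhs t).

Definition jcont f t x :=
  f p.1 p.2 @[p --> filter_prod (time_nbhs t) (nbhs x)] --> f t x.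

Definition jcont_on T1 f := forall t x, 0 <= t < T1 -> jcont f t x.

#[local] Instance time_nbhs_filter t : Filter (time_nbhs t).
Proof. exact: within_filter. Qed.

Lemma time_nbhs_gt0 t : 0 < t -> time_nbhs t = nbhs t.
Proof.
move=> t0; apply: within_interior.
near=> s; rewrite /= ltW//; near: s; exact: lt_nbhsr.
Unshelve. all: by end_near. Qed.

Lemma time_nbhs_here (t : R) (A : set R) : 0 <= t -> time_nbhs t A -> A t.
Proof. by move=> t0 /nbhs_singleton; exact. Qed.

Lemma jcont_slice f t x : 0 <= t -> jcont f t x -> f t y @[y --> x] --> f t x.
Proof.
move=> t0; apply: (cvg_comp (fun y : E => (t, y)) (fun p : R * E => f p.1 p.2)).
have tc : (fun _ : E => t) @ nbhs x --> time_nbhs t.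
  by move=> A /(time_nbhs_here t0) At; rewrite /nbhs/=; apply: (@filterS _ (nbhs x) _ setT) => //; exact: filterT.
have idc : (fun y : E => y) @ nbhs x --> nbhs x by exact: cvg_id.
exact: (cvg_pair tc idc).
Qed.

Lemma cube_compact (c : E) s : compact (cube c s).
Proof.
have := @rV_compact _ _ (fun i : 'I_d => `[c 0 i, c 0 i + s]%classic).
by move=> /(_ (fun i => @segment_compact _ _ _)).
Qed.

Lemma continuous_bounded_on_cube c s (g : E -> R) :
  (forall x, {for x, continuous g}) -> bounded_on_cube c s g.
Proof.
move=> gc; have : compact (g @` cube c s).
  apply: continuous_compact; last exact: cube_compact.
  exact: continuous_subspaceT.
move=> /compact_bounded[M [_ gM]]; exists (M + 1) => x cx.
by apply: (gM (M + 1)); [rewrite ltrDl|exists x].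
Qed.

(** Joint continuity is uniform over a compact set of positions. *)
Lemma jcont_uniform f t (K : set E) eps : 0 <= t -> compact K ->
  (forall x, K x -> jcont f t x) -> 0 < eps ->
  \forall s \near time_nbhs t, forall x, K x -> `|f s x - f t x| <= eps.
Proof.
move=> t0 /compact_near_coveringP Kc fc eps0.
apply: (Kc R (time_nbhs t) (fun s x => `|f s x - f t x| <= eps)) => x Kx.
have e2 : 0 < eps / 2 by rewrite divr_gt0.
have /cvgrPdist_le/(_ _ e2)[[A B] [/= tA xB] AB] := fc x Kx.
exists (B, A) => // -[y s] /= [By As].
have At : A t by exact: (time_nbhs_here t0).
have := AB (s, y) (conj As By); have := AB (t, y) (conj At By) => /=.
rewrite (distrC _ (f s y)) => h1 h2.
have -> : f s y - f t y = (f s y - f t x) + (f t x - f t y) by rewrite addrA subrK.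
by rewrite (le_trans (ler_normD _ _))// (splitr eps) lerD.
Qed.

Variables (c : E) (s : R).
Hypothesis s0 : 0 < s.
Local Notation mean := (mean c s).

Lemma jcont_on_bounded T1 f t : jcont_on T1 f -> 0 <= t < T1 ->
  bounded_on_cube c s (f t).
Proof.
move=> fc tT; apply: continuous_bounded_on_cube => x.
by apply: jcont_slice (fc t x tT); case/andP: tT.
Qed.

Lemma ler_norm_mean g k : bounded_on_cube c s g ->
  (forall x, cube c s x -> `|g x| <= k) -> `|mean g| <= k.
Proof.
move=> bg gk; have bk a : bounded_on_cube c s (fun=> a) by exists `|a|.
rewrite ler_norml; apply/andP; split.
  rewrite -[leLHS](mean_cst c s); apply: (ler_mean s0) => // x /gk.
  by rewrite ler_norml => /andP[].
rewrite -[leRHS](mean_cst c s); apply: (ler_mean s0) => // x /gk.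
by rewrite ler_norml => /andP[].
Qed.

Lemma meanB g h : bounded_on_cube c s g -> bounded_on_cube c s h ->
  mean (fun x => g x - h x) = mean g - mean h.
Proof.
move=> bg [k hk]; rewrite -[X in _ = _ + X]mulN1r -meanZ//; last by exists k.
rewrite -meanD//; first by apply: (eq_mean s0) => x _; rewrite mulN1r.
by exists k => x /hk; rewrite mulN1r normrN.
Qed.

Lemma bounded_onB g h : bounded_on_cube c s g -> bounded_on_cube c s h ->
  bounded_on_cube c s (fun x => g x - h x).
Proof.
move=> [k gk] [l hl]; exists (k + l) => x cx.
by rewrite (le_trans (ler_normB _ _))// lerD// ?gk ?hl.
Qed.

Lemma bounded_onZ k g : bounded_on_cube c s g ->
  bounded_on_cube c s (fun x => k * g x).
Proof.
move=> [l gl]; exists (`|k| * l) => x cx.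
by rewrite normrM ler_wpM2l// gl.
Qed.

Lemma mean_time_continuous T1 f t : jcont_on T1 f -> 0 <= t < T1 ->
  mean (f r) @[r --> time_nbhs t] --> mean (f t).
Proof.
move=> fc tT; have /andP[t0 tT1] := tT.
apply/cvgrPdist_le => eps eps0.
have := jcont_uniform t0 (@cube_compact c s) (fun x _ => fc t x tT) eps0.
move=> unif; near=> r.
have rT : 0 <= r < T1.
  apply/andP; split; near: r; first by apply: withinT.
  by apply: cvg_within; exact: lt_nbhsl.
rewrite distrC -meanB; try exact: (jcont_on_bounded fc).
apply: ler_norm_mean; first by apply: bounded_onB; exact: (jcont_on_bounded fc).
by near: r.
Unshelve. all: by end_near. Qed.

(** Differentiation under the mean: by the mean value theorem the error is
    controlled by the modulus of joint continuity of [ft], uniform on the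
    cube. *)
Lemma mean_is_derive T1 f ft t : jcont_on T1 f -> jcont_on T1 ft ->
  (forall t x, 0 < t < T1 -> is_derive t 1 (f ^~ x) (ft t x)) ->
  0 < t < T1 -> is_derive t 1 (fun r => mean (f r)) (mean (ft t)).
Proof.
move=> fc ftc dft tT; have /andP[t0 tT1] := tT.
have tT' : 0 <= t < T1 by rewrite ltW.
apply: is_derive_affine_approx => eps eps0.
have := jcont_uniform (ltW t0) (@cube_compact c s) (fun x _ => ftc t x tT') eps0.
rewrite time_nbhs_gt0// => unif.
have : \forall r \near t, 0 < r < T1 /\
    forall x, cube c s x -> `|ft r x - ft t x| <= eps.
  near=> r; split; last by near: r.
  by apply/andP; split; near: r; [exact: lt_nbhsr|exact: lt_nbhsl].
move=> /nbhs_ballP[e /= e0 te].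
apply/nbhs_ballP; exists e => //= r tr.
have [rT _] := te r tr; have /andP[r0 rT1] := rT.
have rT' : 0 <= r < T1 by rewrite ltW.
have bf r' : 0 <= r' < T1 -> bounded_on_cube c s (f r').
  by move=> ?; exact: (jcont_on_bounded fc).
have bft : bounded_on_cube c s (ft t) by exact: (jcont_on_bounded ftc).
rewrite -meanB; [|exact: bf..]; rewrite mulrC -meanZ// -meanB; last 2 first.
- by apply: bounded_onB; exact: bf.
- exact: bounded_onZ.
apply: ler_norm_mean.
  by apply: bounded_onB; [apply: bounded_onB; exact: bf|exact: bounded_onZ].
move=> x cx.
have [r' tr' Er'] : exists2 r', ball t e r' & f r x - f t x = ft r' x * (r - t).
  have mM r' : r' \in `[Num.min t r, Num.max t r] -> ball t e r'.
    rewrite in_itv /=; move: tr; rewrite -ball_normE /= !ltr_norml.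
    by case: (leP t r) => tr /andP[h1 h2] /andP[h3 h4]; apply/andP; split; lra.
  have [r' r'in Er'] := MVT_unordered (fun r' r'in => dft r' x (te r' (mM r' r'in)).1).
  by exists r' => //; exact: mM.
rewrite Er' mulrC -mulrBr normrM mulrC ler_wpM2r//.
by have [_] := te r' tr'; exact.
Unshelve. all: by end_near. Qed.

End time_derivative.

(** * Walking along the axes *)

Section partial_derivatives.
Context {R : realType} {d : nat}.
Local Notation E := 'rV[R]_d.
Implicit Types (f : E -> R) (x y z : E).

Lemma is_derive_line f z i (t : R) :
  derivable f (z + t *: basis i) (basis i) ->
  is_derive t 1 (fun r => f (z + r *: basis i)) ('D_(basis i) f (z + t *: basis i)).
Proof.
move=> dfz; have eqf : (fun h : R => h^-1 *: (f (h *: basis i + (z + t *: basis i)) - f (z + t *: basis i)))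
   = (fun h : R => h^-1 *: (f (z + (h *: (1 : R) + t) *: basis i) - f (z + t *: basis i))).
  apply/funext => h; rewrite -[h *: 1]/(h * 1) mulr1 scalerDl.
  by rewrite addrCA addrA addrC addrCA.
by apply: DeriveDef; rewrite /derivable /derive -eqf.
Qed.

(** Walking from [x] to [y] along the axes, one coordinate at a time. *)
Lemma axis_mvt f x y :
  (forall z i, `|z - x| <= `|y - x| -> derivable f z (basis i)) ->
  exists xi : 'I_d -> E, (forall i, `|xi i - x| <= `|y - x|) /\
    f y - f x = \sum_i 'D_(basis i) f (xi i) * (y - x) 0 i.
Proof.
move=> df; pose z (k : nat) : E := \row_i (if (i < k)%N then y 0 i else x 0 i).
have zS (k : 'I_d) : z k.+1 = z k + (y 0 k - x 0 k) *: basis k.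
  apply/rowP => i; rewrite !mxE ltnS leq_eqVlt.
  have [ik|ik] := eqVneq i k; first by rewrite ik eqxx ltnn mulr1 addrC subrK.
  have -> : (nat_of_ord i == k) = false by apply: negbTE.
  by rewrite mulr0 addr0.
have near_x k (r : R) : r \in `[Num.min 0 (y 0 k - x 0 k), Num.max 0 (y 0 k - x 0 k)] ->
    `|z k + r *: basis k - x| <= `|y - x|.
  move=> rin; apply/row_norm_leP => // i; rewrite !mxE.
  have [ik|ik] := eqVneq i k; last first.
    rewrite mulr0 addr0; case: ifP => _; last by rewrite subrr normr0.
    by have := coord_le_norm (y - x) i; rewrite !mxE.
  rewrite ik ltnn mulr1 addrAC subrr add0r.
  have := coord_le_norm (y - x) k; rewrite !mxE; apply: le_trans.
  move: rin; rewrite in_itv /=; set v := y 0 k - x 0 k.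
  case: (leP 0 v) => v0 /andP[h1 h2]; first by rewrite !ger0_norm.
  by rewrite !ler0_norm ?lerN2// ltW.
have step (k : 'I_d) : exists xi, `|xi - x| <= `|y - x| /\
    f (z k.+1) - f (z k) = 'D_(basis k) f xi * (y - x) 0 k.
  have dline r : r \in `[Num.min 0 (y 0 k - x 0 k), Num.max 0 (y 0 k - x 0 k)] ->
     is_derive r 1 (fun r => f (z k + r *: basis k)) ('D_(basis k) f (z k + r *: basis k)).
    by move=> rin; apply/is_derive_line/df/near_x.
  have [r rin] := MVT_unordered dline.
  rewrite scale0r addr0 subr0 -zS => Er.
  by exists (z k + r *: basis k); rewrite Er !mxE; split => //; exact: near_x.
pose xi k := projT1 (cid (step k)); exists xi; split.
  by move=> k; have [] := projT2 (cid (step k)).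
have -> : f y - f x = f (z d) - f (z 0%N).
  by congr (f _ - f _); apply/rowP => i; rewrite mxE ?ltn_ord.
rewrite -(telescope_sumr (fun k => f (z k)) (leq0n d)) big_mkord.
by apply: eq_bigr => k _; have [] := projT2 (cid (step k)).
Qed.

Lemma continuous_partials_differentiable f x :
  (\forall y \near x, forall i, derivable f y (basis i)) ->
  (forall i, {for x, continuous ('D_(basis i) f)}) ->
  differentiable f x.
Proof.
move=> /nbhs_ballP[r /= r0 dfr] dfc.
apply: (differentiable_affine_approx (p := fun i => 'D_(basis i) f x)) => eps eps0.
pose e := eps / d.+1%:R.
have e0 : 0 < e by rewrite divr_gt0// ltr0n.
have : \forall y \near x, forall i, `|'D_(basis i) f y - 'D_(basis i) f x| <= e.
  apply: (@filter_forall _ _ _ _ (nbhs_filter x)) => i; have /cvgrPdist_le/(_ _ e0) := dfc i.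
  by apply: filterS => y; rewrite distrC.
move=> /nbhs_ballP[r' /= r'0 dfe].
have m0 : 0 < Num.min r r' by rewrite lt_min r0.
apply/nbhs_ballP; exists (Num.min r r') => //= y; rewrite -ball_normE /= => xy.
have ball_xi z : `|z - x| <= `|y - x| -> ball x r z /\ ball x r' z.
  move=> zy; have : `|x - z| < Num.min r r'.
    by rewrite distrC; apply: le_lt_trans zy _; rewrite distrC.
  by rewrite lt_min -ball_normE /= => /andP[].
have [z i zy|xi [xiy ->]] := axis_mvt (f := f) (x := x) (y := y).
  by apply: dfr; have [] := ball_xi z zy.
rewrite -sumrB; apply: le_trans (ler_norm_sum _ _ _) _.
apply: (@le_trans _ _ (\sum_(i < d) e * `|y - x|)).
  apply: ler_sum => i _; rewrite -mulrBl normrM ler_pM ?coord_le_norm//.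
  by apply: dfe; have [] := ball_xi _ (xiy i).
rewrite sumr_const card_ord -mulr_natl mulrA ler_wpM2r//.
rewrite /e mulrCA ler_piMr ?(ltW eps0)//.
by rewrite ler_pdivrMr ?ltr0n// mul1r ler_nat.
Qed.

(** A bound on the partial derivatives in the sup-norm ball alone suffices: the
    axis-parallel walk from [x] to [y] never leaves it. *)
Lemma partials_lipschitz f x y (M : R) :
  (forall z i, `|z - x| <= `|y - x| ->
     derivable f z (basis i) /\ `|'D_(basis i) f z| <= M) ->
  `|f y - f x| <= d%:R * M * `|y - x|.
Proof.
move=> dfM; have [z i zy|xi [xiy ->]] := axis_mvt (f := f) (x := x) (y := y).
  by have [] := dfM z i zy.
apply: le_trans (ler_norm_sum _ _ _) _.
rewrite -mulrA -[X in X%:R * _](card_ord d) mulr_natl -sumr_const.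
apply: ler_sum => i _; rewrite normrM ler_pM ?coord_le_norm//.
by have [] := dfM _ i (xiy i).
Qed.

End partial_derivatives.

(** * Cutoff profiles *)

Section cutoff.
Context {R : realType}.
Implicit Types s : R.

(** A [C^1] stand-in for the positive part, from which all the cutoffs are
    made. *)
Definition sqpos s : R := Num.max s 0 ^+ 2.

Lemma sqpos_quadratic s (y : R) :
  0 <= sqpos y - sqpos s - 2 * Num.max s 0 * (y - s) <= (y - s) ^+ 2.
Proof.
rewrite /sqpos; have hy := sqr_ge0 y; have hs := sqr_ge0 s; have hys := sqr_ge0 (y - s).
have [y0|y0] := leP y 0; have [s0|s0] := leP s 0.
- by apply/andP; split; lra.
- have := mulr_ge0_le0 (ltW s0) y0; by move=> ?; apply/andP; split; lra.
- have := mulr_ge0_le0 (ltW y0) s0; by move=> ?; apply/andP; split; lra.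
- by apply/andP; split; lra.
Qed.

Lemma is_derive_sqpos s : is_derive s 1 sqpos (2 * Num.max s 0).
Proof.
apply: is_derive_affine_approx => eps eps0.
apply/nbhs_ballP; exists eps => //= y; rewrite -ball_normE /= distrC => ye.
have /andP[h1 h2] := sqpos_quadratic s y.
rewrite ger0_norm// (le_trans h2)// -(real_normK (num_real (y - s))) expr2.
by rewrite ler_wpM2r// ltW.
Qed.

(** A decreasing C^1 plateau: 1 up to [s = 1], 0 from [s = 2] on. *)
Definition plateau s := sqpos (1 - sqpos (s - 1)).

Definition plateau' s := - (4 * Num.max (1 - sqpos (s - 1)) 0 * Num.max (s - 1) 0).

Lemma is_derive_plateau s : is_derive s 1 plateau (plateau' s).
Proof.
have h : is_derive s 1 (fun s => 1 - sqpos (s - 1)) (- (2 * Num.max (s - 1) 0)).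
  have -> : (fun s => 1 - sqpos (s - 1)) = cst 1 - (sqpos \o (fun s => s - 1)) by [].
  have hs : is_derive s 1 (fun s => s - 1) (1 : R).
    by apply: is_derive_eq; rewrite subr0.
  have hc := @is_derive1_comp R sqpos (fun s => s - 1) s _ _ (is_derive_sqpos _) hs.
  by apply: is_derive_eq; rewrite sub0r mulr1.
have -> : plateau = sqpos \o (fun s => 1 - sqpos (s - 1)) by [].
have := @is_derive1_comp R sqpos (fun s => 1 - sqpos (s - 1)) s _ _ (is_derive_sqpos _) h.
by move/is_derive_eq; apply; rewrite /plateau'; ring.
Qed.

Lemma sqpos_ge0 s : 0 <= sqpos s. Proof. exact: sqr_ge0. Qed.

Lemma sqpos_le0 s : s <= 0 -> sqpos s = 0.
Proof. by move=> s0; rewrite /sqpos max_r// expr0n. Qed.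

Lemma sqpos_ge1 s : 1 <= s -> 1 <= sqpos s.
Proof.
by move=> s1; rewrite /sqpos max_l ?(le_trans _ s1)// expr_ge1// (le_trans _ s1).
Qed.

Lemma sqpos_le1 s : s <= 1 -> sqpos s <= 1.
Proof. by move=> s1; rewrite expr_le1// ?le_max ?lexx ?orbT// ge_max s1 ler01. Qed.

Lemma plateau_ge0 s : 0 <= plateau s. Proof. exact: sqpos_ge0. Qed.

Lemma plateau_eq1 s : s <= 1 -> plateau s = 1.
Proof.
by move=> s1; rewrite /plateau (@sqpos_le0 (s - 1)) ?subr_le0// subr0 /sqpos max_l// expr1n.
Qed.

Lemma plateau_eq0 s : 2 <= s -> plateau s = 0.
Proof.
by move=> s2; apply: sqpos_le0; rewrite subr_le0; apply: sqpos_ge1; lra.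
Qed.

Lemma plateau'_le0 s : plateau' s <= 0.
Proof. by rewrite oppr_le0 !mulr_ge0// le_max lexx orbT. Qed.

Lemma plateau'_eq0 s : plateau s = 0 -> plateau' s = 0.
Proof.
move/eqP; rewrite sqrf_eq0 => /eqP s0.
by rewrite /plateau' s0 mulr0 mul0r oppr0.
Qed.

Lemma plateau'_neq0 s : plateau' s != 0 -> s < 2.
Proof.
by rewrite ltNge; apply: contra => /plateau_eq0/plateau'_eq0/eqP.
Qed.

Lemma continuous_max0 : continuous (fun s : R => Num.max s 0).
Proof. by move=> s; apply: continuous_max; [exact: cvg_id|exact: cvg_cst]. Qed.

Lemma continuous_sqpos : continuous sqpos.
Proof.
by move=> s; apply/differentiable_continuous/derivable1_diffP; have [] := is_derive_sqpos s.
Qed.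

Lemma continuous_plateau' : continuous plateau'.
Proof.
move=> s; apply: cvgN; apply: cvgM; [apply: cvgM; first exact: cvg_cst|].
  apply: (cvg_comp (fun s => 1 - sqpos (s - 1)) (fun s => Num.max s 0)); last exact: continuous_max0.
  apply: cvgB; first exact: cvg_cst.
  apply: (cvg_comp (fun s => s - 1) sqpos); last exact: continuous_sqpos.
  by apply: cvgB; [exact: cvg_id|exact: cvg_cst].
apply: (cvg_comp (fun s => s - 1) (fun s => Num.max s 0)); last exact: continuous_max0.
by apply: cvgB; [exact: cvg_id|exact: cvg_cst].
Qed.
End cutoff.

(** * Weights in space and time *)

Section joint_continuity_algebra.
Context {R : realType} {d : nat}.
Local Notation E := 'rV[R]_d.
Implicit Types (f g : R -> E -> R) (t : R) (x : E).

#[local] Instance jfilter_filter t x : Filter (filter_prod (time_nbhs t) (nbhs x)).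
Proof.
by have F1 := time_nbhs_filter t; have F2 := nbhs_filter x; exact: filter_prod_filter.
Qed.

Lemma jcont_cst (k : R) t x : jcont (fun _ _ => k) t x.
Proof. exact: cvg_cst. Qed.

Lemma jcontD f g t x : jcont f t x -> jcont g t x ->
  jcont (fun t x => f t x + g t x) t x.
Proof. by move=> *; apply: cvgD. Qed.

Lemma jcontB f g t x : jcont f t x -> jcont g t x ->
  jcont (fun t x => f t x - g t x) t x.
Proof. by move=> *; apply: cvgB. Qed.

Lemma jcontM f g t x : jcont f t x -> jcont g t x ->
  jcont (fun t x => f t x * g t x) t x.
Proof. by move=> *; apply: cvgM. Qed.

Lemma jcont_sum I (r : seq I) (F : I -> R -> E -> R) t x :
  (forall i, jcont (F i) t x) -> jcont (fun t x => \sum_(i <- r) F i t x) t x.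
Proof.
move=> Fc; elim: r => [|i r IH].
  rewrite /jcont big_nil; under eq_fun do rewrite big_nil; exact: cvg_cst.
rewrite /jcont big_cons; under eq_fun do rewrite big_cons.
exact: (cvgD (Fc i) IH).
Qed.

Lemma jcont_comp (phi : R -> R) f t x : jcont f t x ->
  {for f t x, continuous phi} -> jcont (fun t x => phi (f t x)) t x.
Proof. by move=> fc phic; apply: (cvg_comp _ _ fc phic). Qed.

Lemma jcont_time (h : R -> R) t x : h r @[r --> time_nbhs t] --> h t ->
  jcont (fun t _ => h t) t x.
Proof.
move=> hc; apply: (cvg_comp fst h _ hc) => A tA.
by exists (A, setT) => /=; [split => //; exact: filterT|move=> [a b] []].
Qed.

Lemma jcont_pos (h : E -> R) t x : {for x, continuous h} -> jcont (fun _ x => h x) t x.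
Proof.
move=> hc; apply: (cvg_comp snd h _ hc) => A xA.
by exists (setT, A) => /=; [split => //; exact: filterT|move=> [a b] []].
Qed.

Lemma coord_continuous_at (i : 'I_d) x : {for x, continuous (fun y : E => y 0 i)}.
Proof. by apply: differentiable_continuous; exact: differentiable_coord. Qed.

Lemma is_derive_bigsum (V : normedModType R) I (r : seq I) (F : I -> V -> R) (x v : V)
    (dF : I -> R) : (forall i, is_derive x v (F i) (dF i)) ->
  is_derive x v (fun y => \sum_(i <- r) F i y) (\sum_(i <- r) dF i).
Proof.
move=> dFx; elim: r => [|i r IH].
  rewrite big_nil (_ : (fun _ => _) = cst 0); first exact: is_derive_cst.
  by apply/funext => y; rewrite big_nil.
rewrite big_cons (_ : (fun _ => _) = F i + (fun y => \sum_(j <- r) F j y)).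
  by apply: is_deriveD.
by apply/funext => y; rewrite big_cons.
Qed.

Lemma is_derive_coord (i j : 'I_d) x :
  is_derive x (basis i) (fun y : E => y 0 j) (j == i)%:R.
Proof.
have dc : differentiable (fun y : E => y 0 j) x by exact: differentiable_coord.
apply: DeriveDef; first exact: diff_derivable.
rewrite /derive; apply: cvg_lim => //.
apply: (@cvg_trans _ (cst ((j == i)%:R : R) @ 0^')); last exact: cvg_cst.
apply: near_eq_cvg; near=> h.
rewrite /= !mxE addrK eqxx /= -[_ *: _]/(_ * _) mulrA mulVf ?mul1r//.
by near: h; exact: nbhs_dnbhs_neq.
Unshelve. all: by end_near. Qed.

End joint_continuity_algebra.

Section weights.
Context {R : realType} {d : nat}.
Local Notation E := 'rV[R]_d.

(** Continuity is joint in time and space, and one-sided in time at [t = 0];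
    time derivatives are asked for at positive times, where they are two-sided. *)
Record weight (w wt : R -> E -> R) (wx : 'I_d -> R -> E -> R) : Prop := Weight {
  weight_jcont : forall (t : R) (x : E), 0 <= t -> jcont w t x ;
  weight_jcontt : forall (t : R) (x : E), 0 <= t -> jcont wt t x ;
  weight_jcontx : forall i (t : R) (x : E), 0 <= t -> jcont (wx i) t x ;
  weight_dt : forall (t : R) (x : E), 0 < t -> is_derive t 1 (w ^~ x) (wt t x) ;
  weight_diff : forall (t : R) (x : E), 0 <= t -> differentiable (w t) x ;
  weight_dx : forall (t : R) (x : E) i, 0 <= t -> is_derive x (basis i) (w t) (wx i t x) }.

Lemma weightM v vt vx w wt wx : weight v vt vx -> weight w wt wx ->
  weight (fun t x => v t x * w t x) (fun t x => v t x * wt t x + w t x * vt t x)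
    (fun i t x => v t x * wx i t x + w t x * vx i t x).
Proof.
move=> [vc vtc vxc vdt vd vdx] [wc wtc wxc wdt wd wdx]; split.
- by move=> t x t0; apply: jcontM; [exact: vc|exact: wc].
- by move=> t x t0; apply: jcontD; apply: jcontM; auto.
- by move=> i t x t0; apply: jcontD; apply: jcontM; auto.
- by move=> t x t0; apply: is_deriveM; [exact: vdt|exact: wdt].
- by move=> t x t0; apply: differentiableM; [exact: vd|exact: wd].
- by move=> t x i t0; apply: is_deriveM; [exact: vdx|exact: wdx].
Qed.

Lemma weight_sum I (r : seq I) (w wt : I -> R -> E -> R) wx :
  (forall i, weight (w i) (wt i) (wx i)) ->
  weight (fun t x => \sum_(i <- r) w i t x) (fun t x => \sum_(i <- r) wt i t x)
    (fun k t x => \sum_(i <- r) wx i k t x).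
Proof.
move=> ww; split.
- by move=> t x t0; apply: jcont_sum => i; apply: (weight_jcont (ww i)).
- by move=> t x t0; apply: jcont_sum => i; apply: (weight_jcontt (ww i)).
- by move=> k t x t0; apply: jcont_sum => i; apply: (weight_jcontx (ww i)).
- by move=> t x t0; apply: is_derive_bigsum => i; apply: (weight_dt (ww i)).
- move=> t x t0; elim: r => [|i r IH].
    by under eq_fun do rewrite big_nil; exact: differentiable_cst.
  under eq_fun do rewrite big_cons.
  by apply: differentiableD; [exact: (weight_diff (ww i))|exact: IH].
- by move=> t x k t0; apply: is_derive_bigsum => i; apply: (weight_dx (ww i)).
Qed.

Lemma is_derive_along (V : normedModType R) (f : V -> R) (x v : V) (a : R) :
  is_derive x v f a <-> is_derive (0 : R) 1 (fun h : R => f (h *: v + x)) a.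
Proof.
have E : (fun h : R => h^-1 *: (f (h *: v + x) - f x)) =
    (fun h : R => h^-1 *: (f ((h *: (1 : R) + 0) *: v + x) - f (0 *: v + x))).
  by apply/funext => h; rewrite -[h *: 1]/(h * 1) mulr1 addr0 scale0r add0r.
by split=> -[]; rewrite /derivable /derive => cf df; apply: DeriveDef;
  rewrite /derivable /derive; [rewrite -E|rewrite -E|rewrite E|rewrite E].
Qed.

Lemma is_derive_chain (V : normedModType R) (phi : R -> R) (f : V -> R) (x v : V)
    (a b : R) :
  is_derive (f x) 1 phi a -> is_derive x v f b -> is_derive x v (phi \o f) (a * b).
Proof.
move=> dphi /is_derive_along df; apply/is_derive_along.
apply: (@is_derive1_comp R phi (fun h : R => f (h *: v + x))) df.
by rewrite scale0r add0r.
Qed.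

Lemma weight_comp (phi phi' : R -> R) w wt wx :
  (forall s : R, is_derive s 1 phi (phi' s)) -> continuous phi' -> weight w wt wx ->
  weight (fun t x => phi (w t x)) (fun t x => phi' (w t x) * wt t x)
    (fun i t x => phi' (w t x) * wx i t x).
Proof.
move=> dphi phic' [wc wtc wxc wdt wd wdx].
have dphi_ s : differentiable phi s by apply/derivable1_diffP; have [] := dphi s.
have phic s : {for s, continuous phi} by exact: differentiable_continuous.
split.
- by move=> t x t0; apply: jcont_comp; [exact: wc|exact: phic].
- by move=> t x t0; apply: jcontM; [apply: jcont_comp; [exact: wc|exact: phic']|exact: wtc].
- by move=> i t x t0; apply: jcontM; [apply: jcont_comp; [exact: wc|exact: phic']|exact: wxc].
- by move=> t x t0; apply: (is_derive_chain (dphi _)); exact: wdt.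
- by move=> t x t0; apply: (differentiable_comp (wd t x t0)).
- by move=> t x i t0; apply: (is_derive_chain (dphi _)); exact: wdx.
Qed.

(** Its sublevel sets are Euclidean balls around the moving point whose radius
    varies exponentially, at rate [- k / 2]. *)
Definition tube (c k : R) (X : R -> E) t (x : E) : R :=
  c * expR (k * t) * sqnorm (x - X t).

Definition tube_dt (c k : R) (X X' : R -> E) t (x : E) : R :=
  c * expR (k * t) *
  (k * sqnorm (x - X t) - 2 * \sum_i (x - X t) 0 i * X' t 0 i).

Definition tube_dx (c k : R) (X : R -> E) (i : 'I_d) t (x : E) : R :=
  c * expR (k * t) * (2 * (x - X t) 0 i).

(** The path is required to be differentiable for positive times only, hence
    the separate continuity hypotheses up to [t = 0]. *)
Lemma weight_tube (c k : R) (X X' : R -> E) :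
  (forall (t : R) i, 0 <= t -> X r 0 i @[r --> time_nbhs t] --> X t 0 i) ->
  (forall (t : R) i, 0 <= t -> X' r 0 i @[r --> time_nbhs t] --> X' t 0 i) ->
  (forall (t : R) i, 0 < t -> is_derive t 1 (fun r => X r 0 i) (X' t 0 i)) ->
  weight (tube c k X) (tube_dt c k X X') (tube_dx c k X).
Proof.
move=> Xc X'c dX.
have ec t (x : E) : 0 <= t -> jcont (fun t _ => c * expR (k * t)) t x.
  move=> t0; apply: (@jcont_time R d (fun r => c * expR (k * r))); apply: cvgM; first exact: cvg_cst.
  apply: cvg_within_filter; apply: continuous_comp; last exact: continuous_expR.
  by apply: cvgM; [exact: cvg_cst|exact: cvg_id].
have xc t (x : E) i : 0 <= t -> jcont (fun t x => (x - X t) 0 i) t x.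
  move=> t0; rewrite (_ : (fun t x => _) = (fun (t : R) (x : E) => x 0 i - X t 0 i)); last first.
    by apply/funext => r; apply/funext => y; rewrite !mxE.
  apply: jcontB.
    by apply: (@jcont_pos R d (fun y : E => y 0 i) t x); exact: coord_continuous_at.
  by apply: (@jcont_time R d (fun r => X r 0 i)); exact: Xc.
have nc t (x : E) : 0 <= t -> jcont (fun t x => sqnorm (x - X t)) t x.
  by move=> t0; apply: jcont_sum => i; apply: jcontM; exact: xc.
split.
- by move=> t x t0; apply: jcontM; [exact: ec|exact: nc].
- move=> t x t0; apply: jcontM; first exact: ec.
  apply: jcontB; first by apply: jcontM; [exact: jcont_cst|exact: nc].
  apply: jcontM; first exact: jcont_cst.
  apply: jcont_sum => i; apply: jcontM; first exact: xc.
  by apply: (@jcont_time R d (fun r => X' r 0 i)); exact: X'c.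
- move=> i t x t0; apply: jcontM; first exact: ec.
  by apply: jcontM; [exact: jcont_cst|exact: xc].
- move=> t x t0.
  have dC : is_derive t 1 (fun r => c * expR (k * r)) (c * (expR (k * t) * k)).
    apply: is_deriveZ; apply: is_derive_chain.
    by apply: is_derive_eq; rewrite [_ *: _]mulr1.
  have dS : is_derive t 1 (fun r => sqnorm (x - X r))
      (- (2 * \sum_i (x - X t) 0 i * X' t 0 i)).
    rewrite mulr_sumr -sumrN; apply: is_derive_bigsum => i.
    have dxX : is_derive t 1 (fun r => (x - X r) 0 i) (- X' t 0 i).
      rewrite (_ : (fun r => _) = (fun r => x 0 i - X r 0 i)); last first.
        by apply/funext => r; rewrite !mxE.
      have := dX t i t0 => dXi.
      by have := is_deriveB (is_derive_cst (x 0 i) t 1) dXi; rewrite sub0r.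
    have := is_deriveM dxX dxX; move/is_derive_eq; apply.
    by rewrite -[_ *: _]/(_ * _); ring.
  have := is_deriveM dC dS; move/is_derive_eq; apply.
  by rewrite /tube_dt -[_ *: _]/(_ * _) -[X in _ + X]/(_ * _); ring.
- move=> t x t0; apply: differentiableM; first exact: differentiable_cst.
  apply: differentiable_bigsum => i.
  suff dxX : differentiable (fun y : E => (y - X t) 0 i) x by exact: (differentiableM dxX dxX).
  apply: (@differentiable_comp _ _ _ _ (fun y : E => y - X t) (fun v : E => v 0 i)).
    by [].
  exact: differentiable_coord.
- move=> t x i t0; apply: is_deriveZ.
  rewrite (_ : 2 * _ = \sum_j 2 * (x - X t) 0 j * (j == i)%:R); last first.
    rewrite (bigD1 i) //= eqxx mulr1 big1 ?addr0// => j /negbTE ->.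
    by rewrite mulr0.
  apply: is_derive_bigsum => j.
  have dxX : is_derive x (basis i) (fun y : E => (y - X t) 0 j) (j == i)%:R.
    rewrite (_ : (fun y => _) = (fun y : E => y 0 j - X t 0 j)); last first.
      by apply/funext => y; rewrite !mxE.
    have := is_derive_coord i j x => dj.
    by have := is_deriveB dj (is_derive_cst (X t 0 j) x (basis i)); rewrite subr0.
  have := is_deriveM dxX dxX; move/is_derive_eq; apply.
  by rewrite -[_ *: _]/(_ * _); ring.
Qed.

End weights.

(** * Extension by zero *)

Section supported.
Context {R : realType} {d : nat}.
Local Notation E := 'rV[R]_d.
Variables (Omega K : set E) (T1 : R).
Hypotheses (Kc : closed K) (KO : K `<=` Omega).

Lemma near_outside (x : E) : ~ Omega x -> \forall y \near x, ~ K y.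
Proof.
move=> nO; have oK : open (~` K) by exact: closed_openC.
by apply: oK => /KO.
Qed.

(** Extension by zero: a function that vanishes off a closed [K] inside [Omega]
    keeps outside [Omega] the regularity it has in [Omega], so that it may be
    averaged over a cube larger than [Omega]. *)
Lemma supported_jcont (f : R -> E -> R) :
  (forall (t : R) (x : E), 0 <= t < T1 -> ~ K x -> f t x = 0) ->
  (forall (t : R) (x : E), 0 <= t < T1 -> Omega x -> jcont f t x) ->
  jcont_on T1 f.
Proof.
move=> f0 fc t x tT; have [Ox|nOx] := pselect (Omega x); first exact: fc.
have nKx : ~ K x by move=> /KO.
rewrite /jcont f0//; apply: cvg_near_cst.
have tn : \forall r \near time_nbhs t, 0 <= r < T1.
  near=> r; apply/andP; split; near: r; first exact: withinT.
  by apply: cvg_within; apply: lt_nbhsl; case/andP: tT.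
exists ([set r | 0 <= r < T1], ~` K) => /=.
  by split => //; exact: near_outside.
by move=> [r y] /= [rT nKy]; apply: f0.
Unshelve. all: by end_near. Qed.

Lemma supported_continuous (f : E -> R) :
  (forall x, ~ K x -> f x = 0) ->
  (forall x, Omega x -> {for x, continuous f}) ->
  forall x, {for x, continuous f}.
Proof.
move=> f0 fc x; have [Ox|nOx] := pselect (Omega x); first exact: fc.
have fx : f x = 0 by apply: f0 => /KO.
rewrite /prop_for /continuous_at fx.
apply: (@cvg_near_cst _ _ 0 f (nbhs x) (nbhs_filter x)).
exact: (@filterS _ (nbhs x) (nbhs_filter x) _ _ f0 (near_outside nOx)).
Qed.

Lemma supported_near0 (f : E -> R) (x : E) :
  (forall x, ~ K x -> f x = 0) -> ~ Omega x -> \forall y \near x, cst 0 y = f y.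
Proof.
by move=> f0 nOx; near=> y; rewrite /= f0//; near: y; exact: near_outside.
Unshelve. all: by end_near. Qed.

Lemma supported_differentiable (f : E -> R) :
  (forall x, ~ K x -> f x = 0) ->
  (forall x, Omega x -> differentiable f x) ->
  forall x, differentiable f x.
Proof.
move=> f0 df x; have [Ox|nOx] := pselect (Omega x); first exact: df.
apply: differentiable_flat => eps eps0.
near=> y; have nKy : ~ K y by near: y; exact: near_outside.
by rewrite !f0 ?subrr ?normr0 ?mulr_ge0 // 1?ltW//; move=> /KO.
Unshelve. all: by end_near. Qed.

Lemma supported_derive (f : E -> R) (x : E) i :
  (forall x, ~ K x -> f x = 0) -> ~ Omega x -> 'D_(basis i) f x = 0.
Proof.
move=> f0 nOx; rewrite -(near_eq_derive _ (supported_near0 f0 nOx)) ?derive_cst//.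
Qed.

Lemma supported_is_derive_time (f ft : R -> E -> R) :
  (forall (t : R) (x : E), 0 <= t < T1 -> ~ K x -> f t x = 0 /\ ft t x = 0) ->
  (forall (t : R) (x : E), 0 < t < T1 -> Omega x -> is_derive t 1 (f ^~ x) (ft t x)) ->
  forall (t : R) (x : E), 0 < t < T1 -> is_derive t 1 (f ^~ x) (ft t x).
Proof.
move=> f0 dft t x tT; have [Ox|nOx] := pselect (Omega x); first exact: dft.
have nKx : ~ K x by move=> /KO.
have /andP[t0 tT1] := tT.
have [ft0 ftt0] : f t x = 0 /\ ft t x = 0 by apply: f0 => //; rewrite ltW.
apply: is_derive_affine_approx => eps eps0.
near=> r; have [fr0 _] : f r x = 0 /\ ft r x = 0.
  apply: f0 => //; apply/andP; split.
    by apply: ltW; near: r; exact: lt_nbhsr.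
  by near: r; exact: lt_nbhsl.
by rewrite fr0 ft0 ftt0 mul0r !subr0 normr0 mulr_ge0// ltW.
Unshelve. all: by end_near. Qed.

End supported.

(** * Transport and virial identities *)

Lemma continuous_bigsum {R : realType} (T : topologicalType) I (r : seq I)
    (F : I -> T -> R) (x : T) :
  (forall i, {for x, continuous (F i)}) ->
  {for x, continuous (fun y => \sum_(i <- r) F i y)}.
Proof.
move=> Fc; elim: r => [|i r IH].
  rewrite /prop_for /continuous_at big_nil; under eq_fun do rewrite big_nil.
  exact: cvg_cst.
rewrite /prop_for /continuous_at big_cons; under eq_fun do rewrite big_cons.
exact: (cvgD (Fc i) IH).
Qed.

Lemma continuousD_at {R : realType} (T : topologicalType) (f g : T -> R) (x : T) :
  {for x, continuous f} -> {for x, continuous g} ->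
  {for x, continuous (fun y => f y + g y)}.
Proof. by move=> fc gc; apply: cvgD. Qed.

Lemma continuousM_at {R : realType} (T : topologicalType) (f g : T -> R) (x : T) :
  {for x, continuous f} -> {for x, continuous g} ->
  {for x, continuous (fun y => f y * g y)}.
Proof. by move=> fc gc; apply: cvgM. Qed.

Lemma continuousN_at {R : realType} (T : topologicalType) (f : T -> R) (x : T) :
  {for x, continuous f} -> {for x, continuous (fun y => - f y)}.
Proof. by move=> fc; apply: cvgN. Qed.

Section flow.
Context {R : realType} {d : nat}.
Local Notation E := 'rV[R]_d.

(** What the virial argument uses of a solution, apart from the momentum
    equation; the continuity equation is expanded by the product rule. *)
Record regular_flow (Omega : set E) (rho rhot : R -> E -> R) (u ut : R -> E -> E) :
    Prop := RegularFlow {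
  flow_ge0 : forall (t : R) (x : E), 0 <= t -> Omega x -> 0 <= rho t x ;
  flow_rho : forall (t : R) (x : E), 0 <= t -> Omega x -> jcont rho t x ;
  flow_rhot : forall (t : R) (x : E), 0 <= t -> Omega x -> jcont rhot t x ;
  flow_rho_dt : forall (t : R) (x : E), 0 < t -> Omega x ->
    is_derive t 1 (rho ^~ x) (rhot t x) ;
  flow_rho_diff : forall (t : R) (x : E), 0 <= t -> Omega x ->
    differentiable (rho t) x ;
  flow_rho_dx : forall (t : R) (x : E) i, 0 <= t -> Omega x ->
    {for x, continuous ('D_(basis i) (rho t))} ;
  flow_u : forall (t : R) (x : E) k, 0 <= t -> Omega x ->
    jcont (fun r y => u r y 0 k) t x ;
  flow_ut : forall (t : R) (x : E) k, 0 <= t -> Omega x ->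
    jcont (fun r y => ut r y 0 k) t x ;
  flow_u_dt : forall (t : R) (x : E) k, 0 < t -> Omega x ->
    is_derive t 1 (fun r => u r x 0 k) (ut t x 0 k) ;
  flow_u_diff : forall (t : R) (x : E) k, 0 <= t -> Omega x ->
    differentiable (fun y => u t y 0 k) x ;
  flow_u_dx : forall (t : R) (x : E) i k, 0 <= t -> Omega x ->
    jcont (fun r y => 'D_(basis i) (fun z => u r z 0 k) y) t x ;
  flow_continuity : forall (t : R) (x : E), 0 < t -> Omega x ->
    rhot t x + \sum_i ('D_(basis i) (rho t) x * u t x 0 i
      + rho t x * 'D_(basis i) (fun y => u t y 0 i) x) = 0 }.

(** The derivative of a weight along the flow. *)
Definition material (u : R -> E -> E) (wt : R -> E -> R) (wx : 'I_d -> R -> E -> R)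
    t x : R :=
  wt t x + \sum_i u t x 0 i * wx i t x.

Definition supported_in (K : set E) (T1 : R) (f : R -> E -> R) :=
  forall (t : R) (x : E), 0 <= t < T1 -> ~ K x -> f t x = 0.

Variables (Omega K : set E) (T1 : R) (c : E) (s : R).
Hypotheses (Kc : closed K) (KO : K `<=` Omega) (s0 : 0 < s).
Hypothesis inner : forall x j, Omega x -> c 0 j < x 0 j < c 0 j + s.
Local Notation mean := (mean c s).

Variables (rho rhot : R -> E -> R) (u ut : R -> E -> E).
Hypothesis F : regular_flow Omega rho rhot u ut.

Lemma supported_face0 (f : E -> R) : (forall x, ~ K x -> f x = 0) ->
  forall (j : 'I_d) (x : E), x 0 j = c 0 j \/ x 0 j = c 0 j + s -> f x = 0.
Proof.
move=> f0 j x xj; apply: f0 => /KO /(inner j) /andP[h1 h2].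
by case: xj => xj; move: h1 h2; rewrite xj ltxx.
Qed.

Lemma mean_divergence_supported (W : 'I_d -> E -> R) (g : E -> R) :
  (forall j (x : E), ~ K x -> W j x = 0) -> (forall x, ~ K x -> g x = 0) ->
  (forall j (x : E), Omega x -> differentiable (W j) x) ->
  (forall x, Omega x -> g x = \sum_j 'D_(basis j) (W j) x) ->
  (forall x, Omega x -> {for x, continuous g}) -> mean g = 0.
Proof.
move=> W0 g0 dW gW gc.
have gcont := supported_continuous Kc KO g0 gc.
apply: (mean_divergence s0 (W := W)).
- by move=> j x _; apply: (supported_differentiable Kc KO (W0 j) (dW j)).
- move=> x _; have [Ox|nOx] := pselect (Omega x); first exact: gW.
  rewrite g0; last by move=> /KO.
  by rewrite big1// => j _; exact: (supported_derive Kc KO j (W0 j) nOx).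
- by move=> x _; exact: gcont.
- by move=> j x; exact: (supported_face0 (W0 j)).
- exact: continuous_bounded_on_cube.
Qed.

Lemma flow_divergence_cont (t : R) (x : E) : 0 <= t -> Omega x ->
  {for x, continuous (divergence (u t))}.
Proof.
move=> t0 Ox; rewrite /prop_for /continuous_at /divergence.
have := @jcont_sum R d 'I_d (index_enum 'I_d) (fun i r y => 'D_(basis i) (fun z => u r z 0 i) y) t x.
move=> /(_ (fun i => flow_u_dx F t0 Ox)) /(jcont_slice t0).
by [].
Qed.

(** The transport formula: for [h = id] the last term disappears, and for other
    [h] it produces the velocity divergence against [s h' s - h s]. *)
Lemma transport (w wt : R -> E -> R) wx (h h' : R -> R) (t : R) :
  weight w wt wx -> supported_in K T1 w -> supported_in K T1 wt ->
  (forall i, supported_in K T1 (wx i)) ->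
  (forall r : R, 0 <= r -> is_derive r 1 h (h' r)) ->
  (forall r : R, 0 <= r -> {for r, continuous h'}) ->
  0 < t < T1 ->
  is_derive t 1 (fun r => mean (fun x => w r x * h (rho r x)))
    (mean (fun x => material u wt wx t x * h (rho t x)
       - w t x * ((rho t x * h' (rho t x) - h (rho t x)) * divergence (u t) x))).
Proof.
move=> ww w0 wt0 wx0 dh h'c tT; have /andP[t0 tT1] := tT.
have t0' := ltW t0.
have tT' : 0 <= t < T1 by rewrite t0'.
have hdiff (r : R) : 0 <= r -> differentiable h r.
  by move=> r0; apply/derivable1_diffP; have [] := dh r r0.
have hc (r : R) : 0 <= r -> {for r, continuous h}.
  by move=> r0; exact/differentiable_continuous/hdiff.
have hrc (r : R) x : 0 <= r -> Omega x -> jcont (fun r y => h (rho r y)) r x.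
  move=> r0 Ox; apply: jcont_comp; first exact: (flow_rho F).
  by apply: hc; exact: (flow_ge0 F).
have h'rc (r : R) x : 0 <= r -> Omega x -> jcont (fun r y => h' (rho r y)) r x.
  move=> r0 Ox; apply: jcont_comp; first exact: (flow_rho F).
  by apply: h'c; exact: (flow_ge0 F).
pose f (r : R) (x : E) := w r x * h (rho r x).
pose ft (r : R) (x : E) := w r x * (h' (rho r x) * rhot r x) + h (rho r x) * wt r x.
have fc : jcont_on T1 f.
  apply: (supported_jcont Kc KO) => [r x rT nKx|r x /andP[r0 _] Ox].
    by rewrite /f w0// mul0r.
  by apply: jcontM; [exact: (weight_jcont ww)|exact: hrc].
have ftc : jcont_on T1 ft.
  apply: (supported_jcont Kc KO) => [r x rT nKx|r x /andP[r0 _] Ox].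
    by rewrite /ft w0// wt0// mul0r mulr0 addr0.
  apply: jcontD; apply: jcontM.
  - exact: (weight_jcont ww).
  - by apply: jcontM; [exact: h'rc|exact: (flow_rhot F)].
  - exact: hrc.
  - exact: (weight_jcontt ww).
have dft (r : R) (x : E) : 0 < r < T1 -> is_derive r 1 (f ^~ x) (ft r x).
  move: r x; apply: (supported_is_derive_time KO) => [r x rT nKx|r x /andP[r0 _] Ox].
    by rewrite /f /ft w0// wt0// !mul0r mulr0 addr0.
  apply: is_deriveM; first exact: (weight_dt ww).
  apply: is_derive_chain; last exact: (flow_rho_dt F).
  by apply: dh; apply: (flow_ge0 F) => //; exact: ltW.
have := mean_is_derive c s0 fc ftc dft tT.
move/is_derive_eq; apply.
pose W (i : 'I_d) (y : E) := w t y * (h (rho t y) * u t y 0 i).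
pose g (y : E) := \sum_i (w t y * (h (rho t y) * 'D_(basis i) (fun z => u t z 0 i) y
    + u t y 0 i * (h' (rho t y) * 'D_(basis i) (rho t) y))
    + (h (rho t y) * u t y 0 i) * wx i t y).
have g0 x : ~ K x -> g x = 0.
  move=> nKx; rewrite /g big1// => i _.
  by rewrite w0// wx0// mul0r mulr0 addr0.
have gcO x : Omega x -> {for x, continuous g}.
  move=> Ox.
  have ct : {for x, continuous (fun y => h (rho t y))}.
    exact: (jcont_slice (ltW t0) (hrc t x (ltW t0) Ox)).
  have ct' : {for x, continuous (fun y => h' (rho t y))}.
    exact: (jcont_slice (ltW t0) (h'rc t x (ltW t0) Ox)).
  have cw : {for x, continuous (w t)}.
    by apply: (jcont_slice (ltW t0)); exact: (weight_jcont ww).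
  have cwx i : {for x, continuous (wx i t)}.
    by apply: (jcont_slice (ltW t0)); exact: (weight_jcontx ww).
  have cu i : {for x, continuous (fun y => u t y 0 i)}.
    by apply: (@jcont_slice R d (fun r y => u r y 0 i) t x (ltW t0)); exact: (flow_u F).
  have cdu i : {for x, continuous ('D_(basis i) (fun z => u t z 0 i))}.
    by apply: (@jcont_slice R d (fun r y => 'D_(basis i) (fun z => u r z 0 i) y) t x (ltW t0)); exact: (flow_u_dx F).
  have cdr i : {for x, continuous ('D_(basis i) (rho t))}.
    exact: (flow_rho_dx F (ltW t0) Ox).
  apply: continuous_bigsum => i; apply: continuousD_at.
    apply: continuousM_at => //; apply: continuousD_at; apply: continuousM_at => //.
    exact: continuousM_at.
  by apply: continuousM_at => //; exact: continuousM_at.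
have gW x : Omega x -> g x = \sum_j 'D_(basis j) (W j) x.
  move=> Ox; apply: eq_bigr => i _.
  have dw := weight_dx ww x i (ltW t0).
  have dr := derivableP (@diff_derivable _ _ _ _ _ (basis i) (flow_rho_diff F (ltW t0) Ox)).
  have dhr := is_derive_chain (dh _ (flow_ge0 F (ltW t0) Ox)) dr.
  have du := derivableP (@diff_derivable _ _ _ _ _ (basis i) (flow_u_diff F i (ltW t0) Ox)).
  have dW := is_deriveM dw (is_deriveM dhr du).
  by rewrite /W (@derive_val _ _ _ _ _ _ _ dW).
have dW j x : Omega x -> differentiable (W j) x.
  move=> Ox; apply: differentiableM; first exact: (weight_diff ww _ (ltW t0)).
  apply: differentiableM; last exact: (flow_u_diff F).
  apply: (differentiable_comp (flow_rho_diff F (ltW t0) Ox)).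
  by apply: hdiff; exact: (flow_ge0 F (ltW t0)).
have W0 j x : ~ K x -> W j x = 0 by move=> nKx; rewrite /W w0// mul0r.
have mg := mean_divergence_supported W0 g0 dW gW gcO.
have gcont := supported_continuous Kc KO g0 gcO.
rewrite -[LHS]addr0 -[X in _ + X = _]mg -meanD//; last 2 first.
- exact: jcont_on_bounded ftc tT'.
- exact: continuous_bounded_on_cube.
apply: (eq_mean s0) => x _.
have [Ox|nOx] := pselect (Omega x); last first.
  have nKx : ~ K x by move=> /KO.
  rewrite /ft g0// /material w0// wt0// !mul0r mulr0 !addr0 add0r big1 ?mul0r ?subr0//.
  by move=> i _; rewrite wx0// mulr0.
have ceq : rhot t x = - (\sum_i 'D_(basis i) (rho t) x * u t x 0 i
    + rho t x * divergence (u t) x).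
  apply/eqP; rewrite -addr_eq0 /divergence mulr_sumr -big_split /=.
  by rewrite (flow_continuity F t0 Ox).
have -> : g x = w t x * h (rho t x) * divergence (u t) x
    + w t x * h' (rho t x) * (\sum_i 'D_(basis i) (rho t) x * u t x 0 i)
    + h (rho t x) * \sum_i u t x 0 i * wx i t x.
  rewrite /g /divergence !mulr_sumr -!big_split /=.
  by apply: eq_bigr => i _; ring.
by rewrite /ft /material ceq; ring.
Qed.

Lemma transport_mass (w wt : R -> E -> R) wx (t : R) :
  weight w wt wx -> supported_in K T1 w -> supported_in K T1 wt ->
  (forall i, supported_in K T1 (wx i)) -> 0 < t < T1 ->
  is_derive t 1 (fun r => mean (fun x => w r x * rho r x))
    (mean (fun x => material u wt wx t x * rho t x)).
Proof.
move=> ww w0 wt0 wx0 tT.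
have did (r : R) : 0 <= r -> is_derive r 1 (fun q : R => q) (1 : R).
  by move=> _; exact: is_derive_id.
have c1 (r : R) : 0 <= r -> {for r, continuous (fun _ : R => 1 : R)}.
  by move=> _; exact: cvg_cst.
have := transport ww w0 wt0 wx0 did c1 tT; move/is_derive_eq; apply.
by apply: (eq_mean s0) => x _; rewrite mulr1 subrr mul0r mulr0 subr0.
Qed.

(** The virial identity: testing the momentum equation against the position
    turns the divergence of the stress into minus its trace.  The gradient of
    the weight does not contribute because it meets no stress. *)
Lemma virial (w wt : R -> E -> R) wx (S : 'I_d -> 'I_d -> E -> R) (t : R) :
  weight w wt wx -> supported_in K T1 w -> supported_in K T1 wt ->
  (forall i, supported_in K T1 (wx i)) ->
  0 < t < T1 ->
  (forall k j (x : E), Omega x -> differentiable (S k j) x) ->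
  (forall k (x : E), Omega x -> \sum_j 'D_(basis j) (S k j) x
     = rhot t x * u t x 0 k + rho t x * ut t x 0 k) ->
  (forall (x : E) k j, Omega x -> wx j t x * S k j x = 0) ->
  (forall (x : E), Omega x -> wt t x * rho t x = 0) ->
  is_derive t 1 (fun r => mean (fun x => w r x * \sum_k rho r x * u r x 0 k * x 0 k))
    (mean (fun x => - (w t x * \sum_k S k k x))).
Proof.
move=> ww w0 wt0 wx0 tT dS divS wxS wtr; have /andP[t0 tT1] := tT.
have t0' := ltW t0; have tT' : 0 <= t < T1 by rewrite t0'.
pose f (r : R) (x : E) := w r x * \sum_k rho r x * u r x 0 k * x 0 k.
pose m (r : R) (x : E) := \sum_k (rho r x * ut r x 0 k + u r x 0 k * rhot r x) * x 0 k.
pose ft (r : R) (x : E) := w r x * m r x + (\sum_k rho r x * u r x 0 k * x 0 k) * wt r x.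
have xc (r : R) (x : E) (k : 'I_d) : jcont (fun _ y => y 0 k) r x.
  by apply: (@jcont_pos R d (fun y : E => y 0 k) r x); exact: coord_continuous_at.
have pc (r : R) x : 0 <= r -> Omega x ->
    jcont (fun r x => \sum_k rho r x * u r x 0 k * x 0 k) r x.
  move=> r0 Ox; apply: jcont_sum => k; apply: jcontM; last exact: xc.
  by apply: jcontM; [exact: (flow_rho F)|exact: (flow_u F)].
have mc (r : R) x : 0 <= r -> Omega x -> jcont m r x.
  move=> r0 Ox; apply: jcont_sum => k; apply: jcontM; last exact: xc.
  apply: jcontD; apply: jcontM.
  - exact: (flow_rho F).
  - exact: (flow_ut F).
  - exact: (flow_u F).
  - exact: (flow_rhot F).
have fc : jcont_on T1 f.
  apply: (supported_jcont Kc KO) => [r x rT nKx|r x /andP[r0 _] Ox].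
    by rewrite /f w0// mul0r.
  by apply: jcontM; [exact: (weight_jcont ww)|exact: pc].
have ftc : jcont_on T1 ft.
  apply: (supported_jcont Kc KO) => [r x rT nKx|r x /andP[r0 _] Ox].
    by rewrite /ft w0// wt0// mul0r mulr0 addr0.
  apply: jcontD; apply: jcontM.
  - exact: (weight_jcont ww).
  - exact: mc.
  - exact: pc.
  - exact: (weight_jcontt ww).
have dft (r : R) (x : E) : 0 < r < T1 -> is_derive r 1 (f ^~ x) (ft r x).
  move: r x; apply: (supported_is_derive_time KO) => [r x rT nKx|r x /andP[r0 _] Ox].
    by rewrite /f /ft w0// wt0// !mul0r mulr0 addr0.
  apply: is_deriveM; first exact: (weight_dt ww).
  apply: is_derive_bigsum => k.
  have := is_deriveM (is_deriveM (flow_rho_dt F r0 Ox) (flow_u_dt F k r0 Ox))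
    (is_derive_cst (x 0 k) r 1).
  by move/is_derive_eq; apply; rewrite scaler0 add0r -[LHS]/(_ * _) mulrC.
have := mean_is_derive c s0 fc ftc dft tT.
move/is_derive_eq; apply.
pose W (j : 'I_d) (y : E) := w t y * \sum_k y 0 k * S k j y.
pose g (y : E) := w t y * (m t y + \sum_k S k k y).
have Sc k j x : Omega x -> {for x, continuous (S k j)}.
  by move=> Ox; apply: differentiable_continuous; exact: dS.
have g0 x : ~ K x -> g x = 0 by move=> nKx; rewrite /g w0// mul0r.
have W0 j x : ~ K x -> W j x = 0 by move=> nKx; rewrite /W w0// mul0r.
have gcO x : Omega x -> {for x, continuous g}.
  move=> Ox; apply: continuousM_at.
    by apply: (jcont_slice t0'); exact: (weight_jcont ww).
  apply: continuousD_at; last by apply: continuous_bigsum => k; exact: Sc.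
  by apply: (jcont_slice t0'); exact: mc.
have dW j x : Omega x -> differentiable (W j) x.
  move=> Ox; apply: differentiableM; first exact: (weight_diff ww).
  apply: differentiable_bigsum => k; apply: differentiableM; last exact: dS.
  exact: differentiable_coord.
have gW x : Omega x -> g x = \sum_j 'D_(basis j) (W j) x.
  move=> Ox.
  have dWj j : 'D_(basis j) (W j) x =
      w t x * (\sum_k (x 0 k * 'D_(basis j) (S k j) x)) + w t x * S j j x.
    have dw := weight_dx ww x j t0'.
    have dsum : is_derive x (basis j) (fun y : E => \sum_k y 0 k * S k j y)
        (\sum_k (x 0 k * 'D_(basis j) (S k j) x + S k j x * (k == j)%:R)).
      apply: is_derive_bigsum => k.
      have dSk := derivableP (@diff_derivable _ _ _ _ _ (basis j) (dS k j x Ox)).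
      exact: is_deriveM (is_derive_coord j k x) dSk.
    have dWj := is_deriveM dw dsum.
    rewrite /W (@derive_val _ _ _ _ _ _ _ dWj) -[_ *: _]/(_ * _) -[X in _ + X]/(_ * _).
    rewrite big_split /= [X in _ + X](_ : _ = 0); last first.
      by rewrite mulr_suml big1// => k _; rewrite -mulrA (mulrC (S k j x)) wxS// mulr0.
    rewrite addr0 mulrDr; congr (_ + _ * _).
    rewrite (bigD1 j) //= eqxx mulr1 big1 ?addr0// => k /negbTE ->.
    by rewrite mulr0.
  rewrite (eq_bigr _ (fun j _ => dWj j)) big_split /= -!mulr_sumr -mulrDr.
  congr (_ * (_ + _)); rewrite exchange_big /=; apply: eq_bigr => k _.
  by rewrite -mulr_sumr divS//; ring.
have mg := mean_divergence_supported W0 g0 dW gW gcO.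
have gcont := supported_continuous Kc KO g0 gcO.
rewrite -[RHS]addr0 -[X in _ = _ + X]mg -meanD//; last 2 first.
- apply: continuous_bounded_on_cube; apply: (supported_continuous Kc KO).
    by move=> x nKx; rewrite w0// mul0r oppr0.
  move=> x Ox; apply: continuousN_at; apply: continuousM_at.
    by apply: (jcont_slice t0'); exact: (weight_jcont ww).
  by apply: continuous_bigsum => k; exact: Sc.
- exact: continuous_bounded_on_cube.
apply: (eq_mean s0) => x _.
have [Ox|nOx] := pselect (Omega x); last first.
  have nKx : ~ K x by move=> /KO.
  by rewrite /ft g0// w0// wt0// !mul0r mulr0 oppr0.
rewrite /ft /g mulr_suml [X in _ + X]big1 ?addr0; first by ring.
by move=> k _; rewrite -!mulrA mulrC -!mulrA [X in _ * (_ * X)]wtr// !mulr0.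
Qed.

End flow.

(** * Entropies of power laws *)

Section entropy.
Context {R : realType}.
Implicit Types (al ga s th eps : R) (p : R -> R).

(** Convexity of [s ^ ga], by Young's inequality. *)
Lemma powR_tangent ga s th : 1 <= ga -> 0 <= s -> 0 <= th ->
  ga * th `^ (ga - 1) * s <= s `^ ga + (ga - 1) * th `^ ga.
Proof.
rewrite le_eqVlt => /orP[/eqP <-|ga1] s0 th0.
  by rewrite subrr powRr0 mulr1 mul1r mul0r addr0 powRr1.
have ga0 : 0 < ga by rewrite (lt_trans ltr01).
have ga10 : 0 < ga - 1 by rewrite subr_gt0.
have := @conjugate_powR R s (th `^ (ga - 1)) ga (ga / (ga - 1)) s0 (powR_ge0 _ _) ga0.
rewrite divr_gt0// => /(_ isT).
have -> : ga^-1 + (ga / (ga - 1))^-1 = 1.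
  by field; rewrite !gt_eqF.
move=> /(_ erefl); rewrite -powRrM (_ : (ga - 1) * _ = ga); last by field; rewrite gt_eqF.
rewrite -(ler_pM2l ga0) => /le_trans.
rewrite (_ : ga * th `^ (ga - 1) * s = ga * (s * th `^ (ga - 1))); last by ring.
apply; rewrite le_eqVlt; apply/orP; left; apply/eqP.
by field; rewrite !gt_eqF.
Qed.

(** When [s h'(s) - h(s) = p(s)], the continuity equation makes [- \int p(rho) div u]
    the time derivative of [\int h(rho)]; the error [delta] accommodates laws whose
    [h] is singular at vacuum.  The bounds on [h] precede [delta] and the range
    [S] of densities: these two depend on the length of the time interval under
    study, whereas the bounds must not. *)
Definition entropic p := exists2 C, 0 <= C &
  forall S0, 0 <= S0 -> exists C', forall delta S, 0 < delta -> 0 <= S ->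
  exists h h' : R -> R, [/\ h 0 = 0,
    (forall s, 0 <= s -> is_derive s 1 h (h' s)),
    (forall s, 0 <= s -> {for s, continuous h'}),
    (forall s, 0 <= s <= S -> `|s * h' s - h s - p s| <= delta) &
    (forall s, 0 <= s -> - C * (1 + s) <= h s) /\
    (forall s, 0 <= s <= S0 -> h s <= C')].

Lemma entropic0 : entropic (fun=> 0).
Proof.
exists 0 => // S0 S00; exists 0 => delta S delta0 S_0.
exists (cst 0), (cst 0); split.
- by [].
- by move=> s _; exact: is_derive_cst.
- by move=> s _; exact: cst_continuous.
- by move=> s _; rewrite mulr0 !subr0 normr0 ltW.
- by split=> // s _; rewrite oppr0 mul0r.
Qed.

Lemma entropicD p q : entropic p -> entropic q -> entropic (fun s => p s + q s).
Proof.
move=> [Cp Cp0 Hp] [Cq Cq0 Hq]; exists (Cp + Cq); first exact: addr_ge0.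
move=> S0 S00; have [Cp' {}Hp] := Hp S0 S00; have [Cq' {}Hq] := Hq S0 S00.
exists (Cp' + Cq') => delta S delta0 S_0.
have d2 : 0 < delta / 2 by rewrite divr_gt0.
have [h [h' [h0 dh ch hp [hlow hup]]]] := Hp (delta / 2) S d2 S_0.
have [k [k' [k0 dk ck kq [klow kup]]]] := Hq (delta / 2) S d2 S_0.
exists (fun s => h s + k s), (fun s => h' s + k' s); split.
- by rewrite h0 k0 addr0.
- by move=> s s0; apply: is_deriveD; [exact: dh|exact: dk].
- by move=> s s0; apply: cvgD; [exact: ch|exact: ck].
- move=> s sS; rewrite (splitr delta).
  have -> : s * (h' s + k' s) - (h s + k s) - (p s + q s) =
    (s * h' s - h s - p s) + (s * k' s - k s - q s) by ring.
  by apply: le_trans (ler_normD _ _) _; apply: lerD; [exact: hp|exact: kq].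
- split=> s s0; last by apply: lerD; [exact: hup|exact: kup].
  by have := hlow s s0; have := klow s s0; lra.
Qed.

Lemma entropicZ a p : 0 <= a -> entropic p -> entropic (fun s => a * p s).
Proof.
rewrite le_eqVlt => /orP[/eqP <- _|a0].
  by under eq_fun do rewrite mul0r; exact: entropic0.
move=> [C C0 Hp]; exists (a * C); first by rewrite mulr_ge0// ltW.
move=> S0 S00; have [C' {}Hp] := Hp S0 S00.
exists (a * C') => delta S delta0 S_0.
have da : 0 < delta / a by rewrite divr_gt0.
have [h [h' [h0 dh ch hp [hlow hup]]]] := Hp (delta / a) S da S_0.
exists (fun s => a * h s), (fun s => a * h' s); split.
- by rewrite h0 mulr0.
- by move=> s s0; apply: is_deriveZ; exact: dh.
- by move=> s s0; apply: cvgM; [exact: cvg_cst|exact: ch].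
- move=> s sS; have -> : s * (a * h' s) - a * h s - a * p s =
    a * (s * h' s - h s - p s) by ring.
  by rewrite normrM gtr0_norm// mulrC -ler_pdivlMr//; exact: hp.
- split=> s s0; last by rewrite ler_pM2l//; exact: hup.
  by rewrite -mulrN -mulrA ler_pM2l//; exact: hlow.
Qed.

(** The entropy of [s ^ al] is not differentiable at vacuum for small [al];
    shifting the argument by [eps] restores that, at the price of this error. *)
Lemma powR_regularized al s eps : 0 < al -> 0 <= s -> 0 < eps ->
  `|s ^+ 2 * (s + eps) `^ (al - 2) - s `^ al|
    <= (2 + al) * (eps * (s + eps) `^ (al - 1)).
Proof.
move=> al0 s0 eps0; set r := s + eps; have r0 : 0 < r by rewrite ltr_wpDl.
have rN0 : r != 0 by rewrite gt_eqF.
set q := r `^ (al - 1).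
have q0 : 0 <= q by exact: powR_ge0.
have rq : r `^ al = r * q by rewrite /q mulr_powRB1// ltW.
have q2 : r `^ (al - 2) = q / r.
  rewrite -(powR_inv1 (ltW r0)) -powRD; last by rewrite rN0 implybT.
  by congr (_ `^ _); ring.
have sr : s <= r by rewrite lerDl ltW.
have sal : s `^ al <= r * q.
  by rewrite -rq; apply: ge0_ler_powR => //; rewrite ?ltW// nnegrE// ltW.
have sal' : r * q - (1 + al) * eps * q <= s `^ al.
  have [al1|al1] := leP 1 al.
    have := powR_tangent al1 s0 (ltW r0); rewrite rq -/q.
    have -> : s = r - eps by rewrite /r addrK.
    have : 0 <= eps * q by rewrite mulr_ge0// ltW.
    by move=> h1 h2; lra.
  have sq : s * q <= s `^ al.
    have [->|sN0] := eqVneq s 0; first by rewrite mul0r powR_ge0.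
    have sp : 0 < s by rewrite lt0r sN0.
    rewrite -(mulr_powRB1 s0 al0) ler_pM2l// /q.
    have -> : al - 1 = - (1 - al) by ring.
    rewrite !powRN lef_pV2 ?posrE ?powR_gt0//.
    by apply: ge0_ler_powR => //; rewrite ?nnegrE ?subr_ge0// ltW.
  have : 0 <= al * (eps * q) by rewrite !mulr_ge0// ltW.
  have -> : r = s + eps by [].
  by move=> h; lra.
have -> : s ^+ 2 * r `^ (al - 2) = r * q - 2 * eps * q + eps ^+ 2 / r * q.
  rewrite q2 (_ : s = r - eps); last by rewrite /r addrK.
  by field.
have e1 : 0 <= eps ^+ 2 / r * q.
  by rewrite !mulr_ge0 ?invr_ge0 ?sqr_ge0// ltW.
have e2 : eps ^+ 2 / r * q <= eps * q.
  rewrite ler_wpM2r// ler_pdivrMr// expr2 ler_pM2l// /r lerDr//.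
have e3 : 0 <= eps * q by rewrite mulr_ge0// ltW.
have e4 : 0 <= al * (eps * q) by rewrite mulr_ge0// ltW.
by rewrite ler_norml; apply/andP; split; lra.
Qed.

Lemma powR_regularization_small al S delta : 0 < al -> 0 <= S -> 0 < delta ->
  exists2 eps, 0 < eps <= 1 & forall s, 0 <= s <= S ->
    (2 + al) * (eps * (s + eps) `^ (al - 1)) <= delta.
Proof.
move=> al0 S0 delta0; have al2 : 0 < 2 + al by rewrite addr_gt0.
pose e := delta / (2 + al); have e0 : 0 < e by rewrite divr_gt0.
have S1 : 0 < S + 1 by rewrite ltr_wpDl.
(* the second bound serves al < 1, the third one 1 <= al *)
pose eps := Num.min 1 (Num.min (e `^ al^-1) (e / (S + 1) `^ (al - 1))).
have eps0 : 0 < eps by rewrite !lt_min ltr01 powR_gt0// divr_gt0// powR_gt0.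
have eps1 : eps <= 1 by rewrite ge_min lexx.
exists eps; first by rewrite eps0.
move=> s /andP[s0 sS]; rewrite mulrC -ler_pdivlMr// -/e.
have r0 : 0 < s + eps by rewrite ltr_wpDl.
have [al1|al1] := leP 1 al.
  apply: (@le_trans _ _ (eps * (S + 1) `^ (al - 1))).
    rewrite ler_pM2l//; apply: ge0_ler_powR; rewrite ?subr_ge0// ?nnegrE ?(ltW r0) ?(ltW S1)//.
    exact: lerD.
  by rewrite -ler_pdivlMr ?powR_gt0// /eps !ge_min lexx !orbT.
apply: (@le_trans _ _ (eps * eps `^ (al - 1))).
  rewrite ler_pM2l//; have -> : al - 1 = - (1 - al) by ring.
  rewrite !powRN lef_pV2 ?posrE ?powR_gt0//.
  by apply: ge0_ler_powR; rewrite ?nnegrE ?subr_ge0 ?(ltW r0) ?(ltW eps0) ?(ltW al1)// lerDr.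
rewrite mulr_powRB1// ?(ltW eps0)//.
have -> : e = (e `^ al^-1) `^ al by rewrite -powRrM mulVf ?gt_eqF// powRr1// ltW.
apply: ge0_ler_powR; rewrite ?nnegrE ?powR_ge0 ?(ltW eps0) ?(ltW al0)//.
by rewrite /eps !ge_min lexx orbT.
Qed.

(** With [k' r = r ^ (al - 2)], the function [s k(s + eps)] is the entropy of
    the regularized law. *)
Lemma entropic_powR_of al (k : R -> R) (C : R) : 0 < al -> 0 <= C ->
  (forall r : R, 0 < r -> is_derive r 1 k (r `^ (al - 2))) ->
  (forall s eps, 0 <= s -> 0 < eps <= 1 -> - C * (1 + s) <= s * k (s + eps)) ->
  (forall S0, 0 <= S0 -> exists C', forall s eps, 0 <= s <= S0 -> 0 < eps <= 1 ->
     s * k (s + eps) <= C') ->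
  entropic (fun s => s `^ al).
Proof.
move=> al0 C0 dk klow kup; exists C => // S0 S00.
have [C' {}kup] := kup S0 S00; exists C' => delta S delta0 S_0.
have [eps eps01 small] := powR_regularization_small al0 S_0 delta0.
have /andP[eps0 eps1] := eps01.
exists (fun s => s * k (s + eps)), (fun s => s * (s + eps) `^ (al - 2) + k (s + eps)).
have sh s : is_derive s 1 (fun s => s + eps) (1 : R).
  by apply: is_derive_eq; rewrite addr0.
have dk_ s : 0 <= s -> is_derive s 1 (fun s => k (s + eps)) ((s + eps) `^ (al - 2)).
  move=> s0; have r0 : 0 < s + eps by rewrite ltr_wpDl.
  have := @is_derive1_comp R k (fun s => s + eps) s _ _ (dk _ r0) (sh s).
  by rewrite mulr1.
have cshift s : {for s, continuous (fun s => s + eps)}.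
  by apply: continuousD_at; [exact: cvg_id|exact: cvg_cst].
split.
- by rewrite mul0r.
- move=> s s0; have := is_deriveM (is_derive_id s 1) (dk_ s s0).
  by move/is_derive_eq; apply; rewrite -[_ *: _]/(_ * _) -[X in _ + X]/(_ * _) mulr1.
- move=> s s0; have r0 : 0 < s + eps by rewrite ltr_wpDl.
  have c_at (f : R -> R) a : is_derive (s + eps) 1 f a ->
      {for s, continuous (fun s => f (s + eps))}.
    move=> [df _]; apply: (continuous_comp (cshift s)).
    by apply/differentiable_continuous/derivable1_diffP.
  apply: continuousD_at; last exact: c_at (dk _ r0).
  apply: continuousM_at; first exact: cvg_id.
  exact: (c_at (fun r => r `^ (al - 2)) _ (is_derive1_powR _ r0)).
- move=> s sS; have /andP[s0 _] := sS.
  have -> : s * (s * (s + eps) `^ (al - 2) + k (s + eps)) - s * k (s + eps) - s `^ al =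
     s ^+ 2 * (s + eps) `^ (al - 2) - s `^ al by ring.
  exact: le_trans (powR_regularized al0 s0 eps0) (small s sS).
- by split=> s ss; [exact: klow|exact: kup].
Qed.

(** The entropy is [s ^ al / (al - 1)], or [s ln s] for [al = 1]; in each case it
    is bounded below by an affine function of [s]. *)
Lemma entropic_powR al : 0 < al -> entropic (fun s => s `^ al).
Proof.
move=> al0; have [al1|al1|al1] := ltgtP al 1.
- have al10 : 0 < 1 - al by rewrite subr_gt0.
  have alN : al - 1 != 0 by rewrite lt_eqF// subr_lt0.
  apply: (@entropic_powR_of al (fun r => (al - 1)^-1 * r `^ (al - 1)) (2 / (1 - al))) => //.
  + by rewrite divr_ge0// ltW.
  + move=> r r0; have := is_derive1_powR (al - 1) r0 => dp.
    have := is_deriveZ (al - 1)^-1 dp; move/is_derive_eq; apply.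
    rewrite -[LHS]/(_ * _) mulrA mulVf// mul1r; congr (_ `^ _); ring.
  + move=> s eps s0 /andP[eps0 eps1].
    have r0 : 0 < s + eps by rewrite ltr_wpDl.
    have h1 : s * (s + eps) `^ (al - 1) <= 2 * (1 + s).
      apply: (@le_trans _ _ ((s + eps) * (s + eps) `^ (al - 1))).
        by rewrite ler_wpM2r ?powR_ge0// lerDl ltW.
      rewrite mulr_powRB1// ?(ltW r0)//.
      have [r1|r1] := leP (s + eps) 1.
        apply: (@le_trans _ _ 1); last by lra.
        rewrite -(powRr0 (s + eps)); apply: ger_powR; rewrite ?r0//.
        exact: ltW.
      by apply: le_trans (ler1_powR (ltW r1) (ltW al1)) _; lra.
    have -> : (al - 1)^-1 = - (1 - al)^-1 by rewrite -invrN opprB.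
    have -> : - (2 / (1 - al)) * (1 + s) = - ((1 - al)^-1 * (2 * (1 + s))) by ring.
    rewrite (_ : s * _ = - ((1 - al)^-1 * (s * (s + eps) `^ (al - 1)))); last by ring.
    by rewrite lerN2 ler_pM2l ?invr_gt0.
  + move=> S0 S00; exists 0 => s eps /andP[s0 _] /andP[eps0 _].
    rewrite mulr_ge0_le0// mulr_le0_ge0// ?powR_ge0// invr_le0 subr_le0 ltW//.
- have al10 : 0 < al - 1 by rewrite subr_gt0.
  have alN : al - 1 != 0 by rewrite gt_eqF.
  apply: (@entropic_powR_of al (fun r => (al - 1)^-1 * r `^ (al - 1)) 0) => //.
  + move=> r r0; have := is_derive1_powR (al - 1) r0 => dp.
    have := is_deriveZ (al - 1)^-1 dp; move/is_derive_eq; apply.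
    rewrite -[LHS]/(_ * _) mulrA mulVf// mul1r; congr (_ `^ _); ring.
  + move=> s eps s0 _; rewrite oppr0 mul0r !mulr_ge0 ?powR_ge0 ?invr_ge0// ltW//.
  + move=> S0 S00; exists (S0 * ((al - 1)^-1 * (S0 + 1) `^ (al - 1))).
    move=> s eps /andP[s0 sS] /andP[eps0 eps1].
    have r0 : 0 < s + eps by rewrite ltr_wpDl.
    apply: ler_pM => //; first by rewrite mulr_ge0 ?powR_ge0 ?invr_ge0// ltW.
    rewrite ler_pM2l ?invr_gt0//; apply: ge0_ler_powR; rewrite ?(ltW al10)// ?nnegrE ?(ltW r0) ?addr_ge0//.
    exact: lerD.
- rewrite al1; apply: (@entropic_powR_of 1 (@ln R) 1) => //.
  + move=> r r0; have := is_derive1_ln r0; move/is_derive_eq; apply.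
    by rewrite -powR_inv1 ?ltW//; congr (_ `^ _); ring.
  + move=> s eps s0 /andP[eps0 _].
    have [->|sN0] := eqVneq s 0; first by rewrite mul0r addr0 mulr1 oppr_le0.
    have sp : 0 < s by rewrite lt0r sN0.
    have h : 1 - s^-1 <= ln (s + eps).
      apply: (@le_trans _ _ (ln s)); last by rewrite ler_ln ?posrE// ?lerDl ?ltW// ltr_wpDl.
      rewrite -[X in ln X]invrK lnV ?posrE ?invr_gt0// lerNr opprB.
      have -> : s^-1 = 1 + (s^-1 - 1) by ring.
      have : -1 < s^-1 - 1 by rewrite ltrBrDr addNr invr_gt0.
      by move/le_ln1Dx/le_trans; apply; lra.
    have : s * (1 - s^-1) <= s * ln (s + eps) by rewrite ler_pM2l.
    by rewrite mulrBr mulfV// mulr1; lra.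
  + move=> S0 S00; exists (S0 * (S0 + 1)) => s eps /andP[s0 sS] /andP[eps0 eps1].
    have r0 : 0 < s + eps by rewrite ltr_wpDl.
    apply: (@le_trans _ _ (s * (s + eps))).
      by rewrite ler_wpM2l//; exact/ltW/ln_sublinear.
    by apply: ler_pM; rewrite ?(ltW r0)//; exact: lerD.
Qed.

End entropy.

(** * Particle paths and their tubes *)

Section particle_paths.
Context {R : realType} {d : nat}.
Local Notation E := 'rV[R]_d.

Lemma sqnorm_ge0 (v : E) : 0 <= sqnorm v.
Proof. by apply: sumr_ge0 => i _; exact: sqr_ge0. Qed.

Lemma sqnorm0 : sqnorm (0 : E) = 0.
Proof. by apply: big1 => i _; rewrite mxE expr0n. Qed.

Lemma coord_le_sqnorm (v : E) i : v 0 i ^+ 2 <= sqnorm v.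
Proof. by rewrite /sqnorm (bigD1 i) //= lerDl sumr_ge0// => j _; exact: sqr_ge0. Qed.

Lemma norm_le_sqnorm (v : E) : `|v| ^+ 2 <= sqnorm v.
Proof.
have s0 := sqnorm_ge0 v; rewrite -(sqr_sqrtr s0) ler_sqr ?nnegrE ?sqrtr_ge0//.
apply/row_norm_leP; first exact: sqrtr_ge0.
by move=> i; rewrite -sqrtr_sqr ler_wsqrtr// coord_le_sqnorm.
Qed.

Variables (Omega : set E) (rho rhot : R -> E -> R) (u ut : R -> E -> E).
Hypothesis oO : open Omega.
Hypothesis F : regular_flow Omega rho rhot u ut.

Record path_of (X : R -> E) : Prop := PathOf {
  path_in : forall t : R, 0 <= t -> Omega (X t) ;
  path_cont : forall t : R, 0 <= t -> X r @[r --> time_nbhs t] --> X t ;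
  path_dt : forall (t : R) i, 0 < t ->
    is_derive t 1 (fun r => X r 0 i) (u t (X t) 0 i) }.

Lemma path_coord_cont X (t : R) i : path_of X -> 0 <= t ->
  X r 0 i @[r --> time_nbhs t] --> X t 0 i.
Proof.
move=> PX t0; apply: (cvg_comp X (fun y : E => y 0 i) (path_cont PX t0)).
exact: coord_continuous_at.
Qed.

Lemma path_compose X f (t : R) : path_of X -> 0 <= t -> jcont f t (X t) ->
  f r (X r) @[r --> time_nbhs t] --> f t (X t).
Proof.
move=> PX t0 fc; apply: (cvg_comp (fun r => (r, X r)) (fun p => f p.1 p.2) _ fc).
have F1 := time_nbhs_filter t.
have idc : (fun r : R => r) @ time_nbhs t --> time_nbhs t by exact: cvg_id.
exact: (cvg_pair idc (path_cont PX t0)).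
Qed.

(** Along a path, on a bounded time interval, a tube of fixed radius stays in
    [Omega] and carries a bound on the gradient of [u]: this holds near each
    time, and a compactness argument makes the constants uniform. *)
Lemma path_tube X T1 : path_of X -> exists2 eps, 0 < eps &
  exists2 M, 0 <= M & forall (t : R) (x : E), 0 <= t <= T1 -> `|x - X t| <= eps ->
    Omega x /\ forall i k, `|'D_(basis i) (fun z => u t z 0 k) x| <= M.
Proof.
move=> PX.
pose P (n : nat) (t : R) := 0 <= t -> forall x : E, `|x - X t| <= n.+1%:R^-1 ->
  Omega x /\ forall i k, `|'D_(basis i) (fun z => u t z 0 k) x| <= n%:R.
suff [N _ NP] : \forall n \near \oo, `[0, T1]%classic `<=` P n.
  exists N.+1%:R^-1; first by rewrite invr_gt0.
  exists N%:R; first by [].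
  move=> t x tT xX; have /andP[t0 _] := tT.
  by apply: (NP N (leqnn N) t _ t0) => //=; rewrite in_itv.
have := @segment_compact R 0 T1 => /compact_near_coveringP.
move=> /(_ nat \oo P); apply => t; rewrite /= in_itv /= => /andP[t0 tT].
have OX := path_in PX t0.
pose D i k (r : R) (x : E) := 'D_(basis i) (fun z => u r z 0 k) x.
pose M := \sum_i \sum_k `|D i k t (X t)| + 1.
have F1 := jfilter_filter t (X t).
have near_p : \forall p \near filter_prod (time_nbhs t) (nbhs (X t)),
    Omega p.2 /\ forall i k, `|D i k p.1 p.2| <= M.
  near=> p; split.
    near: p; exists (setT, Omega) => /=; last by move=> [a b] [].
    by split; [exact: filterT|exact: oO].
  near: p; apply: filter_forall => i; apply: filter_forall => k.
  have Dc : jcont (D i k) t (X t) by exact: (flow_u_dx F).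
  have /cvgrPdist_le/(_ _ ltr01) := Dc.
  apply: filterS => p /=; rewrite distrC => Dp.
  have DM : `|D i k t (X t)| <= M - 1.
    rewrite /M addrK (bigD1 i) //= (bigD1 k) //= -addrA lerDl addr_ge0//.
      by apply: sumr_ge0 => k' _.
    by apply: sumr_ge0 => i' _; apply: sumr_ge0 => k' _.
  have -> : D i k p.1 p.2 = (D i k p.1 p.2 - D i k t (X t)) + D i k t (X t).
    by rewrite subrK.
  by apply: le_trans (ler_normD _ _) _; rewrite addrC -lerBrDr (le_trans DM)// lerB.
have [[A B] /= [tA /nbhs_ballP[e /= e0 eB]] AB] := near_p.
have e2 : 0 < e / 2 by rewrite divr_gt0.
have tX : \forall r \near nbhs t, 0 <= r -> A r /\ `|X t - X r| < e / 2.
  have : \forall r \near time_nbhs t, A r /\ `|X t - X r| < e / 2.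
    have F2 := time_nbhs_filter t.
    apply: filterI => //.
    by have /cvgrPdist_lt := path_cont PX t0; exact.
  by apply: filterS => r; exact.
have nn : \forall n \near \oo, M <= n%:R /\ n.+1%:R^-1 < e / 2.
  near=> n; split.
    by near: n; exact: nbhs_infty_ger.
  by near: n; exact: near_infty_natSinv_lt (PosNum e2).
exists ([set r | 0 <= r -> A r /\ `|X t - X r| < e / 2],
  [set n | M <= n%:R /\ n.+1%:R^-1 < e / 2]) => //.
move=> [r n] /= [rA [Mn ne]] r0 x xX; have [Ar Xr] := rA r0.
have Bx : B x.
  apply: eB; rewrite -ball_normE /=.
  have -> : X t - x = (X t - X r) + - (x - X r) by rewrite opprB addrA subrK.
  apply: le_lt_trans (ler_normD _ _) _; rewrite normrN (splitr e) ltrD//.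
  exact: le_lt_trans xX ne.
have [Ox Dx] := AB (r, x) (conj Ar Bx).
by split => // i k; exact: le_trans (Dx i k) Mn.
Unshelve. all: by end_near. Qed.

Definition scalar_product (v : E) (w : E) := \sum_i v 0 i * w 0 i.

(** Distances to the path change at a relative rate at most [L]. *)
Lemma path_lipschitz X T1 : path_of X -> exists2 eps, 0 < eps &
  exists2 L, 0 <= L & forall (t : R) (x : E), 0 <= t <= T1 -> `|x - X t| <= eps ->
    Omega x /\
    `|scalar_product (x - X t) (u t x - u t (X t))| <= L * sqnorm (x - X t).
Proof.
move=> PX; have [eps eps0 [M M0 tube]] := path_tube T1 PX.
exists eps => //; exists (d%:R * (d%:R * M)); first by rewrite !mulr_ge0.
move=> t x tT xX; split; first by have [] := tube t x tT xX.
have /andP[t0 _] := tT.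
have lip k : `|u t x 0 k - u t (X t) 0 k| <= d%:R * M * `|x - X t|.
  apply: (partials_lipschitz (f := fun z => u t z 0 k)) => z i zx.
  have [Oz Dz] := tube t z tT (le_trans zx xX).
  by split=> //; apply: diff_derivable; exact: (flow_u_diff F).
apply: le_trans (ler_norm_sum _ _ _) _.
apply: (@le_trans _ _ (\sum_(i < d) (d%:R * M) * `|x - X t| ^+ 2)).
  apply: ler_sum => i _; rewrite normrM expr2 mulrCA ler_pM// ?coord_le_norm//.
  by rewrite !mxE lip.
rewrite sumr_const card_ord -[leLHS]mulr_natl -[leRHS]mulrA; apply: ler_wpM2l => //.
by apply: ler_wpM2l; rewrite ?mulr_ge0 ?norm_le_sqnorm.
Qed.

End particle_paths.

Section tubes.
Context {R : realType} {d : nat}.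
Local Notation E := 'rV[R]_d.
Variables (Omega : set E) (rho rhot : R -> E -> R) (u ut : R -> E -> E).
Hypothesis oO : open Omega.
Hypothesis F : regular_flow Omega rho rhot u ut.
Variable T1 : R.
Local Notation path_of := (path_of Omega u).

Record tube_data (X : R -> E) (eps L : R) : Prop := TubeData {
  td_path : path_of X ;
  td_eps : 0 < eps ;
  td_L : 0 <= L ;
  td_lip : forall (t : R) (x : E), 0 <= t <= T1 -> `|x - X t| <= eps ->
    Omega x /\ `|scalar_product (x - X t) (u t x - u t (X t))| <= L * sqnorm (x - X t) }.

Definition bump (c k : R) (X : R -> E) (t : R) (x : E) : R := plateau (tube c k X t x).
Definition bump_dt (c k : R) (X : R -> E) (t : R) (x : E) : R :=
  plateau' (tube c k X t x) * tube_dt c k X (fun r => u r (X r)) t x.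
Definition bump_dx (c k : R) (X : R -> E) (i : 'I_d) (t : R) (x : E) : R :=
  plateau' (tube c k X t x) * tube_dx c k X i t x.

Lemma weight_bump (c k : R) (X : R -> E) : path_of X ->
  weight (bump c k X) (bump_dt c k X) (bump_dx c k X).
Proof.
move=> PX; apply: (weight_comp (@is_derive_plateau R) (@continuous_plateau' R)).
apply: weight_tube => [t i t0|t i t0|t i t0].
- exact: (path_coord_cont PX t0).
- apply: (path_compose (f := fun r y => u r y 0 i) PX t0).
  by apply: (flow_u F) => //; exact: (path_in PX).
- exact: (path_dt PX).
Qed.

(** The path moves with the flow, so only velocity differences remain. *)
Lemma material_bump (c k : R) (X : R -> E) (t : R) (x : E) :
  material u (bump_dt c k X) (bump_dx c k X) t x =
  plateau' (tube c k X t x) * (c * expR (k * t)) *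
   (k * sqnorm (x - X t) + 2 * scalar_product (x - X t) (u t x - u t (X t))).
Proof.
rewrite /material /bump_dt /bump_dx /tube_dt /tube_dx /scalar_product.
set p := plateau' _; set e := c * _.
have -> : \sum_i u t x 0 i * (p * (e * (2 * (x - X t) 0 i))) =
   p * e * (2 * \sum_i (x - X t) 0 i * u t x 0 i).
  by rewrite !mulr_sumr; apply: eq_bigr => i _; ring.
have -> : \sum_i (x - X t) 0 i * (u t x - u t (X t)) 0 i =
  \sum_i (x - X t) 0 i * u t x 0 i - \sum_i (x - X t) 0 i * u t (X t) 0 i.
  by rewrite -sumrB; apply: eq_bigr => i _; rewrite !mxE; ring.
by ring.
Qed.

Section one_tube.
Variables (X : R -> E) (eps L : R).
Hypothesis D : tube_data X eps L.
Let eps0 := td_eps D.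
Let L0 := td_L D.

(** The outer bump shrinks at least as fast as the flow can compress the tube,
    and [outer_c] keeps its support within distance [eps] of the path; the inner
    one grows at least as fast as the flow can dilate the tube, and [inner_c]
    keeps it, up to time [T1], where the outer bump equals 1. *)
Definition outer_c := 2 / eps ^+ 2.
Definition inner_c := 4 * expR (4 * L * T1) / eps ^+ 2.

Let eps20 : 0 < eps ^+ 2. Proof. exact: exprn_gt0. Qed.

Lemma outer_c_gt0 : 0 < outer_c. Proof. by rewrite divr_gt0. Qed.
Lemma inner_c_gt0 : 0 < inner_c. Proof. by rewrite divr_gt0// mulr_gt0// expR_gt0. Qed.

Lemma outer_far (t : R) (x : E) : 0 <= t -> eps < `|x - X t| ->
  2 <= tube outer_c (2 * L) X t x.
Proof.
move=> t0 far.
have h1 : eps ^+ 2 <= sqnorm (x - X t).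
  apply: le_trans _ (norm_le_sqnorm _).
  by rewrite ler_sqr ?nnegrE ?(ltW eps0)// ltW.
have h2 : 1 <= expR (2 * L * t) by rewrite -expR0 ler_expR !mulr_ge0.
rewrite /tube /outer_c -mulrA.
apply: (@le_trans _ _ (2 / eps ^+ 2 * (1 * eps ^+ 2))).
  by rewrite mul1r divfK// gt_eqF.
by rewrite ler_pM2l ?divr_gt0// ler_pM// ltW.
Qed.

Lemma outer_near (t : R) (x : E) : 0 <= t -> tube outer_c (2 * L) X t x < 2 ->
  `|x - X t| <= eps.
Proof.
by move=> t0; rewrite ltNge; apply: contraNle => /(outer_far t0).
Qed.

Lemma inner_near_outer1 (t : R) (x : E) : 0 <= t <= T1 ->
  tube inner_c (- (2 * L)) X t x < 2 -> tube outer_c (2 * L) X t x <= 1.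
Proof.
move=> /andP[t0 tT]; rewrite /tube; set z := sqnorm _ => hz.
have z0 : 0 <= z by exact: sqnorm_ge0.
have e1 : expR (2 * L * t) * expR (2 * L * t) <= expR (4 * L * T1).
  rewrite -expRD ler_expR.
  by have := ler_wpM2l L0 tT; lra.
have hz' : 4 * expR (4 * L * T1) * z < 2 * eps ^+ 2 * expR (2 * L * t).
  move: hz; rewrite /inner_c mulNr expRN.
  have -> : 4 * expR (4 * L * T1) / eps ^+ 2 * (expR (2 * L * t))^-1 * z =
    (4 * expR (4 * L * T1) * z) / (eps ^+ 2 * expR (2 * L * t)).
    by field; rewrite !gt_eqF// expR_gt0.
  by rewrite ltr_pdivrMr ?mulr_gt0 ?expR_gt0// mulrA.
rewrite /outer_c.
have -> : 2 / eps ^+ 2 * expR (2 * L * t) * z = (2 * expR (2 * L * t) * z) / eps ^+ 2.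
  by field; rewrite gt_eqF.
rewrite ler_pdivrMr// mul1r.
have ep : 0 < expR (2 * L * t) by exact: expR_gt0.
rewrite -(ler_pM2l ep).
have : expR (2 * L * t) * expR (2 * L * t) * z <= expR (4 * L * T1) * z by rewrite ler_wpM2r.
by move=> h; lra.
Qed.

Lemma outer_material_le0 (t : R) (x : E) : 0 <= t <= T1 ->
  material u (bump_dt outer_c (2 * L) X) (bump_dx outer_c (2 * L) X) t x <= 0.
Proof.
move=> tT; have /andP[t0 _] := tT; rewrite material_bump.
have [->|/plateau'_neq0 near2] := eqVneq (plateau' (tube outer_c (2 * L) X t x)) 0.
  by rewrite !mul0r.
have [_ lip] := td_lip D tT (outer_near t0 near2).
rewrite mulr_le0_ge0//.
  by rewrite mulr_le0_ge0 ?plateau'_le0// mulr_ge0 ?expR_ge0// ltW// outer_c_gt0.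
by move: lip; rewrite ler_norml => /andP[]; lra.
Qed.

Lemma inner_material_ge0 (t : R) (x : E) : 0 <= t <= T1 ->
  0 <= material u (bump_dt inner_c (- (2 * L)) X) (bump_dx inner_c (- (2 * L)) X) t x.
Proof.
move=> tT; have /andP[t0 _] := tT; rewrite material_bump.
have [->|/plateau'_neq0 near2] := eqVneq (plateau' (tube inner_c (- (2 * L)) X t x)) 0.
  by rewrite !mul0r.
have near1 := inner_near_outer1 tT near2.
have [|_ lip] := td_lip D tT (outer_near t0 (x := x) _); first by apply: le_lt_trans near1 _; lra.
rewrite mulr_le0//.
  by rewrite mulr_le0_ge0 ?plateau'_le0// mulr_ge0 ?expR_ge0// ltW// inner_c_gt0.
by move: lip; rewrite ler_norml => /andP[]; lra.
Qed.

Definition tube_set : set E :=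
  [set x | exists2 t, 0 <= t <= T1 & `|x - X t| <= eps].

Lemma tube_set_sub : tube_set `<=` Omega.
Proof. by move=> x [t tT xX]; have [] := td_lip D tT xX. Qed.

(** Compactness of the time interval turns pointwise separation from the path
    into separation on a neighbourhood. *)
Lemma tube_set_closed : closed tube_set.
Proof.
rewrite -[tube_set]setCK; apply: open_closedC; rewrite openE => x nx.
have FX := nbhs_filter x.
pose P (y : E) (t : R) := 0 <= t -> eps < `|y - X t|.
suff : \forall y \near nbhs x, `[0, T1]%classic `<=` P y.
  apply: filterS => y yP [t tT]; have /andP[t0 _] := tT.
  by apply/negP; rewrite -ltNge; apply: yP => //=; rewrite in_itv.
have := @segment_compact R 0 T1 => /compact_near_coveringP.
move=> /(_ _ (nbhs x) P FX); apply => t; rewrite /= in_itv /= => tT.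
have /andP[t0 _] := tT.
have far : 0 < (`|x - X t| - eps) / 2.
  rewrite divr_gt0// subr_gt0 ltNge; apply/negP => h; apply: nx.
  by exists t.
set e := _ / 2 in far.
have tX : \forall r \near nbhs t, 0 <= r -> `|X t - X r| < e.
  have : \forall r \near time_nbhs t, `|X t - X r| < e.
    by have /cvgrPdist_lt := path_cont (td_path D) t0; exact.
  by apply: filterS => r; exact.
have xX : \forall y \near nbhs x, `|x - y| < e.
  by apply/nbhs_ballP; exists e => // y; rewrite -ball_normE.
exists ([set r | 0 <= r -> `|X t - X r| < e], [set y | `|x - y| < e]) => //.
move=> [r y] /= [rX xy] r0; have {}rX := rX r0.
have h : `|x - X t| <= `|x - y| + `|y - X r| + `|X t - X r|.
  have -> : x - X t = (x - y) + (y - X r) - (X t - X r).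
    by rewrite opprB !addrA subrK subrK.
  by apply: le_trans (ler_normB _ _) _; rewrite lerD2r ler_normD.
by move: h rX xy; rewrite /e; lra.
Qed.

End one_tube.
End tubes.

(** * Cutoffs that travel with the isolated mass *)

Section cutoffs.
Context {R : realType} {d : nat}.
Local Notation E := 'rV[R]_d.
Variables (Omega : set E) (rho rhot : R -> E -> R) (u ut : R -> E -> E).
Hypothesis oO : open Omega.
Hypothesis F : regular_flow Omega rho rhot u ut.
Variables (T1 : R) (A U : set E).
Hypotheses (T10 : 0 <= T1) (cA : compact A) (oU : open U) (AU : A `<=` U).
Hypothesis A0 : A !=set0.
Local Notation path_of := (path_of Omega u).
Local Notation tube_data := (tube_data Omega u T1).
Hypothesis paths : forall a, A a -> exists2 X, X 0 = a & path_of X.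

Lemma tube_data_exists a : A a -> exists X eps L,
  [/\ X 0 = a, tube_data X eps L & forall x, `|x - a| <= eps -> U x].
Proof.
move=> Aa; have [X X0 PX] := paths Aa.
have [e1 e10 [L L0 lip]] := path_lipschitz oO F T1 PX.
have /nbhs_ballP[e2 /= e20 ballU] : nbhs a U by apply: oU; exact: AU.
exists X, (Num.min e1 (e2 / 2)), L; split => //.
  split=> // [|t x tT xX]; first by rewrite lt_min e10 divr_gt0.
  by apply: lip => //; apply: le_trans xX _; rewrite ge_min lexx.
move=> x xa; apply: ballU; rewrite -ball_normE /= distrC.
apply: le_lt_trans xa _; rewrite gt_min; apply/orP; right.
by rewrite ltr_pdivrMr// ltr_pMr// ltr1n.
Qed.

(** [eta] decreases along the flow and starts in the vacuum gap [U] minus [A], so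
    [eta rho] stays zero; where [eta] vanishes, [chi] is locally constant.  Thus
    [chi] separates the isolated mass from the rest without cutting through any
    mass. *)
Record cutoff_pair (K : set E) (eta etat : R -> E -> R) (etax : 'I_d -> R -> E -> R)
    (chi chit : R -> E -> R) (chix : 'I_d -> R -> E -> R) : Prop := CutoffPair {
  cut_closed : closed K ;
  cut_sub : K `<=` Omega ;
  cut_eta : weight eta etat etax ;
  cut_chi : weight chi chit chix ;
  cut_eta_supp : supported_in K T1 eta ;
  cut_etat_supp : supported_in K T1 etat ;
  cut_etax_supp : forall i, supported_in K T1 (etax i) ;
  cut_chi_supp : supported_in K T1 chi ;
  cut_chit_supp : supported_in K T1 chit ;
  cut_chix_supp : forall i, supported_in K T1 (chix i) ;
  cut_eta_ge0 : forall t x, 0 <= eta t x ;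
  cut_chi_ge0 : forall t x, 0 <= chi t x ;
  cut_chi_le1 : forall t x, chi t x <= 1 ;
  cut_eta_decr : forall (t : R) (x : E), 0 <= t <= T1 ->
    material u etat etax t x <= 0 ;
  cut_eta_init : forall x, eta 0 x != 0 -> U x /\ ~ A x ;
  cut_locally_cst : forall (t : R) (x : E), 0 <= t <= T1 -> eta t x = 0 ->
    chit t x = 0 /\ forall i, chix i t x = 0 ;
  cut_chi_in : forall x, A x -> chi 0 x = 1 ;
  cut_chi_out : forall x, ~ U x -> chi 0 x = 0 }.

(** Finitely many paths starting in [A] suffice, their inner bumps covering [A].
    With [sigma] the sum of the outer bumps, [tau] that of the inner ones and [q]
    a decreasing function that is 0 from 1 on, take [eta = sigma q(tau)] and
    [chi = 1 - q(sigma)].  Where [eta] vanishes, either [sigma = 0], or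
    [tau >= 1], and then some inner bump is positive, whence [sigma >= 1]. *)
Lemma cutoff_pair_exists :
  exists K eta etat etax chi chit chix, cutoff_pair K eta etat etax chi chit chix.
Proof.
pose Q a (p : (R -> E) * R * R) := tube_data p.1.1 p.1.2 p.2 /\
    (A a -> p.1.1 0 = a /\ forall x, `|x - a| <= p.1.2 -> U x).
have exQ a : exists p, Q a p.
  have [Aa|nAa] := pselect (A a).
    by have [X [eps [L [X0 XT XU]]]] := tube_data_exists Aa; exists (X, eps, L).
  (* outside [A] any tube serves as a default value *)
  have [b Ab] := A0.
  by have [X [eps [L [X0 XT XU]]]] := tube_data_exists Ab; exists (X, eps, L).
have [D DP] := boolp.choice exQ.
pose X a := (D a).1.1; pose eps a := (D a).1.2; pose L a := (D a).2.
have TD a : tube_data (X a) (eps a) (L a) by have [] := DP a.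
pose inn a := tube (inner_c T1 (eps a) (L a)) (- (2 * L a)) (X a).
pose out a := tube (outer_c (eps a)) (2 * L a) (X a).
have cinn a (x : E) : {for x, continuous (inn a 0)}.
  have PX := td_path (TD a).
  have ww := weight_tube (inner_c T1 (eps a) (L a)) (- (2 * L a))
    (X := X a) (X' := fun r => u r (X a r)).
  apply: (jcont_slice (lexx 0)); apply: (weight_jcont (ww _ _ _)) => //.
  - by move=> t i t0; exact: (path_coord_cont PX t0).
  - move=> t i t0; apply: (path_compose (f := fun r y => u r y 0 i) PX t0).
    by apply: (flow_u F) => //; exact: (path_in PX).
  - by move=> t i t0; exact: (path_dt PX).
have [s sA scov] : exists2 s : seq E, {in s, forall a, A a} &
    forall x, A x -> exists2 a, a \in s & inn a 0 x < 1.
  have := cA; rewrite compact_cover => /(_ E A (fun a => [set x | inn a 0 x < 1])).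
  case.
  - move=> a Aa; rewrite openE => x /= hx; have := cinn a x.
    move=> /(_ [set y | y < 1]); apply; exact: lt_nbhsl.
  - move=> x Ax; exists x => //=; rewrite /inn /tube.
    have [_ /(_ Ax)[X0 _]] := DP x.
    by rewrite [X x 0]X0 subrr sqnorm0 mulr0.
  move=> s sA Acov; exists (finmap.enum_fset s) => [a /sA|x /Acov[a /= as_ ax]]; first by rewrite inE.
  by exists a.
pose sigma t x := \sum_(a <- s) bump (outer_c (eps a)) (2 * L a) (X a) t x.
pose sigmat t x := \sum_(a <- s) bump_dt u (outer_c (eps a)) (2 * L a) (X a) t x.
pose sigmax i t x := \sum_(a <- s) bump_dx (outer_c (eps a)) (2 * L a) (X a) i t x.
pose ic a := inner_c T1 (eps a) (L a).
pose tau t x := \sum_(a <- s) bump (ic a) (- (2 * L a)) (X a) t x.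
pose taut t x := \sum_(a <- s) bump_dt u (ic a) (- (2 * L a)) (X a) t x.
pose taux i t x := \sum_(a <- s) bump_dx (ic a) (- (2 * L a)) (X a) i t x.
have wsigma : weight sigma sigmat sigmax.
  by apply: weight_sum => a; apply: (weight_bump F); exact: (td_path (TD a)).
have wtau : weight tau taut taux.
  by apply: weight_sum => a; apply: (weight_bump F); exact: (td_path (TD a)).
pose q (r : R) := sqpos (1 - r); pose q' (r : R) := - (2 * Num.max (1 - r) 0).
have dq (r : R) : is_derive r 1 q (q' r).
  have hs : is_derive r 1 (fun r => 1 - r) (- 1 : R).
    by have := is_deriveB (is_derive_cst (1 : R) r (1 : R)) (is_derive_id r (1 : R)); rewrite sub0r.
  have := @is_derive1_comp R (@sqpos R) (fun r => 1 - r) r _ _ (is_derive_sqpos _) hs.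
  by move/is_derive_eq; apply; rewrite /q' mulrN1.
have cq' : continuous q'.
  move=> r; apply: (@continuousN_at R R (fun r => 2 * Num.max (1 - r) 0)).
  apply: continuousM_at; first exact: cvg_cst.
  apply: (cvg_comp (fun r => 1 - r) (fun r => Num.max r 0)); last exact: continuous_max0.
  by apply: cvgB; [exact: cvg_cst|exact: cvg_id].
pose q1 (r : R) := 1 - q r; pose q1' (r : R) := - q' r.
have dq1 (r : R) : is_derive r 1 q1 (q1' r).
  by have := is_deriveB (is_derive_cst (1 : R) r (1 : R)) (dq r); rewrite sub0r.
have cq1' : continuous q1' by move=> r; apply: (@continuousN_at R R q'); exact: cq'.
have weta := weightM wsigma (weight_comp dq cq' wtau).
have wchi := weight_comp dq1 cq1' wsigma.
pose K := \bigcup_(a in [set` s]) tube_set T1 (X a) (eps a).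
have far (t : R) (x : E) a : 0 <= t < T1 -> ~ K x -> a \in s -> 2 <= out a t x.
  move=> /andP[t0 tT] nK as_; rewrite leNgt; apply/negP => h; apply: nK.
  exists a => //; exists t; first by rewrite t0 ltW.
  exact: (outer_near (TD a) t0 h).
have sigma_out (t : R) x : 0 <= t < T1 -> ~ K x -> sigma t x = 0.
  move=> tT nK; rewrite /sigma big_seq big1// => a as_.
  by apply: plateau_eq0; exact: far.
have sigmat_out (t : R) x : 0 <= t < T1 -> ~ K x -> sigmat t x = 0.
  move=> tT nK; rewrite /sigmat big_seq big1// => a as_.
  by rewrite /bump_dt plateau'_eq0 ?mul0r//; apply: plateau_eq0; exact: far.
have sigmax_out i (t : R) x : 0 <= t < T1 -> ~ K x -> sigmax i t x = 0.
  move=> tT nK; rewrite /sigmax big_seq big1// => a as_.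
  by rewrite /bump_dx plateau'_eq0 ?mul0r//; apply: plateau_eq0; exact: far.
have sigma_ge0 t x : 0 <= sigma t x by apply: sumr_ge0 => a _; exact: plateau_ge0.
have sigma0 t x : sigma t x = 0 -> sigmat t x = 0 /\ forall i, sigmax i t x = 0.
  move/eqP; rewrite psumr_eq0 => [/allP s0|a _]; last exact: plateau_ge0.
  have p0 a : a \in s -> plateau' (out a t x) = 0.
    by move=> /s0 /= /eqP; exact: plateau'_eq0.
  split=> [|i]; rewrite /sigmat /sigmax big_seq big1// => a as_.
    by rewrite /bump_dt p0// mul0r.
  by rewrite /bump_dx p0// mul0r.
have sigma_ge1 t x a : a \in s -> out a t x <= 1 -> 1 <= sigma t x.
  move=> as_ ha; rewrite /sigma (big_rem a)//= {1}/bump plateau_eq1// lerDl.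
  by apply: sumr_ge0 => b _; exact: plateau_ge0.
have q1_0 (r : R) : r = 0 -> q1 r = 0.
  by move=> ->; rewrite /q1 /q subr0 /sqpos max_l// expr1n subrr.
have material_sum wt wx (c k : E -> R) t x :
  wt = (fun t x => \sum_(a <- s) bump_dt u (c a) (k a) (X a) t x) ->
  wx = (fun i t x => \sum_(a <- s) bump_dx (c a) (k a) (X a) i t x) ->
  material u wt wx t x = \sum_(a <- s)
    material u (bump_dt u (c a) (k a) (X a)) (bump_dx (c a) (k a) (X a)) t x.
  move=> -> ->; rewrite /material big_split /=; congr (_ + _).
  by rewrite exchange_big /=; apply: eq_bigr => i _; rewrite mulr_sumr.
exists K, (fun t x => sigma t x * q (tau t x)),
  (fun t x => sigma t x * (q' (tau t x) * taut t x) + q (tau t x) * sigmat t x),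
  (fun i t x => sigma t x * (q' (tau t x) * taux i t x) + q (tau t x) * sigmax i t x),
  (fun t x => q1 (sigma t x)), (fun t x => q1' (sigma t x) * sigmat t x),
  (fun i t x => q1' (sigma t x) * sigmax i t x).
split => //.
- apply: closed_bigcup; first exact: finite_seq.
  by move=> a _; apply: tube_set_closed; exact: TD.
- by move=> x [a _]; exact: (tube_set_sub (TD a)).
- by move=> t x tT nK; rewrite sigma_out// mul0r.
- by move=> t x tT nK; rewrite sigma_out// sigmat_out// mul0r mulr0 addr0.
- by move=> i t x tT nK; rewrite sigma_out// sigmax_out// mul0r mulr0 addr0.
- by move=> t x tT nK; rewrite sigma_out// q1_0.
- by move=> t x tT nK; rewrite sigmat_out// mulr0.
- by move=> i t x tT nK; rewrite sigmax_out// mulr0.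
- by move=> t x; rewrite mulr_ge0// sqpos_ge0.
- by move=> t x; rewrite subr_ge0; apply: sqpos_le1; rewrite lerBlDr lerDl.
- by move=> t x; rewrite lerBlDr lerDl sqpos_ge0.
- move=> t x tT; rewrite /material.
  have -> : sigma t x * (q' (tau t x) * taut t x) + q (tau t x) * sigmat t x +
    \sum_i u t x 0 i * (sigma t x * (q' (tau t x) * taux i t x) + q (tau t x) * sigmax i t x)
    = sigma t x * q' (tau t x) * material u taut taux t x
      + q (tau t x) * material u sigmat sigmax t x.
    have -> : \sum_i u t x 0 i * (sigma t x * (q' (tau t x) * taux i t x)
          + q (tau t x) * sigmax i t x) =
        sigma t x * q' (tau t x) * (\sum_i u t x 0 i * taux i t x)
        + q (tau t x) * \sum_i u t x 0 i * sigmax i t x.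
      by rewrite !mulr_sumr -big_split; apply: eq_bigr => i _ /=; ring.
    by rewrite /material; ring.
  have m1 : 0 <= material u taut taux t x.
    rewrite (material_sum taut taux ic (fun a => - (2 * L a)))// sumr_ge0// => a _.
    exact: (inner_material_ge0 (TD a)).
  have m2 : material u sigmat sigmax t x <= 0.
    rewrite (material_sum sigmat sigmax (fun a => outer_c (eps a)) (fun a => 2 * L a))//.
    by apply: sumr_le0 => a _; exact: (outer_material_le0 (TD a)).
  have q'0 : q' (tau t x) <= 0.
    by rewrite oppr_le0 mulr_ge0// le_max lexx orbT.
  have h1 : sigma t x * q' (tau t x) * material u taut taux t x <= 0.
    by rewrite mulr_le0_ge0// mulr_ge0_le0.
  have h2 : q (tau t x) * material u sigmat sigmax t x <= 0.
    by rewrite mulr_ge0_le0// sqpos_ge0.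
  by lra.
- move=> x; rewrite mulf_eq0 negb_or => /andP[s0 q0]; split.
    have [a as_ ha] : exists2 a, a \in s & bump (outer_c (eps a)) (2 * L a) (X a) 0 x != 0.
      apply: contrapT => nex; move/eqP: s0; apply.
      rewrite /sigma big_seq big1// => a as_; apply/eqP/negPn/negP => h.
      by apply: nex; exists a.
    have [_ /(_ (sA a as_))[X0 XU]] := DP a.
    apply: XU; rewrite -[X in _ - X]X0; apply: (outer_near (TD a) (lexx 0)).
    by rewrite ltNge; apply: contra ha => /plateau_eq0/eqP.
  move=> /scov[a as_ ha]; move/eqP: q0; apply.
  apply: sqpos_le0; rewrite subr_le0 /tau (big_rem a)//= {1}/bump.
  rewrite plateau_eq1; last exact: ltW.
  by rewrite lerDl; apply: sumr_ge0 => b _; exact: plateau_ge0.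
- move=> t x tT /eqP; rewrite mulf_eq0 => /orP[/eqP s0|q0].
    have [st sx] := sigma0 t x s0.
    by split=> [|i]; rewrite ?st ?sx mulr0.
  have t1 : 1 <= tau t x.
    rewrite leNgt; apply/negP => t1; move: q0; rewrite /q /sqpos max_l; last first.
      by rewrite subr_ge0 ltW.
    by rewrite sqrf_eq0 subr_eq0 => /eqP t1'; rewrite -t1' ltxx in t1.
  have [a as_ ha] : exists2 a, a \in s & bump (ic a) (- (2 * L a)) (X a) t x != 0.
    apply: contrapT => nex; move: t1; rewrite /tau big_seq big1 ?ler10// => a as_.
    by apply/eqP/negPn/negP => h; apply: nex; exists a.
  have s1 : 1 <= sigma t x.
    apply: (sigma_ge1 t x a as_); apply: (inner_near_outer1 (TD a) tT).
    by rewrite ltNge; apply: contra ha => /plateau_eq0/eqP.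
  have q10 : q1' (sigma t x) = 0.
    by rewrite /q1' /q' max_r ?mulr0 ?oppr0// subr_le0.
  by split=> [|i]; rewrite q10 mul0r.
- move=> x /scov[a as_ ha].
  have s1 : 1 <= sigma 0 x.
    apply: (sigma_ge1 0 x a as_); apply: (inner_near_outer1 (TD a)).
      by rewrite lexx.
    by apply: lt_le_trans ha _; rewrite ler1n.
  by rewrite /q1 /q sqpos_le0 ?subr0// subr_le0.
- move=> x nU; apply: q1_0; rewrite /sigma big_seq big1// => a as_.
  apply: plateau_eq0; rewrite leNgt; apply/negP => h; apply: nU.
  have [_ /(_ (sA a as_))[X0 XU]] := DP a.
  by apply: XU; rewrite -[X in _ - X]X0; exact: (outer_near (TD a) (lexx 0) h).
Qed.

End cutoffs.

(** * The virial argument *)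

Section time_monotone.
Context {R : realType}.

Lemma time_monotone (T1 : R) (G g : R -> R) :
  (forall t : R, 0 <= t < T1 -> G r @[r --> time_nbhs t] --> G t) ->
  (forall t : R, 0 < t < T1 -> is_derive t 1 G (g t)) ->
  (forall t : R, 0 < t < T1 -> 0 <= g t) ->
  forall t : R, 0 <= t < T1 -> G 0 <= G t.
Proof.
move=> Gc dG g0 t /andP[]; rewrite le_eqVlt => /orP[/eqP <- _ //|t0 tT].
have Gt (r : R) : 0 < r < T1 -> {for r, continuous G}.
  by move=> rT; apply/differentiable_continuous/derivable1_diffP; have [] := dG r rT.
have dG' (r : R) : r \in `]0, t[ -> derivable G r 1 /\ 0 <= derive1 G r.
  rewrite in_itv /= => /andP[r0 rt].
  have rT : 0 < r < T1 by rewrite r0 (lt_trans rt).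
  have dGr := dG r rT; split; first by case: dGr.
  by rewrite derive1E (@derive_val _ _ _ _ _ _ _ dGr) g0.
apply: (@ger0_derive1_le_cc R G 0 t) => //; rewrite ?in_itv /= ?lexx ?(ltW t0)//.
- by move=> r /dG'[].
- by move=> r /dG'[].
apply/continuous_within_itvP => //; split.
+ move=> r; rewrite in_itv /= => /andP[r0 rt]; apply: Gt.
  by rewrite r0 (lt_trans rt).
+ have h0 : 0 <= (0 : R) < T1 by rewrite lexx (lt_trans t0).
  move=> A /(Gc 0 h0) HA.
  apply: (@filterS R (nbhs (0 : R)) (nbhs_filter _) [set r | 0 <= r -> A (G r)] _ _ HA).
  by move=> r AGr r0; exact: AGr (ltW r0).
+ by apply: cvg_at_left_filter; apply: Gt; rewrite t0.
Qed.
End time_monotone.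

Section isolated_mass.
Context {R : realType} {d : nat}.
Local Notation E := 'rV[R]_d.
Variables (Omega : set E) (rho rhot : R -> E -> R) (u ut : R -> E -> E).
Hypothesis F : regular_flow Omega rho rhot u ut.
Variables (c : E) (s : R).
Hypothesis s0 : 0 < s.
Hypothesis inner : forall x j, Omega x -> c 0 j < x 0 j < c 0 j + s.
Local Notation mean := (mean c s).

Lemma jcont_bounded_compact (f : R -> E -> R) (K : set E) (T1 : R) :
  compact K -> (forall (t : R) (x : E), 0 <= t -> K x -> jcont f t x) ->
  exists2 B, 0 <= B & forall (t : R) (x : E), 0 <= t <= T1 -> K x -> `|f t x| <= B.
Proof.
move=> cK fc; pose P (n : nat) (t : R) := 0 <= t -> forall x, K x -> `|f t x| <= n%:R.
suff [N _ NP] : \forall n \near \oo, `[0, T1]%classic `<=` P n.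
  exists N%:R => // t x tT Kx; have /andP[t0 _] := tT.
  by apply: (NP N (leqnn N) t _ t0) => //=; rewrite in_itv.
have := @segment_compact R 0 T1 => /compact_near_coveringP.
move=> /(_ nat \oo P); apply => t; rewrite /= in_itv /= => /andP[t0 tT].
have [M KM] : exists M, forall x, K x -> `|f t x| <= M.
  have : compact (f t @` K).
    apply: continuous_compact cK; apply: continuous_in_subspaceT => x; rewrite inE => Kx.
    exact: (jcont_slice t0 (fc t x t0 Kx)).
  move=> /compact_bounded[M [_ fM]]; exists (M + 1) => x Kx.
  by apply: (fM (M + 1)); [rewrite ltrDl|exists x].
have near_t := jcont_uniform t0 cK (fun x Kx => fc t x t0 Kx) ltr01.
have near_n : \forall n \near \oo, M + 1 <= n%:R by exact: nbhs_infty_ger.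
exists ([set r | 0 <= r -> forall x, K x -> `|f r x - f t x| <= 1],
  [set n | M + 1 <= n%:R]) => //.
move=> [r n] /= [rK Mn] r0 x Kx; apply: le_trans Mn.
rewrite -[f r x](subrK (f t x)) addrC; apply: le_trans (ler_normD _ _) _.
by apply: lerD; [exact: KM|exact: rK].
Qed.

Lemma supported_bounded (K : set E) (w f : E -> R) :
  closed K -> K `<=` Omega -> (forall x, ~ K x -> w x = 0) ->
  (forall x, Omega x -> {for x, continuous w}) ->
  (forall x, Omega x -> {for x, continuous f}) ->
  bounded_on_cube c s (fun x => w x * f x).
Proof.
move=> Kc KO w0 wc fc; apply: continuous_bounded_on_cube.
apply: (supported_continuous Kc KO) => [x nK|x Ox]; first by rewrite w0// mul0r.
by apply: continuousM_at; [exact: wc|exact: fc].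
Qed.

Variables (A U V : set E).
Hypotheses (oO : open Omega) (cA : compact A) (oU : open U) (AU : A `<=` U).
Hypotheses (VA : V `<=` A) (UO : U `<=` Omega).
Hypothesis paths : forall a, A a -> exists2 X, X 0 = a & path_of Omega u X.
Hypothesis vacuum : forall x, U x -> ~ V x -> rho 0 x = 0.
Variable x0 : E.
Hypotheses (Vx0 : V x0) (rho_x0 : 0 < rho 0 x0).

(** The initial values of the group do not involve the cutoffs, hence not the
    length of the time interval for which these are built. *)
Definition group_density (x : E) : R := if `[< V x >] then rho 0 x else 0.

(** The momentum equation, for an unspecified flux [S] whose trace obeys a
    viscous law [p]. *)
Record stress_tensor (p : R -> R) (gamma : R) (S : R -> 'I_d -> 'I_d -> E -> R) :
    Prop := StressTensor {
  stress_diff : forall (t : R) k j (x : E), 0 < t -> Omega x ->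
    differentiable (S t k j) x ;
  stress_div : forall (t : R) k (x : E), 0 < t -> Omega x ->
    \sum_j 'D_(basis j) (S t k j) x = rhot t x * u t x 0 k + rho t x * ut t x 0 k ;
  stress_vacuum : forall (t : R) k j (x : E), 0 < t -> Omega x ->
    rho t x = 0 -> S t k j x = 0 ;
  stress_trace : forall (t : R) (x : E), 0 < t -> Omega x ->
    \sum_k S t k k x = p (rho t x) * divergence (u t) x
      - rho t x * sqnorm (u t x) - d%:R * rho t x `^ gamma }.

Section with_cutoffs.
Variables (T1 : R) (K : set E) (eta etat : R -> E -> R) (etax : 'I_d -> R -> E -> R)
  (chi chit : R -> E -> R) (chix : 'I_d -> R -> E -> R).
Hypothesis T10 : 0 < T1.
Hypothesis C : cutoff_pair Omega u T1 A U K eta etat etax chi chit chix.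

Let Kc := cut_closed C.
Let KO := cut_sub C.

(** [eta rho] is nonnegative, and its mean starts at zero and does not increase. *)
Lemma eta_rho_eq0 (t : R) (x : E) : 0 <= t < T1 -> Omega x -> eta t x * rho t x = 0.
Proof.
move=> tT Ox; have /andP[t0 _] := tT.
pose G (r : R) := mean (fun x => eta r x * rho r x).
have etarho_c : jcont_on T1 (fun r x => eta r x * rho r x).
  apply: (supported_jcont Kc KO) => [r y rT nK|r y /andP[r0 _] Oy].
    by rewrite (cut_eta_supp C)// mul0r.
  by apply: jcontM; [exact: (weight_jcont (cut_eta C))|exact: (flow_rho F)].
have Gc (r : R) : 0 <= r < T1 -> G q @[q --> time_nbhs r] --> G r.
  by move=> rT; apply: (mean_time_continuous s0 etarho_c).
pose g (r : R) := mean (fun x => material u etat etax r x * rho r x).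
have dG (r : R) : 0 < r < T1 -> is_derive r 1 G (g r).
  move=> rT; exact: (transport_mass Kc KO s0 inner F (cut_eta C) (cut_eta_supp C)
    (cut_etat_supp C) (cut_etax_supp C) rT).
have g0 (r : R) : 0 < r < T1 -> g r <= 0.
  move=> rT; have /andP[r0 rT1] := rT.
  have r0' := ltW r0; have rT' : 0 <= r < T1 by rewrite r0'.
  have out y : ~ K y -> material u etat etax r y = 0.
    move=> nK; rewrite /material (cut_etat_supp C)// add0r big1// => i _.
    by rewrite (cut_etax_supp C)// mulr0.
  rewrite -(mean_cst c s 0); apply: (ler_mean s0).
  - apply: (supported_bounded Kc KO out) => y Oy; last first.
      by apply: (jcont_slice (ltW r0)); exact: (flow_rho F).
    apply: (@jcont_slice R d (material u etat etax) r y (ltW r0)).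
    apply: jcontD; first exact: (weight_jcontt (cut_eta C)).
    apply: jcont_sum => i; apply: jcontM; first exact: (flow_u F).
    exact: (weight_jcontx (cut_eta C)).
  - by exists 0 => y _; rewrite normr0.
  move=> y _; have [Oy|nOy] := pselect (Omega y).
    by rewrite mulr_le0_ge0 ?(flow_ge0 F) ?(ltW r0)// (cut_eta_decr C)// (ltW r0) ltW.
  by rewrite out ?mul0r// => /KO.
have G0 : G 0 = 0.
  rewrite -[RHS](mean_cst c s); apply: (eq_mean s0) => y _.
  have [->|e0] := eqVneq (eta 0 y) 0; first by rewrite mul0r.
  have [Uy nAy] := cut_eta_init C e0.
  by rewrite vacuum ?mulr0// => /VA.
have Gt : G t <= 0.
  have := @time_monotone R T1 (fun r => - G r) (fun r => - g r).
  move=> /(_ _ _ _ t tT); rewrite G0 oppr0 oppr_ge0; apply.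
  - by move=> r rT; apply: cvgN; exact: Gc.
  - by move=> r rT; apply: is_deriveN; exact: dG.
  - by move=> r rT; rewrite oppr_ge0; exact: g0.
have bG : bounded_on_cube c s (fun x => eta t x * rho t x).
  exact: (jcont_on_bounded _ _ etarho_c tT).
have er0 y : 0 <= eta t y * rho t y.
  have [Oy|nOy] := pselect (Omega y).
    by rewrite mulr_ge0 ?(cut_eta_ge0 C)// (flow_ge0 F).
  by rewrite (cut_eta_supp C) ?mul0r// => /KO.
apply/eqP/negPn/negP => erN0.
have erx : 0 < eta t x * rho t x by rewrite lt0r erN0 er0.
have e2 : 0 < (eta t x * rho t x) / 2 by rewrite divr_gt0.
have /cvgrPdist_lt/(_ _ e2)/nbhs_ballP[r /= r0 near_x] := jcont_slice t0 (etarho_c t x tT).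
have : 0 < G t.
  apply: (mean_gt0 s0 (x := x) bG _ _ r0 e2).
  - by move=> j; have /andP[h1 h2] := inner j Ox; rewrite !ltW.
  - by move=> y _; exact: er0.
  move=> y xy; have := near_x y; rewrite -ball_normE /= distrC => /(_ xy).
  by rewrite ltr_norml => /andP[]; lra.
by rewrite ltNge Gt.
Qed.

Lemma chi_locally_constant (t : R) (x : E) : 0 <= t < T1 -> Omega x -> rho t x != 0 ->
  chit t x = 0 /\ forall i, chix i t x = 0.
Proof.
move=> tT Ox rN0; apply: (cut_locally_cst C).
  by have /andP[-> /ltW] := tT.
by have /eqP := eta_rho_eq0 tT Ox; rewrite mulf_eq0 (negbTE rN0) orbF => /eqP.
Qed.

Lemma chi_material_out (t : R) (x : E) : 0 <= t < T1 -> ~ K x ->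
  material u chit chix t x = 0.
Proof.
move=> tT nK; rewrite /material (cut_chit_supp C)// add0r big1// => i _.
by rewrite (cut_chix_supp C)// mulr0.
Qed.

(** The cutoff travels with the group: at each point either the density vanishes
    or the derivatives of [chi] do. *)
Lemma chi_material (h : R -> R) (t : R) (x : E) : h 0 = 0 -> 0 <= t < T1 ->
  material u chit chix t x * h (rho t x) = 0.
Proof.
move=> h0 tT; have [Ox|nOx] := pselect (Omega x); last first.
  by rewrite chi_material_out ?mul0r// => /KO.
have [->|rN0] := eqVneq (rho t x) 0; first by rewrite h0 mulr0.
have [ct cx] := chi_locally_constant tT Ox rN0.
by rewrite /material ct add0r big1 ?mul0r// => i _; rewrite cx mulr0.
Qed.

Lemma chi_rho_jcont (f : R -> E -> R) :
  (forall (t : R) (x : E), 0 <= t -> Omega x -> jcont f t x) ->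
  jcont_on T1 (fun r x => chi r x * f r x).
Proof.
move=> fc; apply: (supported_jcont Kc KO) => [r y rT nK|r y /andP[r0 _] Oy].
  by rewrite (cut_chi_supp C)// mul0r.
by apply: jcontM; [exact: (weight_jcont (cut_chi C))|exact: fc].
Qed.

Lemma chi_rho_init (x : E) : chi 0 x * rho 0 x = group_density x.
Proof.
rewrite /group_density; case: asboolP => Vx.
  by rewrite (cut_chi_in C) ?mul1r//; exact: VA.
have [Ux|nUx] := pselect (U x); first by rewrite vacuum// mulr0.
by rewrite (cut_chi_out C)// mul0r.
Qed.

Let T1in0 : 0 <= (0 : R) < T1. Proof. by rewrite lexx. Qed.

Definition group_mass := mean group_density.

Lemma group_massE : group_mass = mean (fun x => chi 0 x * rho 0 x).
Proof. by apply: (eq_mean s0) => x _; rewrite chi_rho_init. Qed.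

Lemma group_mass_gt0 : 0 < group_mass.
Proof.
have rc := chi_rho_jcont (fun t x => @flow_rho _ _ _ _ _ _ _ F t x).
have bG := jcont_on_bounded c s rc T1in0.
have Ox0 : Omega x0 by apply/UO/AU/VA.
rewrite group_massE.
have e2 : 0 < rho 0 x0 / 2 by rewrite divr_gt0.
have /cvgrPdist_lt/(_ _ e2)/nbhs_ballP[r /= r0 near_x] :=
  jcont_slice (lexx 0) (rc 0 x0 T1in0).
have chi1 : chi 0 x0 = 1 by apply/(cut_chi_in C)/VA.
apply: (mean_gt0 s0 (x := x0) bG _ _ r0 e2).
- by move=> j; have /andP[h1 h2] := inner j Ox0; rewrite !ltW.
- move=> y _; rewrite chi_rho_init /group_density; case: asboolP => // Vy.
  by apply: (flow_ge0 F) => //; apply/UO/AU/VA.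
move=> y xy; have := near_x y; rewrite -ball_normE /= distrC => /(_ xy).
by rewrite chi1 mul1r ltr_norml => /andP[]; lra.
Qed.

Lemma mass_conserved (t : R) : 0 <= t < T1 ->
  mean (fun x => chi t x * rho t x) = group_mass.
Proof.
move=> tT; rewrite group_massE.
pose G (r : R) := mean (fun x => chi r x * rho r x).
have rc := chi_rho_jcont (fun t x => @flow_rho _ _ _ _ _ _ _ F t x).
have Gc (r : R) : 0 <= r < T1 -> G q @[q --> time_nbhs r] --> G r.
  by move=> rT; apply: (mean_time_continuous s0 rc).
have dG (r : R) : 0 < r < T1 -> is_derive r 1 G 0.
  move=> rT; have /andP[r0 rT1] := rT.
  have := transport_mass Kc KO s0 inner F (cut_chi C) (cut_chi_supp C)
    (cut_chit_supp C) (cut_chix_supp C) rT.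
  move/is_derive_eq; apply; rewrite -[RHS](mean_cst c s); apply: (eq_mean s0) => x _.
  by apply: (@chi_material id) => //; rewrite ltW.
apply/eqP; rewrite eq_le; apply/andP; split.
  rewrite -lerN2; apply: (@time_monotone R T1 (fun r => - G r) (fun=> - 0) _ _ _ t tT).
  - by move=> r rT; apply: cvgN; exact: Gc.
  - by move=> r rT; apply: is_deriveN; exact: dG.
  - by move=> r _; rewrite oppr0.
by apply: (@time_monotone R T1 G (fun=> 0) Gc dG _ t tT).
Qed.

Lemma second_moment_derive (t : R) : 0 < t < T1 ->
  is_derive t 1 (fun r => mean (fun x => chi r x * (rho r x * sqnorm x)))
    (2 * mean (fun x => chi t x * \sum_k rho t x * u t x 0 k * x 0 k)).
Proof.
move=> tT; have /andP[t0 tT1] := tT; have t0' := ltW t0.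
have tT' : 0 <= t < T1 by rewrite t0'.
have c0 (k : R) (i : 'I_d) (r : R) : (k : R) @[_ --> time_nbhs r] --> k.
  exact: cvg_cst.
have wsq := @weight_tube R d 1 0 (fun=> 0) (fun=> 0).
have {}wsq : weight (tube 1 0 (fun=> 0 : E)) (tube_dt 1 0 (fun=> 0 : E) (fun=> 0 : E))
    (tube_dx 1 0 (fun=> 0 : E)).
  apply: wsq => r i _; [exact: cvg_cst|exact: cvg_cst|].
  by rewrite mxE; exact: is_derive_cst.
have tubeE (r : R) (x : E) : tube 1 0 (fun=> 0 : E) r x = sqnorm x.
  by rewrite /tube mul0r expR0 mul1r mul1r subr0.
have ww := weightM (cut_chi C) wsq.
have dF := transport_mass Kc KO s0 inner F ww _ _ _ tT.
have {dF} := dF _ _ _.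
have -> : (fun r => mean (fun x => chi r x * tube 1 0 (fun=> 0 : E) r x * rho r x)) =
   (fun r => mean (fun x => chi r x * (rho r x * sqnorm x))).
  apply/funext => r; apply: (eq_mean s0) => x _.
  by rewrite tubeE; ring.
move=> /(_ _ _ _)/is_derive_eq; apply.
- by move=> r x rT nK; rewrite (cut_chi_supp C)// mul0r.
- by move=> r x rT nK; rewrite (cut_chi_supp C)// (cut_chit_supp C)// mul0r mulr0 addr0.
- by move=> i r x rT nK; rewrite (cut_chi_supp C)// (cut_chix_supp C)// mul0r mulr0 addr0.
rewrite -(meanZ s0); last first.
  apply: (jcont_on_bounded c s (T1 := T1) (f := fun r x => chi r x * \sum_k rho r x * u r x 0 k * x 0 k)) => //.
  apply: chi_rho_jcont => r x r0 Ox; apply: jcont_sum => k.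
  apply: jcontM; last first.
    by apply: (@jcont_pos R d (fun y : E => y 0 k)); exact: coord_continuous_at.
  by apply: jcontM; [exact: (flow_rho F)|exact: (flow_u F)].
apply: (eq_mean s0) => x _.
have chim := @chi_material id t x erefl tT'; rewrite /= in chim.
have -> : material u
   (fun t x => chi t x * tube_dt 1 0 (fun=> 0 : E) (fun=> 0 : E) t x + tube 1 0 (fun=> 0 : E) t x * chit t x)
   (fun i t x => chi t x * tube_dx 1 0 (fun=> 0 : E) i t x + tube 1 0 (fun=> 0 : E) t x * chix i t x) t x
   = sqnorm x * material u chit chix t x + 2 * chi t x * \sum_k u t x 0 k * x 0 k.
  rewrite /material tubeE.
  have -> : tube_dt 1 0 (fun=> 0 : E) (fun=> 0 : E) t x = 0.
    rewrite /tube_dt !mul0r sub0r big1 ?mulr0 ?oppr0 ?mulr0// => i _.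
    by rewrite [X in _ * X]mxE mulr0.
  have -> : \sum_i u t x 0 i * (chi t x * tube_dx 1 0 (fun=> 0 : E) i t x + sqnorm x * chix i t x)
     = 2 * chi t x * (\sum_k u t x 0 k * x 0 k) + sqnorm x * \sum_i u t x 0 i * chix i t x.
    rewrite !mulr_sumr -big_split; apply: eq_bigr => i _ /=.
    by rewrite /tube_dx mul0r expR0 subr0; ring.
  by ring.
have -> : \sum_k rho t x * u t x 0 k * x 0 k = rho t x * \sum_k u t x 0 k * x 0 k.
  by rewrite mulr_sumr; apply: eq_bigr => k _; rewrite mulrA.
by rewrite mulrDl -mulrA chim mulr0 add0r; ring.
Qed.

Definition group_virial :=
  mean (fun x => \sum_k group_density x * u 0 x 0 k * x 0 k).

(** In the virial identity the viscous term is the derivative of the entropy,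
    up to [delta * B]; the pressure term is bounded below through the mass, by
    the tangent of [s ^ gamma] at [s = group_mass].  The latter contributes
    [group_mass ^ gamma], half of which pays for the error. *)
Lemma momentum_growth (p h h' : R -> R) (gamma : R) S (S0 Cl Cu Smax B delta : R) :
  (0 < d)%N -> 1 < gamma -> stress_tensor p gamma S ->
  h 0 = 0 ->
  (forall r : R, 0 <= r -> is_derive r 1 h (h' r)) ->
  (forall r : R, 0 <= r -> {for r, continuous h'}) ->
  (forall r : R, 0 <= r <= Smax -> `|r * h' r - h r - p r| <= delta) ->
  (forall r : R, 0 <= r -> - Cl * (1 + r) <= h r) ->
  (forall r : R, 0 <= r <= S0 -> h r <= Cu) ->
  (forall x, A x -> rho 0 x <= S0) -> 0 <= Cl -> 0 <= Cu ->
  (forall (t : R) (x : E), 0 <= t <= T1 -> K x -> rho t x <= Smax) ->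
  (forall (t : R) (x : E), 0 <= t <= T1 -> K x -> `|divergence (u t) x| <= B) ->
  delta * B <= group_mass `^ gamma / 2 ->
  forall t : R, 0 <= t < T1 ->
  group_virial - Cu - Cl * (1 + group_mass) + group_mass `^ gamma / 2 * t
    <= mean (fun x => chi t x * \sum_k rho t x * u t x 0 k * x 0 k).
Proof.
move=> d0 ga1 ST h0 dh ch' hp hlow hup rhoS0 Cl0 Cu0 rhoB divB dB.
set M := group_mass; set c1 := M `^ gamma / 2.
have M0 : 0 < M := group_mass_gt0.
have Mg : 0 < M `^ gamma by exact: powR_gt0.
have hc (r : R) : 0 <= r -> {for r, continuous h}.
  by move=> r0; apply/differentiable_continuous/derivable1_diffP; have [] := dh r r0.
have xc (k : 'I_d) (r : R) (x : E) : jcont (fun _ y => y 0 k) r x.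
  by apply: (@jcont_pos R d (fun y : E => y 0 k)); exact: coord_continuous_at.
pose m (r : R) (x : E) := \sum_k rho r x * u r x 0 k * x 0 k.
have mc (r : R) (x : E) : 0 <= r -> Omega x -> jcont m r x.
  move=> r0 Ox; apply: jcont_sum => k; apply: jcontM; last exact: xc.
  by apply: jcontM; [exact: (flow_rho F)|exact: (flow_u F)].
have hrc (r : R) (x : E) : 0 <= r -> Omega x -> jcont (fun r x => h (rho r x)) r x.
  move=> r0 Ox; apply: jcont_comp; first exact: (flow_rho F).
  by apply: hc; exact: (flow_ge0 F).
have h'rc (r : R) (x : E) : 0 <= r -> Omega x -> jcont (fun r x => h' (rho r x)) r x.
  move=> r0 Ox; apply: jcont_comp; first exact: (flow_rho F).
  by apply: ch'; exact: (flow_ge0 F).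
have chim_c := chi_rho_jcont mc.
have chih_c := chi_rho_jcont hrc.
pose G (r : R) := mean (fun x => chi r x * m r x).
pose H (r : R) := mean (fun x => chi r x * h (rho r x)).
pose g (r : R) := mean (fun x => - (chi r x * \sum_k S r k k x)).
pose f2 (r : R) (x : E) := material u chit chix r x * h (rho r x)
  - chi r x * ((rho r x * h' (rho r x) - h (rho r x)) * divergence (u r) x).
have dG (r : R) : 0 < r < T1 -> is_derive r 1 G (g r).
  move=> rT; have /andP[r0 rT1] := rT.
  have rT' : 0 <= r < T1 by rewrite ltW.
  apply: (virial Kc KO s0 inner F (cut_chi C) (cut_chi_supp C) (cut_chit_supp C)
    (cut_chix_supp C) rT).
  - by move=> k j x Ox; exact: (stress_diff ST).
  - by move=> k x Ox; exact: (stress_div ST).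
  - move=> x k j Ox; have [rho0|rhoN0] := eqVneq (rho r x) 0.
      by rewrite (stress_vacuum ST)// mulr0.
    by have [_ ->] := chi_locally_constant rT' Ox rhoN0; rewrite mul0r.
  move=> x Ox; have [->|rhoN0] := eqVneq (rho r x) 0; first by rewrite mulr0.
  by have [-> _] := chi_locally_constant rT' Ox rhoN0; rewrite mul0r.
have dH (r : R) : 0 < r < T1 -> is_derive r 1 H (mean (f2 r)).
  move=> rT; exact: (transport Kc KO s0 inner F (cut_chi C) (cut_chi_supp C)
    (cut_chit_supp C) (cut_chix_supp C) dh ch' rT).
have growth (r : R) : 0 < r < T1 -> c1 <= g r - mean (f2 r).
  move=> rT; have /andP[r0 rT1] := rT; have r0' := ltW r0.
  have rT' : 0 <= r < T1 by rewrite r0'.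
  have rT'' : 0 <= r <= T1 by rewrite r0' ltW.
  have chi_out x : ~ K x -> chi r x = 0 by exact: (cut_chi_supp C).
  have chi_c (x : E) : Omega x -> {for x, continuous (chi r)}.
    by move=> Ox; apply: (jcont_slice r0'); exact: (weight_jcont (cut_chi C)).
  have rho_c (x : E) : Omega x -> {for x, continuous (rho r)}.
    by move=> Ox; apply: (jcont_slice r0'); exact: (flow_rho F).
  have bf1 : bounded_on_cube c s (fun x => - (chi r x * \sum_k S r k k x)).
    have [k kb] : bounded_on_cube c s (fun x => chi r x * \sum_k S r k k x).
      apply: (supported_bounded Kc KO chi_out chi_c) => x Ox.
      apply: continuous_bigsum => k; apply: differentiable_continuous.
      exact: (stress_diff ST).
    by exists k => x /kb; rewrite normrN.
  have f2E : f2 r = (fun x =>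
     chi r x * - ((rho r x * h' (rho r x) - h (rho r x)) * divergence (u r) x)).
    by apply/funext => x; rewrite /f2 chi_material// sub0r mulrN.
  have bf2 : bounded_on_cube c s (f2 r).
    rewrite f2E; apply: (supported_bounded Kc KO chi_out chi_c) => x Ox.
    apply: continuousN_at; apply: continuousM_at; last exact: (flow_divergence_cont F).
    apply: continuousD_at; last first.
      by apply: continuousN_at; apply: (@jcont_slice R d (fun r x => h (rho r x)) r x r0'); exact: hrc.
    apply: continuousM_at; first exact: rho_c.
    by apply: (@jcont_slice R d (fun r x => h' (rho r x)) r x r0'); exact: h'rc.
  have bchi : bounded_on_cube c s (chi r).
    by exists 1 => x _; rewrite ger0_norm ?(cut_chi_ge0 C)// (cut_chi_le1 C).
  have bchirho : bounded_on_cube c s (fun x => chi r x * rho r x).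
    exact: (supported_bounded Kc KO chi_out chi_c).
  pose a1 := gamma * M `^ (gamma - 1); pose a2 := - ((gamma - 1) * M `^ gamma + c1).
  have a2le : a2 <= 0.
    by rewrite oppr_le0 addr_ge0// ?divr_ge0 ?ltW// mulr_gt0 ?subr_gt0.
  apply: (@le_trans _ _ (mean (fun x => a1 * (chi r x * rho r x) + a2 * chi r x))).
    rewrite (meanD s0); [|exact: bounded_onZ|exact: bounded_onZ].
    rewrite !(meanZ s0)// mass_conserved// -/M.
    have -> : a1 * M = gamma * M `^ gamma.
      by rewrite /a1 -mulrA (mulrC _ M) mulr_powRB1// ?ltW// (lt_trans ltr01).
    have chi1 : mean (chi r) <= 1.
      rewrite -[leRHS](mean_cst c s); apply: (ler_mean s0) => //.
        by exists 1 => x _; rewrite normr1.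
      by move=> x _; exact: (cut_chi_le1 C).
    have : a2 <= a2 * mean (chi r) by rewrite ler_niMr.
    by rewrite /a2 /c1; lra.
  rewrite /g -(meanB s0)//; apply: (ler_mean s0) => [||x _].
  - have [k1 b1] := bounded_onZ a1 bchirho; have [k2 b2] := bounded_onZ a2 bchi.
    exists (k1 + k2) => x cx; apply: le_trans (ler_normD _ _) _.
    by apply: lerD; [exact: b1|exact: b2].
  - exact: bounded_onB.
  rewrite f2E; have [Kx|nKx] := pselect (K x); last first.
    by rewrite chi_out// !mul0r !mulr0 !oppr0 !addr0.
  have Ox := KO Kx.
  rewrite (stress_trace ST)//.
  set r_ := rho r x; set D := divergence _ _; set z := chi r x.
  have r_0 : 0 <= r_ by exact: (flow_ge0 F).
  have z0 : 0 <= z by exact: (cut_chi_ge0 C).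
  have tangent := powR_tangent (ltW ga1) r_0 (ltW M0).
  have hpD : - c1 <= (r_ * h' r_ - h r_ - p r_) * D.
    have : `|(r_ * h' r_ - h r_ - p r_) * D| <= c1.
      apply: le_trans dB; rewrite normrM ler_pM//; last exact: divB.
      by apply: hp; rewrite r_0 rhoB.
    by rewrite ler_norml => /andP[].
  have dP : r_ `^ gamma <= d%:R * r_ `^ gamma.
    by rewrite ler_peMl ?powR_ge0// ler1n.
  have u2 : 0 <= r_ * sqnorm (u r x) by rewrite mulr_ge0// sqnorm_ge0.
  have -> : a1 * (z * r_) + a2 * z = z * (a1 * r_ + a2) by ring.
  have -> : - (z * (p r_ * D - r_ * sqnorm (u r x) - d%:R * r_ `^ gamma))
      - z * - ((r_ * h' r_ - h r_) * D) =
    z * (r_ * sqnorm (u r x) + d%:R * r_ `^ gamma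
      + (r_ * h' r_ - h r_ - p r_) * D) by ring.
  by rewrite ler_wpM2l// /a1 /a2; lra.
move=> t tT; have /andP[t0 tT1] := tT.
have GE : G 0 = group_virial.
  apply: (eq_mean s0) => x _; rewrite /m mulr_sumr; apply: eq_bigr => k _.
  by rewrite !mulrA chi_rho_init.
have bchih (r : R) : 0 <= r < T1 -> bounded_on_cube c s (fun x => chi r x * h (rho r x)).
  by move=> rT; exact: (jcont_on_bounded c s chih_c rT).
have H0 : H 0 <= Cu.
  rewrite -[leRHS](mean_cst c s); apply: (ler_mean s0).
  - exact: bchih.
  - by exists `|Cu|.
  move=> x _; have [Vx|nVx] := pselect (V x).
    rewrite (cut_chi_in C) ?mul1r; last exact: VA.
    apply: hup; rewrite rhoS0; last exact: VA.
    by rewrite andbT; apply: (flow_ge0 F) => //; apply/UO/AU/VA.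
  have := chi_rho_init x; rewrite /group_density asboolF// => /eqP.
  by rewrite mulf_eq0 => /orP[] /eqP ->; rewrite ?mul0r ?h0 ?mulr0.
have Ht : - (Cl * (1 + M)) <= H t.
  have bchi : bounded_on_cube c s (chi t).
    by exists 1 => x _; rewrite ger0_norm ?(cut_chi_ge0 C)// (cut_chi_le1 C).
  have rc := chi_rho_jcont (fun t x => @flow_rho _ _ _ _ _ _ _ F t x).
  have bchirho : bounded_on_cube c s (fun x => chi t x * rho t x).
    exact: (jcont_on_bounded c s rc tT).
  have bsum : bounded_on_cube c s (fun x => 1 + chi t x * rho t x).
    have [k kb] := bchirho; exists (1 + k) => x cx; apply: le_trans (ler_normD _ _) _.
    by rewrite normr1 lerD2l kb.
  have -> : - (Cl * (1 + M)) = mean (fun x => - Cl * (1 + chi t x * rho t x)).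
    rewrite (meanZ s0)// (meanD s0)//; last by exists 1 => x _; rewrite normr1.
    by rewrite mass_conserved// mean_cst mulNr.
  apply: (ler_mean s0); [exact: bounded_onZ|exact: bchih|move=> x _].
  have [Ox|nOx] := pselect (Omega x); last first.
    by rewrite (cut_chi_supp C) ?mul0r ?addr0 ?mulr1 ?oppr_le0// => /KO.
  have z0 := cut_chi_ge0 C t x; have z1 := cut_chi_le1 C t x.
  have := ler_wpM2l z0 (hlow _ (flow_ge0 F t0 Ox)).
  have : Cl * chi t x <= Cl by rewrite ler_piMr.
  by move=> h1 h2; lra.
have := @time_monotone R T1 (fun r => G r - H r - c1 * r)
  (fun r => g r - mean (f2 r) - c1).
move=> /(_ _ _ _ t tT); rewrite mulr0 subr0 => mono.
suff : G 0 - H 0 <= G t - H t - c1 * t by rewrite GE -/(G t) /c1; lra.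
apply: mono => [r rT|r rT|r rT].
- apply: cvgB; first apply: cvgB.
  + exact: (mean_time_continuous s0 chim_c).
  + exact: (mean_time_continuous s0 chih_c).
  apply: cvg_within_filter; apply: cvgM; [exact: cvg_cst|exact: cvg_id].
- apply: is_deriveB; first by apply: is_deriveB; [exact: dG|exact: dH].
  have := is_deriveZ c1 (is_derive_id r (1 : R)); move/is_derive_eq; apply.
  exact: mulr1.
- by rewrite subr_ge0; exact: growth.
Qed.

End with_cutoffs.
(** The second moment of the group is at most a constant times its mass, but its
    derivative grows linearly in time. *)
Lemma no_global_flow p gamma S : (0 < d)%N -> 1 < gamma ->
  entropic p -> stress_tensor p gamma S -> False.
Proof.
move=> d0 ga1 [Cl Cl0 ent] ST.
have Aex : A !=set0 by exists x0; exact: VA.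
have OA x : A x -> Omega x by move=> /AU /UO.
have [S0 S00 rhoS0] : exists2 S0, 0 <= S0 & forall x, A x -> rho 0 x <= S0.
  have [B B0 rB] := jcont_bounded_compact 0 cA
    (fun t x t0 Ax => flow_rho F t0 (OA x Ax)).
  exists B => // x Ax; apply: le_trans (ler_norm _) _.
  by apply: rB => //; rewrite lexx.
have [Cu' {}ent] := ent S0 S00.
pose Cu := Num.max Cu' 0; have Cu0 : 0 <= Cu by rewrite le_max lexx orbT.
set M := group_mass.
have cutoffs T1 : 0 < T1 -> exists K eta etat etax chi chit chix,
    cutoff_pair Omega u T1 A U K eta etat etax chi chit chix.
  move=> T10; exact: (cutoff_pair_exists oO F (ltW T10) cA oU AU Aex paths).
have M0 : 0 < M.
  have [K [eta [etat [etax [chi [chit [chix C]]]]]]] := cutoffs 1 ltr01.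
  exact: (group_mass_gt0 ltr01 C).
have [D2 D20 sqD2] : exists2 D2, 0 <= D2 & forall x, Omega x -> sqnorm x <= D2.
  have [k kb] : bounded_on_cube c s (fun x : E => sqnorm x).
    apply: continuous_bounded_on_cube => x; apply: continuous_bigsum => i.
    by apply: continuousM_at; exact: coord_continuous_at.
  exists `|k| => // x Ox; apply: le_trans (ler_norm _) _; apply: le_trans (ler_norm _).
  by apply: kb => i; have /andP[h1 h2] := inner i Ox; rewrite !ltW.
pose c1 := M `^ gamma / 2.
have c10 : 0 < c1 by rewrite divr_gt0// powR_gt0.
pose C3 := Cu + Cl * (1 + M) - group_virial.
(* large enough for [T2big]; the constants in it come from the initial group *)
pose T2 := (2 * `|C3| + D2 * M + 1) / c1 + 1.
have T20 : 1 <= T2.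
  by rewrite lerDr divr_ge0 ?(ltW c10)// !addr_ge0// mulr_ge0// ltW.
have T2big : D2 * M < c1 * T2 ^+ 2 - 2 * C3 * T2.
  have e1 : c1 * T2 = 2 * `|C3| + D2 * M + 1 + c1.
    by rewrite /T2; field; rewrite gt_eqF.
  have e2 : D2 * M < c1 * T2 - 2 * C3 by rewrite e1; have := ler_norm C3; lra.
  have D2M : 0 <= D2 * M by rewrite mulr_ge0// ltW.
  have -> : c1 * T2 ^+ 2 - 2 * C3 * T2 = T2 * (c1 * T2 - 2 * C3) by ring.
  apply: lt_le_trans e2 _; rewrite ler_peMl//.
  by rewrite e1; have := ler_norm C3; have := normr_ge0 C3; lra.
(* the cutoffs, and with them [h], are only now chosen, for the interval [0, T1] *)
pose T1 := T2 + 1; have T10 : 0 < T1 by rewrite /T1; lra.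
have [K [eta [etat [etax [chi [chit [chix C]]]]]]] := cutoffs T1 T10.
have KO := cut_sub C.
have cK : compact K.
  apply: (subclosed_compact (cut_closed C) (@cube_compact R d c s)) => x /KO Ox i.
  by have /andP[h1 h2] := inner i Ox; rewrite !ltW.
have [Sm Sm0 rhoB] := jcont_bounded_compact T1 cK
  (fun t x t0 Kx => flow_rho F t0 (KO x Kx)).
have [B B0 divB] : exists2 B, 0 <= B & forall (t : R) (x : E), 0 <= t <= T1 -> K x ->
    `|divergence (u t) x| <= B.
  apply: (jcont_bounded_compact (f := fun t x => divergence (u t) x) T1 cK).
  move=> t x t0 Kx; apply: jcont_sum => i.
  by apply: (flow_u_dx F) => //; exact: KO.
pose delta := c1 / (B + 1).
have B1 : 0 < B + 1 by rewrite ltr_wpDl.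
have delta0 : 0 < delta by rewrite divr_gt0.
have dB : delta * B <= c1.
  rewrite /delta mulrAC ler_pdivrMr// ler_pM2l//; lra.
have [h [h' [h0 dh ch' hp [hlow hup]]]] := ent delta Sm delta0 Sm0.
have rhoB' (t : R) (x : E) : 0 <= t <= T1 -> K x -> rho t x <= Sm.
  by move=> tT Kx; apply: le_trans (ler_norm _) _; exact: rhoB.
have hup' (r : R) : 0 <= r <= S0 -> h r <= Cu.
  by move=> rS; apply: le_trans (hup r rS) _; rewrite le_max lexx.
have growth := momentum_growth T10 C d0 ga1 ST h0 dh ch' hp hlow hup' rhoS0 Cl0 Cu0
  rhoB' divB dB.
pose F2 (r : R) := mean (fun x => chi r x * (rho r x * sqnorm x)).
pose G (r : R) := mean (fun x => chi r x * \sum_k rho r x * u r x 0 k * x 0 k).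
have xc (k : 'I_d) (r : R) (x : E) : jcont (fun _ y => y 0 k) r x.
  by apply: (@jcont_pos R d (fun y : E => y 0 k)); exact: coord_continuous_at.
have F2c := chi_rho_jcont C (f := fun r x => rho r x * sqnorm x).
have {}F2c : jcont_on T1 (fun r x => chi r x * (rho r x * sqnorm x)).
  apply: F2c => r x r0 Ox; apply: jcontM; first exact: (flow_rho F).
  by apply: jcont_sum => i; apply: jcontM; exact: xc.
have T2T1 : 0 <= T2 < T1 by rewrite /T1; apply/andP; split; lra.
have := @time_monotone R T1 (fun r => F2 r + (2 * C3 * r - c1 * r ^+ 2))
  (fun r => 2 * G r + (2 * C3 - c1 * (2 * r))).
move=> /(_ _ _ _ T2 T2T1) mono.
have F20 : 0 <= F2 0.
  have T0 : 0 <= (0 : R) < T1 by rewrite lexx.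
  rewrite -[leLHS](mean_cst c s); apply: (ler_mean s0).
  - by exists 0 => x _; rewrite normr0.
  - exact: (jcont_on_bounded c s F2c T0).
  move=> x _; have [Ox|nOx] := pselect (Omega x).
    by rewrite !mulr_ge0 ?sqnorm_ge0 ?(cut_chi_ge0 C)// (flow_ge0 F).
  by rewrite (cut_chi_supp C) ?mul0r// => /KO.
have F2T2 : F2 T2 <= D2 * M.
  rewrite /M -(mass_conserved C T2T1) -(meanZ s0); last first.
    apply: (jcont_on_bounded c s (T1 := T1) (f := fun r x => chi r x * rho r x)) => //.
    by apply: (chi_rho_jcont C) => r x r0 Ox; exact: (flow_rho F).
  have brho : bounded_on_cube c s (fun x => chi T2 x * rho T2 x).
    apply: (jcont_on_bounded c s (T1 := T1) (f := fun r x => chi r x * rho r x)) => //.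
    by apply: (chi_rho_jcont C) => r x r0 Ox; exact: (flow_rho F).
  apply: (ler_mean s0); [exact: (jcont_on_bounded c s F2c T2T1)|exact: bounded_onZ|].
  move=> x _; have [Ox|nOx] := pselect (Omega x); last first.
    by rewrite (cut_chi_supp C) ?mul0r ?mulr0// => /KO.
  rewrite mulrA mulrC ler_wpM2r ?sqD2// mulr_ge0 ?(cut_chi_ge0 C)//.
  by apply: (flow_ge0 F) => //; lra.
suff : F2 0 <= F2 T2 + (2 * C3 * T2 - c1 * T2 ^+ 2) by lra.
have -> : F2 0 = F2 0 + (2 * C3 * 0 - c1 * 0 ^+ 2) by rewrite !mulr0 expr0n mulr0 subr0 addr0.
apply: mono => [r rT|r rT|r rT].
- apply: cvgD; first exact: (mean_time_continuous s0 F2c).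
  apply: cvg_within_filter; apply: cvgB; first by apply: cvgM; [exact: cvg_cst|exact: cvg_id].
  apply: cvgM; first exact: cvg_cst.
  by apply: cvgM; exact: cvg_id.
- apply: is_deriveD; first exact: (second_moment_derive C rT).
  have did := is_derive_id r (1 : R).
  apply: is_deriveB.
    have := is_deriveZ (2 * C3) did; move/is_derive_eq; apply; exact: mulr1.
  apply: is_deriveZ.
  have := is_deriveM did did; move/is_derive_eq; apply.
  by rewrite -[_ *: _]/(_ * _); ring.
- have /andP[r0 rT1] := rT; have rT' : 0 <= r < T1 by rewrite ltW.
  by have := growth r rT'; rewrite -/M -/c1 -/(G r) /C3; lra.
Qed.

End isolated_mass.

(** * Time derivatives on the half-line *)

Section time_derivatives.
Context {R : realType}.

Lemma tdiff_filter_gt0 (t : R) : 0 < t -> tdiff_filter t = 0^'.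
Proof.
move=> t0; rewrite /tdiff_filter; apply/seteqP; split => A; last first.
  by apply: filterS => h Ah _.
rewrite /within /= => tA; near=> h; have : 0 <= t + h -> A h by near: h.
apply; rewrite -lerBlDl sub0r; near: h; apply: nbhs_dnbhs.
by near=> h; apply: ltW; near: h; apply: lt_nbhsr; rewrite oppr_lt0.
Unshelve. all: by end_near. Qed.

Lemma time_nbhs_tdiff (t : R) (A : set R) : 0 <= t -> A t ->
  (\forall h \near tdiff_filter t, A (t + h)) -> time_nbhs t A.
Proof.
move=> t0 At /nbhs_ballP[e /= e0 eA]; apply/nbhs_ballP; exists e => //= r tr r0.
have [->//|rt] := eqVneq r t.
have trt : t + (r - t) = r by rewrite addrC subrK.
have := eA (r - t); rewrite /= trt; apply => //.
  by rewrite -ball_normE /= sub0r normrN distrC; move: tr; rewrite -ball_normE.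
by rewrite subr_eq0.
Qed.

Context {V : normedModType R}.

#[local] Instance tdiff_is_filter (t : R) : Filter (tdiff_filter t).
Proof. exact: within_filter. Qed.

Lemma tderivable_is_derive (f : R -> V) (t : R) : 0 < t -> tderivable f t ->
  is_derive t 1 f (tderive f t).
Proof.
move=> t0; rewrite /tderivable /tderive tdiff_filter_gt0//.
have -> : (fun h => h^-1 *: (f (t + h) - f t)) =
    (fun h : R => h^-1 *: ((f \o shift t) (h *: (1 : R)) - f t)).
  by apply/funext => h; rewrite /= -[h *: 1]/(h * 1) mulr1 (addrC h t).
by move=> cf; apply: DeriveDef.
Qed.

(** Bounded difference quotients leave room for small increments only. *)
Lemma quotients_uniform {T : Type} (K : set T) (f : R -> T -> V) (g : T -> V) (t B : R) :
  0 <= t -> (forall x, K x -> `|g x| <= B) ->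
  (\forall h \near tdiff_filter t, forall x, K x ->
     `|g x - h^-1 *: (f (t + h) x - f t x)| < 1) ->
  forall eps, 0 < eps ->
  \forall s \near time_nbhs t, forall x, K x -> `|f s x - f t x| <= eps.
Proof.
move=> t0 gB quot eps eps0; apply: time_nbhs_tdiff => //.
  by move=> x _; rewrite subrr normr0 ltW.
have B1 : 0 < `|B| + 1 by rewrite ltr_wpDl.
have e1 : 0 < eps / (`|B| + 1) by rewrite divr_gt0.
have small : \forall h \near tdiff_filter t, h != 0 /\ `|h| <= eps / (`|B| + 1).
  apply: cvg_within; apply: filterI; first exact: (nbhs_dnbhs_neq (0 : R)).
  apply: nbhs_dnbhs; apply/nbhs_ballP; exists (eps / (`|B| + 1)) => // h.
  by rewrite -ball_normE /= sub0r normrN => /ltW.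
near=> h; have [h0 he] : h != 0 /\ `|h| <= eps / (`|B| + 1) by near: h.
have qh : forall x, K x -> `|g x - h^-1 *: (f (t + h) x - f t x)| < 1 by near: h.
move=> x Kx; have -> : f (t + h) x - f t x = h *: (h^-1 *: (f (t + h) x - f t x)).
  by rewrite scalerA mulfV// scale1r.
rewrite normrZ; apply: (@le_trans _ _ (eps / (`|B| + 1) * (`|B| + 1))); last first.
  by rewrite divfK// gt_eqF.
apply: ler_pM => //.
have := qh x Kx; set q := h^-1 *: _ => gq.
have -> : q = g x - (g x - q) by rewrite opprB addrCA subrr addr0.
apply: le_trans (ler_normB _ _) _; apply: lerD; last exact: ltW.
by apply: le_trans (gB x Kx) _; exact: ler_norm.
Unshelve. all: by end_near. Qed.

End time_derivatives.

Section spacetime.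
Context {R : realType} {d : nat} {V : normedModType R}.
Local Notation E := 'rV[R]_d.

Lemma uniform_cvgP {I : Type} (G : set_system I) (FG : Filter G) (K : set E)
    (f : I -> E -> V) (g : E -> V) :
  {uniform K, f @ G --> g} -> forall eps : R, 0 < eps ->
  \forall i \near G, forall x, K x -> `|g x - f i x| < eps.
Proof.
move=> fg eps eps0.
have : nbhs (g : {uniform` K -> V}) [set h | forall x, K x -> `|g x - h x| < eps].
  apply/uniform_nbhs; exists [set p : V * V | ball p.1 eps p.2]; split.
    exact: (entourage_ball V (PosNum eps0)).
  by move=> h gh x Kx; have := gh x Kx; rewrite -ball_normE.
by move=> /fg.
Qed.

Lemma compact_nbhs_in (Omega : set E) (x : E) : open Omega -> Omega x ->
  exists K, [/\ compact K, K `<=` Omega & nbhs x K].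
Proof.
move=> oO Ox; have /nbhs_ballP[r /= r0 rO] : nbhs x Omega by exact: oO.
have r2 : 0 < r / 2 by rewrite divr_gt0.
exists (cube (x - const_mx (r / 2)) r); split; first exact: cube_compact.
  move=> y cy; apply: rO; rewrite -ball_normE /= distrC.
  apply: (@le_lt_trans _ _ (r / 2)); last by lra.
  apply/row_norm_leP; first exact: ltW.
  move=> i; have := cy i; rewrite !mxE => /andP[h1 h2].
  by rewrite ler_norml; apply/andP; split; lra.
apply/nbhs_ballP; exists (r / 2) => // y; rewrite -ball_normE /= distrC => xy i.
have := coord_le_norm (y - x) i; rewrite !mxE => h.
have := le_lt_trans h xy; rewrite ltr_norml => /andP[h1 h2].
by apply/andP; split; lra.
Qed.

(** The limit being continuous, uniformity on a compact neighbourhood of [x]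
    lets both variables move at once. *)
Lemma locally_uniform_joint (Omega : set E) (f : R -> E -> V) (t : R) (x : E) :
  open Omega -> Omega x -> 0 <= t ->
  {within Omega, continuous (f t)} ->
  (forall K, compact K -> K `<=` Omega -> forall eps, 0 < eps ->
     \forall s \near time_nbhs t, forall x, K x -> `|f s x - f t x| <= eps) ->
  f p.1 p.2 @[p --> filter_prod (time_nbhs t) (nbhs x)] --> f t x.
Proof.
move=> oO Ox t0 /subspace_continuousP fc unif.
have {}fc : f t y @[y --> nbhs x] --> f t x.
  by have := fc x Ox; rewrite within_interior//; exact: oO.
have [K [cK KO xK]] := compact_nbhs_in oO Ox.
have F1 := jfilter_filter t x.
apply/cvgrPdist_le => eps eps0; have e2 : 0 < eps / 2 by rewrite divr_gt0.
have near_x : nbhs x [set y | K y /\ `|f t x - f t y| <= eps / 2].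
  by apply: filterI => //; have /cvgrPdist_le := fc; exact.
exists ([set s | forall x, K x -> `|f s x - f t x| <= eps / 2],
  [set y | K y /\ `|f t x - f t y| <= eps / 2]).
  by split => //=; exact: unif.
move=> [s y] /= [sK [Ky xy]].
have -> : f t x - f s y = (f t x - f t y) - (f s y - f t y).
  by rewrite opprB addrA subrK.
by rewrite (splitr eps); apply: le_trans (ler_normB _ _) _; apply: lerD => //; exact: sK.
Qed.

Lemma within_joint (Omega : set E) (f : R -> E -> R) (t : R) (x : E) :
  open Omega -> Omega x -> 0 <= t ->
  {within lifespan +oo%E `*` Omega, continuous (fun p : R * E => f p.1 p.2)} ->
  jcont f t x.
Proof.
move=> oO Ox t0 /subspace_continuousP fc.
have Q0 : (lifespan +oo%E `*` Omega) (t, x) by split => //=; split => //; exact: ltry.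
apply: cvg_trans (fc (t, x) Q0).
apply: cvg_app => B [[A1 A2] /= [tA xA] AB].
exists (A1 `&` [set s | 0 <= s], A2 `&` Omega) => /=.
  split; last exact: (@filterI _ (nbhs x) (nbhs_filter x) _ _ xA (open_nbhs_nbhs (conj oO Ox))).
  have F1 := time_nbhs_filter t.
  apply: (@filterI _ (time_nbhs t) F1); last exact: withinT.
  exact: (@cvg_within _ (nbhs t) (nbhs_filter t)).
move=> [s y] /= [[As s0] [Ay Oy]]; apply: (AB (s, y)) => //=.
by split => //; split => //; exact: ltry.
Qed.

End spacetime.

(** * Regularity of a classical solution *)

Section velocity.
Context {R : realType} {d : nat}.
Local Notation E := 'rV[R]_d.
Variables (Omega : set E) (u ut : R -> E -> E).
Hypothesis oO : open Omega.
Hypothesis u_C1C2 : forall t : R, lifespan +oo%E t ->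
  [/\ Ck 2 Omega (u t), Ck 2 Omega (ut t),
      Ck_cvg 2 Omega (tdiff_filter t) (fun h x => h^-1 *: (u (t + h) x - u t x)) (ut t) &
      Ck_cvg 2 Omega (within (lifespan +oo%E) (nbhs t)) ut (ut t)].

Let life (t : R) : 0 <= t -> lifespan +oo%E t.
Proof. by move=> t0; split => //; exact: ltry. Qed.

#[local] Instance tdiff_filter_filter (t : R) : Filter (tdiff_filter t).
Proof. exact: within_filter. Qed.

#[local] Instance time_filter (t : R) : Filter (time_nbhs t).
Proof. exact: within_filter. Qed.

Lemma continuous_within_bounded (V : normedModType R) (K : set E) (f : E -> V) :
  compact K -> K `<=` Omega -> {within Omega, continuous f} ->
  exists B, forall x, K x -> `|f x| <= B.
Proof.
move=> cK KO fc; have : compact (f @` K).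
  by apply: continuous_compact cK; exact: continuous_subspaceW fc.
move=> /compact_bounded[M [_ fM]]; exists (M + 1) => x Kx.
by apply: (fM (M + 1)); [rewrite ltrDl|exists x].
Qed.

Lemma velocity_uniform (t : R) (K : set E) (eps : R) : 0 <= t -> compact K ->
  K `<=` Omega -> 0 < eps ->
  \forall s \near time_nbhs t, forall x, K x -> `|u s x - u t x| <= eps.
Proof.
move=> t0 cK KO eps0; have [_ [utc _] [uq _] _] := u_C1C2 (life t0).
have [B utB] := continuous_within_bounded cK KO utc.
apply: (quotients_uniform t0 utB _ eps0).
exact: (uniform_cvgP _ (uq K cK KO) ltr01).
Qed.

(** The difference quotients of [u] converge together with their gradients. *)
Lemma velocity_grad_uniform (t : R) i (K : set E) (eps : R) : 0 <= t -> compact K ->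
  K `<=` Omega -> 0 < eps ->
  \forall s \near time_nbhs t, forall x, K x ->
    `|'D_(basis i) (u s) x - 'D_(basis i) (u t) x| <= eps.
Proof.
move=> t0 cK KO eps0.
have [[_ /(_ i)[du _]] [_ /(_ i)[_ [utc _]]] [_ /(_ i)[uq _]] _] := u_C1C2 (life t0).
have [B utB] := continuous_within_bounded cK KO utc.
apply: (quotients_uniform t0 utB _ eps0).
have h0 : \forall h \near tdiff_filter t, 0 <= t + h by exact: withinT.
have := uniform_cvgP _ (uq K cK KO) ltr01.
move=> quot; near=> h => x Kx.
have th : 0 <= t + h by near: h.
have [[_ /(_ i)[duh _]] _ _ _] := u_C1C2 (life th).
have Ox := KO x Kx.
have <- : 'D_(basis i) (fun x => h^-1 *: (u (t + h) x - u t x)) x =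
    h^-1 *: ('D_(basis i) (u (t + h)) x - 'D_(basis i) (u t) x).
  rewrite -(deriveB (duh x Ox) (du x Ox)) -deriveZ//.
  by apply: derivableB; [exact: duh|exact: du].
have : forall x, K x -> `|'D_(basis i) (ut t) x -
    'D_(basis i) (fun x => h^-1 *: (u (t + h) x - u t x)) x| < 1 by near: h; exact: quot.
exact.
Unshelve. all: by end_near. Qed.

Let joint_coord (f : R -> E -> E) (t : R) (x : E) k :
  f p.1 p.2 @[p --> filter_prod (time_nbhs t) (nbhs x)] --> f t x ->
  jcont (fun r y => f r y 0 k) t x.
Proof.
move=> fc; apply: (cvg_comp (fun p => f p.1 p.2) (fun v : E => v 0 k) fc).
exact: coord_continuous_at.
Qed.

Lemma velocity_jcont (t : R) (x : E) k : 0 <= t -> Omega x ->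
  jcont (fun r y => u r y 0 k) t x.
Proof.
move=> t0 Ox; apply: joint_coord; have [[uc _] _ _ _] := u_C1C2 (life t0).
apply: (locally_uniform_joint oO Ox t0 uc) => K cK KO eps eps0.
exact: velocity_uniform.
Qed.

Lemma velocity_dt_jcont (t : R) (x : E) k : 0 <= t -> Omega x ->
  jcont (fun r y => ut r y 0 k) t x.
Proof.
move=> t0 Ox; apply: joint_coord; have [_ [utc _] _ [utq _]] := u_C1C2 (life t0).
apply: (locally_uniform_joint oO Ox t0 utc) => K cK KO eps eps0.
have FW : Filter (within (lifespan +oo%E) (nbhs t)) by exact: within_filter.
have := uniform_cvgP FW (utq K cK KO) eps0.
apply: (@filterS _ (nbhs t) (nbhs_filter t)) => s H s0 y Ky.
by rewrite distrC; apply/ltW/H => //; exact: life.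
Qed.

Lemma velocity_coord_derivable (t : R) (x : E) i k : 0 <= t -> Omega x ->
  derivable (fun y => u t y 0 k) x (basis i) /\
  'D_(basis i) (fun y => u t y 0 k) x = 'D_(basis i) (u t) x 0 k.
Proof.
move=> t0 Ox; have [[_ /(_ i)[du _]] _ _ _] := u_C1C2 (life t0).
have dux := du x Ox; split; last by rewrite (derive_mx dux) mxE.
by have /derivable_mxP := dux; exact.
Qed.

Lemma velocity_dx_jcont (t : R) (x : E) i k : 0 <= t -> Omega x ->
  jcont (fun r y => 'D_(basis i) (fun z => u r z 0 k) y) t x.
Proof.
move=> t0 Ox; have [[_ /(_ i)[_ [duc _]]] _ _ _] := u_C1C2 (life t0).
have jD : jcont (fun r y => 'D_(basis i) (u r) y 0 k) t x.
  apply: (@joint_coord (fun r y => 'D_(basis i) (u r) y)).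
  apply: (@locally_uniform_joint R d E Omega (fun r y => 'D_(basis i) (u r) y) t x oO Ox t0).
    exact: duc.
  by move=> K cK KO eps eps0; exact: velocity_grad_uniform.
rewrite /jcont; have [_ ->] := velocity_coord_derivable i k t0 Ox.
apply: cvg_trans jD; apply: near_eq_cvg.
exists ([set s | 0 <= s], Omega) => /=.
  by split; [exact: withinT|exact: open_nbhs_nbhs].
by move=> [s y] /= [s0' Oy]; have [_ ->] := velocity_coord_derivable i k s0' Oy.
Qed.

Lemma velocity_diff (t : R) (x : E) k : 0 <= t -> Omega x ->
  differentiable (fun y => u t y 0 k) x.
Proof.
move=> t0 Ox; apply: continuous_partials_differentiable => [|i].
  apply: (@filterS _ (nbhs x) (nbhs_filter x) Omega); last exact: open_nbhs_nbhs.
  by move=> y Oy i; have [] := velocity_coord_derivable i k t0 Oy.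
apply: (@jcont_slice R d (fun r y => 'D_(basis i) (fun z => u r z 0 k) y) t x t0).
exact: velocity_dx_jcont.
Qed.

Lemma velocity_dt (t : R) (x : E) k : 0 < t -> Omega x ->
  is_derive t 1 (fun r => u r x 0 k) (ut t x 0 k).
Proof.
move=> t0 Ox; have [_ _ [uq _] _] := u_C1C2 (life (ltW t0)).
have cx : compact [set x] by exact: compact_set1.
have xO : [set x] `<=` Omega by move=> y ->.
have quot : h^-1 *: (u (t + h) x - u t x) @[h --> tdiff_filter t] --> ut t x.
  apply/cvgrPdist_lt => eps eps0.
  have quot := uniform_cvgP _ (uq _ cx xO) eps0.
  near=> h; have quoth : forall y, [set x] y ->
    `|ut t y - h^-1 *: (u (t + h) y - u t y)| < eps by near: h; exact: quot.
  exact: quoth.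
have du : is_derive t 1 (fun r => u r x) (ut t x).
  have PF : ProperFilter (tdiff_filter t) by rewrite tdiff_filter_gt0 //; exact _.
  have cu : tderivable (fun r => u r x) t by apply/cvg_ex; exists (ut t x).
  have := tderivable_is_derive t0 cu; move/is_derive_eq; apply.
  exact: cvg_lim quot.
have [dud <-] := du; rewrite derive_mx// mxE.
by apply: derivableP; have /derivable_mxP := dud; exact.
Unshelve. all: by end_near. Qed.

End velocity.

(** A classical solution for all times provides what the virial argument needs:
    joint continuity in time and space of the functions and of their first
    derivatives. *)
Lemma classical_regular_flow {R : realType} {d : nat} (Omega : set 'rV[R]_d)
    (mu lambda : R -> R) (gamma : R) (bc : boundary_condition)
    (rho0 : 'rV[R]_d -> R) (u0 : 'rV[R]_d -> 'rV[R]_d)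
    (rho : R -> 'rV[R]_d -> R) (u : R -> 'rV[R]_d -> 'rV[R]_d) :
  open Omega ->
  classical_solution Omega mu lambda gamma bc rho0 u0 +oo%E rho u ->
  exists ut, regular_flow Omega rho (fun t x => tderive (rho ^~ x) t) u ut.
Proof.
move=> oO [rho_ge0 [rc rdt rdx rtc rxc] [ut uC] NS _ _].
have life (t : R) : 0 <= t -> lifespan +oo%E t by move=> t0; split => //; exact: ltry.
have rho_dx (t : R) x i : 0 <= t -> Omega x ->
    {for x, continuous ('D_(basis i) (rho t))}.
  move=> t0 Ox; apply: (@jcont_slice R d (fun t x => 'D_(basis i) (rho t) x) t x t0).
  exact: (within_joint oO Ox t0 (rxc i)).
have rho_diff (t : R) x : 0 <= t -> Omega x -> differentiable (rho t) x.
  move=> t0 Ox; apply: continuous_partials_differentiable => [|i]; last exact: rho_dx.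
  apply: (@filterS _ (nbhs x) (nbhs_filter x) Omega); last exact: open_nbhs_nbhs.
  by move=> y Oy i; apply: rdx; split => //=; exact: life.
exists ut; split.
- by move=> t x t0 Ox; apply: rho_ge0 => //; exact: life.
- by move=> t x t0 Ox; exact: (within_joint oO Ox t0 rc).
- by move=> t x t0 Ox; exact: (within_joint oO Ox t0 rtc).
- move=> t x t0 Ox; apply: tderivable_is_derive => //.
  by apply: rdt; split => //=; apply: life; exact: ltW.
- exact: rho_diff.
- exact: rho_dx.
- by move=> t x k; exact: (velocity_jcont oO uC).
- by move=> t x k; exact: (velocity_dt_jcont oO uC).
- by move=> t x k; exact: (velocity_dt uC).
- by move=> t x k; exact: (velocity_diff oO uC).
- by move=> t x i k; exact: (velocity_dx_jcont oO uC).
move=> t x t0 Ox; have [mass_eq _ _ _] := NS t x (life t (ltW t0)) Ox.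
rewrite -[RHS]mass_eq; congr (_ + _); apply: eq_bigr => i _.
rewrite (_ : (fun y => (rho t y *: u t y) 0 i) = (rho t) * (fun y => u t y 0 i)); last first.
  by apply/funext => y; rewrite mxE.
have [dui _] := velocity_coord_derivable uC i i (ltW t0) Ox.
rewrite deriveM//; last exact/diff_derivable/rho_diff/Ox/ltW.
by rewrite addrC; congr (_ + _); exact: mulrC.
Qed.

(** * The stress tensor of the Navier-Stokes system *)

Lemma near_eq_differentiable {R : realType} {V W : normedModType R} (f g : V -> W) x :
  (\forall y \near x, f y = g y) -> differentiable f x -> differentiable g x.
Proof.
move=> fg df; have -> : g = f \+ (g \- f) by apply/funext => y /=; rewrite addrCA subrr addr0.
apply: differentiableD => //; apply: differentiable_flat => eps eps0.
have fgx := nbhs_singleton fg.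
apply: (@filterS _ (nbhs x) (nbhs_filter x) _ _ _ fg) => y fgy.
by rewrite /= fgy fgx !subrr normr0 mulr_ge0// ltW.
Qed.

(** The density may vanish, where [s ^ gamma] has only a one-sided derivative;
    extending it by 0 makes the chain rule available. *)
Lemma derivable_powR_pos {R : realType} (gamma s : R) : 1 < gamma ->
  derivable (fun s : R => Num.max s 0 `^ gamma) s 1.
Proof.
move=> ga1; have ga0 : 0 < gamma by rewrite (lt_trans ltr01).
have [s0|s0|->] := ltgtP s 0.
- apply/derivable1_diffP; apply: (@near_eq_differentiable R R R (cst 0)).
    near=> r; rewrite max_r; first by rewrite powR0// gt_eqF.
    by apply: ltW; near: r; exact: lt_nbhsl.
  exact: differentiable_cst.
- apply/derivable1_diffP.
  apply: (@near_eq_differentiable R R R (fun r => r `^ gamma)).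
    near=> r; rewrite max_l//.
    by apply: ltW; near: r; exact: lt_nbhsr.
  by apply/derivable1_diffP; have [] := is_derive1_powR gamma s0.
apply/derivable1_diffP; apply: differentiable_flat => eps eps0.
have g10 : 0 < gamma - 1 by rewrite subr_gt0.
pose e := eps `^ (gamma - 1)^-1; have e0 : 0 < e by exact: powR_gt0.
apply/nbhs_ballP; exists e => //= y; rewrite -ball_normE /= sub0r normrN => ye.
rewrite maxxx powR0 ?gt_eqF// !subr0.
have [y0|y0] := leP y 0; first by rewrite powR0 ?gt_eqF// normr0 mulr_ge0// ltW.
rewrite gtr0_norm// in ye; rewrite ger0_norm ?powR_ge0// gtr0_norm//.
rewrite -(mulr_powRB1 (ltW y0) ga0) mulrC ler_pM2r//.
have -> : eps = e `^ (gamma - 1) by rewrite /e -powRrM mulVf ?gt_eqF// powRr1// ltW.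
by apply: ge0_ler_powR; rewrite ?nnegrE ?(ltW g10) ?(ltW y0) ?(ltW e0) ?(ltW ye).
Unshelve. all: by end_near. Qed.

Section navier_stokes.
Context {R : realType} {d : nat}.
Local Notation E := 'rV[R]_d.
Variables (Omega : set E) (a b alpha beta gamma : R).
Variables (rho : R -> E -> R) (u ut : R -> E -> E).
Hypothesis oO : open Omega.
Hypotheses (al0 : 0 < alpha) (be0 : 0 < beta) (ga1 : 1 < gamma).
Local Notation rhot := (fun t x => tderive (rho ^~ x) t).
Local Notation mu := (fun r : R => a * r `^ alpha).
Local Notation lambda := (fun r : R => b * r `^ beta).
Hypothesis F : regular_flow Omega rho rhot u ut.
Hypothesis NS : forall (t : R) (x : E), 0 < t -> Omega x ->
  navier_stokes mu lambda gamma rho u t x.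

Definition viscous_stress t y : 'M[R]_d := (2 * mu (rho t y)) *: sym_grad (u t) y.
Definition bulk_stress t y : R := lambda (rho t y) * divergence (u t) y.

(** Minus the total momentum flux, pressure and convection included. *)
Definition total_stress t (k j : 'I_d) (y : E) : R :=
  viscous_stress t y k j + (k == j)%:R * (bulk_stress t y - rho t y `^ gamma)
  - rho t y * (u t y 0 k * u t y 0 j).

Lemma pressure_differentiable (t : R) (x : E) : 0 <= t -> Omega x ->
  differentiable (fun y => rho t y `^ gamma) x.
Proof.
move=> t0 Ox; pose pw (s : R) := Num.max s 0 `^ gamma.
apply: (@near_eq_differentiable R E R (pw \o rho t)).
  apply: (@filterS _ (nbhs x) (nbhs_filter x) Omega); last exact: open_nbhs_nbhs.
  by move=> y Oy; rewrite /pw /= max_l// (flow_ge0 F).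
apply: differentiable_comp; first exact: (flow_rho_diff F).
exact/derivable1_diffP/derivable_powR_pos.
Qed.

Lemma entry_differentiable (M : E -> 'M[R]_d) (x : E) k j :
  differentiable M x -> differentiable (fun y => M y k j) x.
Proof.
move=> dM; apply: (@differentiable_comp _ _ _ _ M (fun N : 'M[R]_d => N k j)) => //.
exact: differentiable_coord.
Qed.

Lemma total_stress_diff (t : R) k j (x : E) : 0 < t -> Omega x ->
  differentiable (total_stress t k j) x.
Proof.
move=> t0 Ox; have [_ dv db _] := NS t0 Ox.
apply: differentiableB; last first.
  apply: differentiableM; first exact: (flow_rho_diff F (ltW t0)).
  by apply: differentiableM; exact: (flow_u_diff F _ (ltW t0)).
apply: differentiableD; first exact: entry_differentiable.
apply: differentiableM; first exact: differentiable_cst.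
by apply: differentiableB => //; exact: (pressure_differentiable (ltW t0)).
Qed.

Lemma momentum_dt (t : R) (x : E) k : 0 < t -> Omega x ->
  tderive (fun s => rho s x *: u s x) t 0 k
    = rhot t x * u t x 0 k + rho t x * ut t x 0 k.
Proof.
move=> t0 Ox.
have dk i : is_derive t 1 (fun r => (rho r x *: u r x) 0 i)
    (rhot t x * u t x 0 i + rho t x * ut t x 0 i).
  have -> : (fun r => (rho r x *: u r x) 0 i) = (rho ^~ x) * (fun r => u r x 0 i).
    by apply/funext => r; rewrite mxE.
  have := is_deriveM (flow_rho_dt F t0 Ox) (flow_u_dt F i t0 Ox).
  move/is_derive_eq; apply; rewrite addrC; congr (_ + _); exact: mulrC.
have dv : derivable (fun r => rho r x *: u r x) t 1.
  by apply/derivable_mxP => i j; rewrite (ord1 i); exact: (@ex_derive _ _ _ _ _ _ _ (dk j)).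
have -> : tderive (fun s => rho s x *: u s x) t = 'D_1 (fun r => rho r x *: u r x) t.
  rewrite /tderive tdiff_filter_gt0// /derive.
  suff -> : (fun h => h^-1 *: (rho (t + h) x *: u (t + h) x - rho t x *: u t x)) =
    (fun h : R => h^-1 *: (((fun r => rho r x *: u r x) \o shift t) (h *: (1 : R))
                           - rho t x *: u t x)) by [].
  by apply/funext => h; rewrite /= -[h *: 1]/(h * 1) mulr1 (addrC h t).
rewrite derive_mx// mxE.
by rewrite (@derive_val _ _ _ _ _ _ _ (dk k)).
Qed.

(** The momentum equation, expanded: [(rho u)_t] is the divergence of the total
    stress. *)
Lemma total_stress_div (t : R) k (x : E) : 0 < t -> Omega x ->
  \sum_j 'D_(basis j) (total_stress t k j) x
    = rhot t x * u t x 0 k + rho t x * ut t x 0 k.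
Proof.
move=> t0 Ox; have [_ dv db /rowP/(_ k)] := NS t0 Ox.
rewrite !mxE momentum_dt//.
set m := _ + rho t x * _; set conv := \sum_j _; set visc := \sum_j _.
set gb := 'D_(basis k) _ x; set gp := 'D_(basis k) _ x => eq0.
suff -> : \sum_j 'D_(basis j) (total_stress t k j) x = visc + (gb - gp) - conv by lra.
have dvk j : differentiable (fun y => viscous_stress t y k j) x by exact: entry_differentiable.
have dP := pressure_differentiable (ltW t0) Ox.
have dbP : differentiable (fun y => bulk_stress t y - rho t y `^ gamma) x.
  by apply: differentiableB.
have dru j : differentiable (fun y => rho t y * (u t y 0 k * u t y 0 j)) x.
  apply: differentiableM; first exact: (flow_rho_diff F (ltW t0)).
  by apply: differentiableM; exact: (flow_u_diff F _ (ltW t0)).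
have dS j : 'D_(basis j) (total_stress t k j) x =
   'D_(basis j) (fun y => viscous_stress t y k j) x
   + (k == j)%:R * 'D_(basis j) (fun y => bulk_stress t y - rho t y `^ gamma) x
   - 'D_(basis j) (fun y => rho t y * (u t y 0 k * u t y 0 j)) x.
  have der (f : E -> R) : differentiable f x ->
      is_derive x (basis j) f ('D_(basis j) f x).
    by move=> df; apply: derivableP; exact: diff_derivable.
  have dZ := is_deriveZ (k == j)%:R (der _ dbP).
  have := is_deriveB (is_deriveD (der _ (dvk j)) dZ) (der _ (dru j)).
  by move=> H; rewrite (@derive_val _ _ _ _ _ _ _ H).
rewrite (eq_bigr _ (fun j _ => dS j)) sumrB big_split /=; congr (_ + _ - _).
- rewrite (bigD1 k) //= eqxx mul1r big1 ?addr0; last first.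
    by move=> j; rewrite eq_sym => /negbTE ->; rewrite mul0r.
  rewrite deriveB//; exact: diff_derivable.
- apply: eq_bigr => j _; congr ('D_(_) _ x); apply/funext => y.
  by rewrite !mxE big_ord1 mxE.
Qed.

Lemma total_stress_trace (t : R) (x : E) : 0 < t -> Omega x ->
  \sum_k total_stress t k k x =
  (2 * a * rho t x `^ alpha + d%:R * b * rho t x `^ beta) * divergence (u t) x
   - rho t x * sqnorm (u t x) - d%:R * rho t x `^ gamma.
Proof.
move=> t0 Ox; rewrite /total_stress sumrB big_split /=.
have -> : \sum_k viscous_stress t x k k = 2 * mu (rho t x) * divergence (u t) x.
  rewrite /divergence mulr_sumr; apply: eq_bigr => k _.
  by rewrite /viscous_stress /sym_grad !mxE; field.
have -> : \sum_(k < d) (k == k)%:R * (bulk_stress t x - rho t x `^ gamma) =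
    d%:R * (bulk_stress t x - rho t x `^ gamma).
  under eq_bigr do rewrite eqxx mul1r.
  by rewrite sumr_const card_ord mulr_natl.
have -> : \sum_k rho t x * (u t x 0 k * u t x 0 k) = rho t x * sqnorm (u t x).
  by rewrite mulr_sumr; apply: eq_bigr => k _; rewrite expr2.
by rewrite /bulk_stress; ring.
Qed.

Lemma total_stress_vacuum (t : R) k j (x : E) : rho t x = 0 -> total_stress t k j x = 0.
Proof.
move=> r0; rewrite /total_stress /viscous_stress /bulk_stress r0 /=.
have zero (q : R) : 0 < q -> 0 `^ q = 0 :> R by move=> q0; rewrite powR0// gt_eqF.
rewrite !zero ?(lt_trans ltr01 ga1)// !mulr0 !mul0r scale0r mxE.
by rewrite subrr mulr0 addr0 subr0.
Qed.

Lemma total_stress_tensor : stress_tensor Omega rho rhot u ut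
  (fun r => 2 * a * r `^ alpha + d%:R * b * r `^ beta) gamma total_stress.
Proof.
split.
- exact: total_stress_diff.
- exact: total_stress_div.
- by move=> t k j x _ _; exact: total_stress_vacuum.
- exact: total_stress_trace.
Qed.

End navier_stokes.

(** When [2 mu + d lambda] is nonnegative, either [b >= 0] or the two powers
    agree: otherwise the negative term would win at 0 or at infinity. *)
Lemma viscosity_entropic {R : realType} (d : nat) (a b alpha beta : R) :
  0 < a -> 0 <= 2 * a + d%:R * b -> 0 < alpha -> 0 < beta ->
  (forall r : R, 0 <= r -> 0 <= 2 * (a * r `^ alpha) + d%:R * (b * r `^ beta)) ->
  entropic (fun r => 2 * a * r `^ alpha + d%:R * b * r `^ beta).
Proof.
move=> a0 ab0 al0 be0 ge0.
have [<-|alN] := eqVneq alpha beta.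
  under eq_fun do rewrite -mulrDl.
  by apply: entropicZ => //; exact: entropic_powR.
suff db0 : 0 <= d%:R * b.
  by apply: entropicD; apply: entropicZ => //;
    [rewrite mulr_ge0// ltW|exact: entropic_powR|exact: entropic_powR].
rewrite leNgt; apply/negP => db0.
(* at [r ^ (beta - alpha) = k] the sum equals [d b r ^ alpha < 0] *)
pose k := 2 * a / - (d%:R * b) + 1.
have db0' : 0 < - (d%:R * b) by rewrite oppr_gt0.
have k0 : 0 < k by rewrite ltr_wpDl// divr_ge0 ?mulr_ge0 ?ltW.
have bN : beta - alpha != 0 by rewrite subr_eq0 eq_sym.
pose r := k `^ (beta - alpha)^-1; have r0 : 0 < r by exact: powR_gt0.
have rk : r `^ (beta - alpha) = k by rewrite -powRrM mulVf// powRr1// ltW.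
have rbe : r `^ beta = r `^ alpha * k.
  rewrite -{1}(subrK alpha beta) addrC powRD ?rk//.
  by apply/implyP => _; rewrite gt_eqF.
have := ge0 r (ltW r0); rewrite rbe.
have -> : 2 * (a * r `^ alpha) + d%:R * (b * (r `^ alpha * k)) =
  r `^ alpha * (2 * a - - (d%:R * b) * k) by ring.
rewrite pmulr_rge0 ?powR_gt0//.
have -> : - (d%:R * b) * k = 2 * a - d%:R * b.
  by rewrite /k mulrDr mulr1 mulrC divfK// gt_eqF.
by lra.
Qed.

(** * Blow-up *)

(** Continuity up to [t = 0] follows from the convergence of the difference
    quotients there. *)
Lemma particle_path_of {R : realType} {d : nat} (Omega : set 'rV[R]_d)
    (u : R -> 'rV[R]_d -> 'rV[R]_d) (X : R -> 'rV[R]_d) :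
  (forall t, lifespan +oo%E t ->
    [/\ Omega (X t), tderivable X t & tderive X t = u t (X t)]) ->
  path_of Omega u X.
Proof.
move=> HX; have life (t : R) : 0 <= t -> lifespan +oo%E t by move=> t0; split => //; exact: ltry.
split.
- by move=> t t0; have [] := HX t (life t t0).
- move=> t t0; have [_ cX _] := HX t (life t t0).
  have FT := time_nbhs_filter t.
  have FD : Filter (tdiff_filter t) by exact: within_filter.
  apply/cvgrPdist_le => eps eps0.
  have quot : \forall h \near tdiff_filter t, forall y : unit, setT y ->
      `|tderive X t - h^-1 *: (X (t + h) - X t)| < 1.
    have /cvgrPdist_lt/(_ 1 ltr01) := cX.
    by apply: filterS => h hq _ _.
  have := @quotients_uniform R _ unit setT (fun s _ => X s) (fun _ => tderive X t)
    t `|tderive X t| t0 (fun _ _ => lexx _) quot eps eps0.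
  by apply: filterS => s /(_ tt I); rewrite distrC.
move=> t i t0; have [_ dX Xu] := HX t (life t (ltW t0)).
have [dud dE] := tderivable_is_derive t0 dX.
rewrite -Xu -dE derive_mx// mxE.
by apply: derivableP; have /derivable_mxP := dud; exact.
Qed.

Lemma integral_rV_gt0_ex {R : realType} {d : nat} (V : set 'rV[R]_d)
    (f : 'rV[R]_d -> R) :
  (forall x, V x -> 0 <= f x) -> (0 < integral_rV V f)%E ->
  exists2 x, V x & 0 < f x.
Proof.
move=> f0 If; apply: contrapT => noV; move: If.
rewrite /integral_rV integral0_eq ?ltxx// => t Vt; congr (_%:E).
apply/eqP; rewrite eq_le f0// andbT leNgt; apply/negP => ft.
by apply: noV; eexists; eauto.
Qed.

Lemma bounded_in_cube {R : realType} {d : nat} (W : set 'rV[R]_d) :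
  bounded_set W -> exists c : 'rV[R]_d, exists2 s : R, 0 < s &
  forall x j, W x -> c 0 j < x 0 j < c 0 j + s.
Proof.
move=> [N [_ WN]]; pose B := `|N| + 1.
have B0 : 0 < B by rewrite ltr_wpDl.
have WB x : W x -> `|x| <= B by apply: WN; rewrite ltr_pwDr// ler_norm.
exists (const_mx (- (B + 1))), (2 * (B + 1)); first by rewrite mulr_gt0// addr_gt0.
move=> x j Wx; have := le_trans (coord_le_norm x j) (WB x Wx).
by rewrite !mxE ler_norml => /andP[h1 h2]; apply/andP; split; lra.
Qed.

Theorem theorem2p4 (R : realType) (d : nat) (Omega : set 'rV[R]_d)
    (gamma a b alpha beta : R) (bc : boundary_condition)
    (rho0 : 'rV[R]_d -> R) (u0 : 'rV[R]_d -> 'rV[R]_d) (T : \bar R)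
    (rho : R -> 'rV[R]_d -> R) (u : R -> 'rV[R]_d -> 'rV[R]_d)
    (U V : set 'rV[R]_d)
    (mu := fun r : R => a * r `^ alpha) (lambda := fun r : R => b * r `^ beta) :
  (2 <= d)%N ->
  bounded_smooth_domain Omega ->
  1 < gamma ->
  0 < a ->
  0 <= 2 * a + d%:R * b ->
  (forall r : R, 0 <= r -> 0 <= mu r /\ 0 <= 2 * mu r + d%:R * lambda r) ->
  maximal_classical_solution Omega mu lambda gamma bc rho0 u0 T rho u ->
  particle_paths_stay Omega U T u ->
  isolated_mass_group Omega rho0 U V ->
  [\/ [/\ alpha = beta, 0 < alpha, 2 * a + d%:R * b = 0
        & mass V rho0 \is a fin_num],
      [/\ 0 < alpha <= gamma, 0 < beta <= gamma,
          mass V rho0 \is a fin_num & energy gamma V rho0 u0 \is a fin_num]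
    | exists kappa : R,
      [/\ (d = 2%N /\ 1 <= kappa < 2) \/
          ((3 <= d)%N /\ kappa = (d%:R + 2) / d%:R),
          alpha = beta /\ gamma < alpha <= kappa * gamma,
          2 * a * (alpha - 1) = b &
          [/\ mass V rho0 \is a fin_num, energy gamma V rho0 u0 \is a fin_num
            & bd_energy mu gamma V rho0 u0 \is a fin_num]]] ->
  (T < +oo)%E.
Proof.
move=> d2 [oO _ bO _] ga1 a0 ab0 visc [_ sol _] paths.
move=> [[oU oV bU bV] [VU UO _] vac IV] cases.
have [al0 be0] : 0 < alpha /\ 0 < beta.
  case: cases => [[<-]//|[/andP[-> _] /andP[-> _]]//|[kappa [_ [<- /andP[al _]] _ _]]].
  by split; exact: (lt_trans (lt_trans ltr01 ga1) al).
have [Toy|Tfin] := eqVneq T +oo%E; last by rewrite lt_neqAle Tfin leey.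
exfalso; rewrite {}Toy in sol paths.
have life (t : R) : 0 <= t -> lifespan +oo%E t by move=> t0; split => //; exact: ltry.
have [ut F] := classical_regular_flow oO sol.
have NS (t : R) (x : 'rV[R]_d) : 0 < t -> Omega x ->
    navier_stokes mu lambda gamma rho u t x.
  by move=> /ltW/life; exact: (pointwise_system sol).
have UsO : U `<=` Omega by move=> x Ux; exact/UO/subset_closure.
have rho00 x : U x -> rho 0 x = rho0 x.
  by move=> /UsO Ox; have [] := initial_condition sol Ox.
have VsU : V `<=` U by move=> x Vx; exact/VU/subset_closure.
have [x0 Vx0 rx0] : exists2 x, V x & 0 < rho0 x.
  apply: integral_rV_gt0_ex IV => x /VsU Ux.
  by rewrite -rho00//; apply: (flow_ge0 F) => //; exact: UsO.
have [c [s s0 inner]] := bounded_in_cube bO.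
have cA : compact (closure V).
  apply: bounded_closed_compact; last exact: closed_closure.
  have [N [Nreal UN]] := bU.
  by exists N; split => // N' NN' y /VU; exact: UN.
apply: (no_global_flow F s0 inner oO cA oU VU (@subset_closure _ V) UsO _ _ Vx0 _ _ ga1
  (viscosity_entropic a0 ab0 al0 be0 _) (total_stress_tensor oO al0 be0 ga1 F NS)).
- move=> y Vy; have [X [Xy HX]] := paths y (subset_closure (VU y Vy)).
  by exists X => //; exact: particle_path_of.
- by move=> x Ux Vx; rewrite rho00//; exact: vac.
- by rewrite rho00//; exact: VsU.
- exact: ltnW.
- by move=> r r0; have [] := visc r r0.
Qed.
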